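(* Let $R>0$, $m\in\mathbb N$, $\alpha>-1$ and $\beta=\beta_0+p$ with $\beta_0\in(-1,0]$, $p\in\mathbb N$. The reproducing kernel of the Hilbert space $\mathcal D^2_m(\mathbb D_R,\mu^R_{\alpha,\beta})$ is given by $\mathbb K_{\alpha,\beta}^{m,R}(z,w)=\mathcal K_{\alpha,\beta}^{m,R}(z\overline{w})$ ($z,w\in\mathbb D_R^*$), where $$\mathcal K_{\alpha,\beta}^{m,R}(\xi)=\sum_{n=0}^{m-1}\frac{(\alpha+\beta+2)_n}{(\beta+1)_n}\left(\frac{\xi}{R^2}\right)^n+\frac{\xi^m}{(m!)^2}\ {}_4F_3\left(\left.\begin{array}{c}1,1,1,\alpha+\beta+2\\ m+1,m+1,\beta+1\end{array}\right|\frac{\xi}{R^2}\right)+A_{\alpha,\beta}^{m,R}(\xi)$$ with $A_{\alpha,\beta}^{m,R}(\xi)=0$ if $p\le m$, and, if $p>m$, $$A_{\alpha,\beta}^{m,R}(\xi)=R^{2m}\sum_{k=0}^{p-m-1}\frac{\Gamma(\alpha+\beta+1-m-k)}{\Gamma(\beta-m-k)}\,\frac{\Gamma(\beta+1)}{\Gamma(\alpha+\beta+2)}\left(\frac{k!}{(m+k)!}\right)^2\left(\frac{R^2}{\xi}\right)^{k+1}.$$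
   Context: $\mathbb N=\{0,1,2,\dots\}$. $\mathbb D_R=\{z\in\mathbb C:|z|<R\}$, $\mathbb D_R^*=\mathbb D_R\setminus\{0\}$, $dA(z)=\frac1\pi\,dx\,dy$, $\mathscr B$ is the beta function. For $\alpha,\beta>-1$, $\mu^R_{\alpha,\beta}$ is the probability measure on $\mathbb D_R$ $$d\mu^R_{\alpha,\beta}(z)=\frac{|z|^{2\beta}(R^2-|z|^2)^\alpha}{R^{2(\alpha+\beta+1)}\mathscr B(\alpha+1,\beta+1)}\,dA(z).$$ $\mathcal A^2(\mathbb D_R,\mu^R_{\alpha,\beta})$ is the space of holomorphic functions on $\mathbb D_R^*$ that are square integrable with respect to $\mu^R_{\alpha,\beta}$, with the inner product $\langle f,g\rangle_{\mu^R_{\alpha,\beta}}=\int_{\mathbb D_R}f\overline g\,d\mu^R_{\alpha,\beta}$. $\mathcal D^2_m(\mathbb D_R,\mu^R_{\alpha,\beta})$ is the space of holomorphic functions $f$ on $\mathbb D_R^*$ such that $f^{(m)}\in\mathcal A^2(\mathbb D_R,\mu^R_{\alpha,\beta})$. Every such $f$ has a Laurent expansion $f(z)=\sum_{n\ge\min(0,m-p)}a_nz^n$; write $f=f_1+f_2$ with $f_1(z)=\sum_{n=0}^{m-1}a_nz^n$ and $f_2=f-f_1$. The space carries the inner product $$\langle f,g\rangle_{m,\mu^R_{\alpha,\beta}}=\langle f_1,g_1\rangle_{\mu^R_{\alpha,\beta}}+\langle f_2^{(m)},g_2^{(m)}\rangle_{\mu^R_{\alpha,\beta}}.$$ $(a)_n=a(a+1)\cdots(a+n-1)$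 is the Pochhammer symbol, and ${}_kF_j\left(\left.\begin{array}{c}a_1,\dots,a_k\\ b_1,\dots,b_j\end{array}\right|\xi\right)=\sum_{n=0}^{\infty}\frac{(a_1)_n\cdots(a_k)_n}{(b_1)_n\cdots(b_j)_n}\frac{\xi^n}{n!}$. *)

(* Defs.v *)
From HB Require Import structures.
From mathcomp Require Import all_boot all_order all_algebra.
From mathcomp Require Import complex.
From mathcomp Require Import all_classical all_reals all_analysis.

Set Implicit Arguments.
Unset Strict Implicit.
Unset Printing Implicit Defensive.

Import Order.TTheory GRing.Theory Num.Theory.
Import numFieldNormedType.Exports.

Local Open Scope classical_set_scope.
Local Open Scope ring_scope.
Local Open Scope complex_scope.

(* The topology of the complex plane is the one every numFieldType carries; it
   is inferred for the alias [CC R] but not for the bare type [R[i]]. *)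
Definition CC (R : realType) : numFieldType := R[i].

Section Defs.
Context {R : realType}.

Definition rtoc (x : R) : CC R := x%:C.

Definition conj (z : CC R) : CC R := conjc z.

(* [`|z|] lives in [CC R] and has zero imaginary part. *)
Definition modulus (z : CC R) : R := complex.Re `|z|.

Definition of_plane (u : R * R) : CC R := u.1 +i* u.2.

Definition disc (r : R) : set (CC R) := [set z | modulus z < r].

Definition pdisc (r : R) : set (CC R) := disc r `\ 0.

(* The Euler integrals, used below at positive arguments only. *)
Definition Beta (a b : R) : R :=
  \int[lebesgue_measure]_(t in `]0, 1[) (t `^ (a - 1) * (1 - t) `^ (b - 1)).

Definition Gamma (a : R) : R :=
  \int[lebesgue_measure]_(t in `]0, +oo[) (t `^ (a - 1) * expR (- t)).

Definition pochhammer (a : R) (n : nat) : R := \prod_(i < n) (a + i%:R).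

Definition hypergeometric (a b : seq R) (xi : CC R) : CC R :=
  limn (series (fun n : nat =>
    rtoc ((\prod_(c <- a) pochhammer c n) / (\prod_(c <- b) pochhammer c n))
      * (xi ^+ n / n`!%:R))).

Definition lebesgue2 := ((@lebesgue_measure R) \x (@lebesgue_measure R))%E.

(* The density of mu^r_{alpha,beta} with respect to dx dy; the factor 1 / pi
   comes from dA = dx dy / pi. *)
Definition mu_density (r alpha beta : R) (z : CC R) : R :=
  modulus z `^ (2 * beta) * (r ^+ 2 - modulus z ^+ 2) `^ alpha
    / (r `^ (2 * (alpha + beta + 1)) * Beta (alpha + 1) (beta + 1)) / pi.

(* Functions on the punctured disc are represented by total functions: only
   their restriction to [pdisc r] matters, the origin being a null set. *)

Definition mu_integral (r alpha beta : R) (f : CC R -> R) : R :=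
  \int[lebesgue2]_(u in of_plane @^-1` disc r)
    (f (of_plane u) * mu_density r alpha beta (of_plane u)).

Definition mu_cintegral (r alpha beta : R) (f : CC R -> CC R) : CC R :=
  mu_integral r alpha beta (fun z => complex.Re (f z))
    +i* mu_integral r alpha beta (fun z => complex.Im (f z)).

(* [derivable f z 1] over the field [CC R] is complex differentiability. *)
Definition holomorphic_on (U : set (CC R)) (f : CC R -> CC R) : Prop :=
  forall z, U z -> derivable f z 1.

(* The integrand is measurable because [f] is continuous on [pdisc r]. *)
Definition mu_square_integrable (r alpha beta : R) (f : CC R -> CC R) : Prop :=
  (\int[lebesgue2]_(u in of_plane @^-1` disc r)
    (modulus (f (of_plane u)) ^+ 2 * mu_density r alpha beta (of_plane u))%:E
    < +oo)%E.

Definition bergman (r alpha beta : R) : set (CC R -> CC R) :=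
  [set f | holomorphic_on (pdisc r) f /\ mu_square_integrable r alpha beta f].

Definition bergman_ip (r alpha beta : R) (f g : CC R -> CC R) : CC R :=
  mu_cintegral r alpha beta (fun z => f z * conj (g z)).

Definition bergman_dirichlet (r : R) (m : nat) (alpha beta : R) :
    set (CC R -> CC R) :=
  [set f | holomorphic_on (pdisc r) f /\ bergman r alpha beta (derive1n m f)].

(* [Negz n] is the integer - (n + 1). *)
Definition laurent_expansion (r : R) (f : CC R -> CC R) (a : int -> CC R) :
    Prop :=
  forall z, pdisc r z -> exists s t : CC R,
    [/\ series (fun n : nat => a n%:Z * z ^+ n) @ \oo --> s,
        series (fun n : nat => a (Negz n) * z ^- n.+1) @ \oo --> t
      & f z = s + t].

(* A function holomorphic on [pdisc r] has exactly one Laurent expansion there,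
   so that no actual choice takes place. *)
Definition laurent_coef (r : R) (f : CC R -> CC R) : int -> CC R :=
  xget (fun=> 0) [set a | laurent_expansion r f a].

Definition taylor_part (r : R) (m : nat) (f : CC R -> CC R) : CC R -> CC R :=
  fun z => \sum_(n < m) laurent_coef r f n%:Z * z ^+ n.

Definition remainder_part (r : R) (m : nat) (f : CC R -> CC R) :
    CC R -> CC R :=
  fun z => f z - taylor_part r m f z.

Definition bergman_dirichlet_ip (r : R) (m : nat) (alpha beta : R)
    (f g : CC R -> CC R) : CC R :=
  bergman_ip r alpha beta (taylor_part r m f) (taylor_part r m g)
  + bergman_ip r alpha beta
      (derive1n m (remainder_part r m f))
      (derive1n m (remainder_part r m g)).

Definition reproducing_kernel (X : set (CC R)) (H : set (CC R -> CC R))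
    (ip : (CC R -> CC R) -> (CC R -> CC R) -> CC R)
    (K : CC R -> CC R -> CC R) : Prop :=
  forall w, X w ->
    H (K ^~ w) /\ (forall f, H f -> f w = ip f (K ^~ w)).

Definition kernel_principal (r : R) (m p : nat) (alpha beta : R) (xi : CC R) :
    CC R :=
  if (p <= m)%N then 0 else
  rtoc (r ^+ (2 * m)) * \sum_(k < p - m)
    rtoc (Gamma (alpha + beta + 1 - m%:R - k%:R) / Gamma (beta - m%:R - k%:R)
          * (Gamma (beta + 1) / Gamma (alpha + beta + 2))
          * (k`!%:R / (m + k)`!%:R) ^+ 2)
    * (rtoc (r ^+ 2) / xi) ^+ k.+1.

Definition kernel_profile (r : R) (m p : nat) (alpha beta : R) (xi : CC R) :
    CC R :=
  \sum_(n < m) rtoc (pochhammer (alpha + beta + 2) n / pochhammer (beta + 1) n)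
     * (xi / rtoc (r ^+ 2)) ^+ n
  + xi ^+ m / (m`!%:R ^+ 2)
    * hypergeometric [:: 1; 1; 1; alpha + beta + 2]
                     [:: m%:R + 1; m%:R + 1; beta + 1] (xi / rtoc (r ^+ 2))
  + kernel_principal r m p alpha beta xi.

End Defs.

(* Main.v *)
Require Import Defs.
From HB Require Import structures.
From mathcomp Require Import all_boot all_order all_algebra.
From mathcomp Require Import complex.
From mathcomp Require Import all_classical all_reals all_analysis.
From mathcomp Require Import measurable_realfun.
From mathcomp Require Import zify ring lra.
Set Implicit Arguments.
Unset Strict Implicit.
Unset Printing Implicit Defensive.
Import Order.TTheory GRing.Theory Num.Theory.
Import numFieldNormedType.Exports.
Local Open Scope classical_set_scope.
Local Open Scope ring_scope.

(** In [bergman_dirichlet r m alpha beta] the monomials [z^n] are orthogonal and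
    every function is the sum of its Laurent series, so the kernel has to be the
    sum over [n] of [z^n conj(w)^n] divided by the squared norm of [z^n], taken
    over the degrees in which that norm is finite. The proof makes this precise
    for Laurent series, and then computes the norms.

    A holomorphic function on the punctured disc has a Laurent expansion
    ([laurent_sum_integral]). Cauchy's theorem for rectangles
    ([rect_integral_eq0], by bisection), read in logarithmic coordinates, makes
    the mean of [f(z) z^(- n)] over the circle of radius [rho] independent of
    [rho]; these means are the coefficients. The expansion at [z0] is obtained
    from the coefficients of the difference quotient [(f(z) - f(z0)) / (z - z0)]:
    in terms of those the partial sums of the expansion of [f] at [z0]
    telescope. Conversely, coefficients that are bounded on every circle define
    a holomorphic function, differentiable term by term ([laurent_sum_derive]).

    The measure is rotation invariant. A rotation is a product of shears, so it
    preserves the area ([ge0_integral_rotation]), and distinct monomials are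
    orthogonal on every annulus ([wint_orthogonal]). In the variable [s = |z|^2]
    the area measure is [pi ds] ([pushforward_qsq]), so that up to normalisation
    the squared norm of [z^n] in the Bergman space is the Euler integral of
    [s^(beta + n) (r^2 - s)^alpha] over the interval from 0 to [r^2]. It is finite exactly when
    [n >= - p], because [beta - p = beta0] lies between -1 and 0, and
    integration by parts relates the norms in consecutive degrees
    ([monomial_normS]). Going up from degree 0 gives quotients of Pochhammer
    symbols ([monomial_norm_nat]), going down gives quotients of values of the
    Gamma function ([monomial_norm_neg]).

    On an annulus the energy of a Laurent series dominates the energy of each
    of its monomials ([moment_energy_le]), hence a square integrable series has
    no term of degree less than [- p] ([bergman_coef_eq0]). For a square
    integrable series with coefficients [b] and one with coefficients [kappa]
    whose partial sums are dominated by a multiple of [|z|^(- p)], the inner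
    product is the sum over [n] of [b n * conj (kappa n)] times the squared norm
    of [z^n] ([bergman_ip_series]).

    The inner product of the Dirichlet space is the sum of one such pairing for
    the Taylor parts and of another one for the [m]-th derivatives. With the
    coefficients [kernel_coef] the two pairings return, degree by degree, the
    terms [a n * w^n] of the expansion of [f] at [w]: the degrees from 0 to
    [m - 1] come from the first pairing, and the others from the second, since
    the [m]-th derivative kills exactly the former
    ([bergman_dirichlet_reproducing]). Finally the nonnegative degrees of
    [kernel_coef] sum up to the polynomial and the hypergeometric series of the
    closed form, and the finitely many negative ones to its principal part
    ([kernel_profile_laurent_sum]). *)

(** * Modulus, convergence and differentiability in the complex plane *)
Section ComplexPlane.
Context {R : realType}.
Implicit Types (z w : CC R) (x y : R).

HB.instance Definition _ := GRing.isZmodMorphism.Build R (CC R) rtoc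
  (rmorphB (real_complex R)).
HB.instance Definition _ := GRing.isMonoidMorphism.Build R (CC R) rtoc
  (rmorphism_monoidP (real_complex R)).
HB.instance Definition _ := GRing.isZmodMorphism.Build (CC R) (CC R) conj
  (@conjc_is_additive R).
HB.instance Definition _ := GRing.isMonoidMorphism.Build (CC R) (CC R) conj
  (rmorphism_monoidP (@conjc R)).

Lemma norm_rtoc z : `|z| = rtoc (modulus z).
Proof. by rewrite /modulus /rtoc; move: (normc_def z) => ->. Qed.

Lemma modulus_def z :
  modulus z = Num.sqrt (complex.Re z ^+ 2 + complex.Im z ^+ 2).
Proof. by rewrite /modulus; move: (normc_def z) => ->. Qed.

Lemma rtoc_inj : injective (@rtoc R).
Proof. exact: complexI. Qed.

Lemma rtoc_eq0 x : (rtoc x == 0) = (x == 0).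
Proof. by rewrite -(inj_eq rtoc_inj) rmorph0. Qed.

Lemma ler_rtoc x y : (rtoc x <= rtoc y) = (x <= y).
Proof. exact: lecR. Qed.

Lemma ltr_rtoc x y : (rtoc x < rtoc y) = (x < y).
Proof. exact: ltcR. Qed.

Lemma rtocM_Re x z : complex.Re (rtoc x * z) = x * complex.Re z.
Proof. by case: z => a b /=; rewrite mul0r subr0. Qed.

Lemma rtocM_Im x z : complex.Im (rtoc x * z) = x * complex.Im z.
Proof. by case: z => a b /=; rewrite mul0r addr0. Qed.

Lemma ReD z w : complex.Re (z + w) = complex.Re z + complex.Re w.
Proof. by case: z; case: w. Qed.
Lemma ImD z w : complex.Im (z + w) = complex.Im z + complex.Im w.
Proof. by case: z; case: w. Qed.
Lemma ReN z : complex.Re (- z) = - complex.Re z.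
Proof. by case: z. Qed.
Lemma ImN z : complex.Im (- z) = - complex.Im z.
Proof. by case: z. Qed.
Lemma ReM z w : complex.Re (z * w) =
  complex.Re z * complex.Re w - complex.Im z * complex.Im w.
Proof. by case: z; case: w. Qed.
Lemma ImM z w : complex.Im (z * w) =
  complex.Re z * complex.Im w + complex.Im z * complex.Re w.
Proof. by case: z; case: w => /= a b c d; rewrite addrC (addrC (_ * _)). Qed.
Lemma complex_ext z w :
  complex.Re z = complex.Re w -> complex.Im z = complex.Im w -> z = w.
Proof. by case: z; case: w => /= a b c d -> ->. Qed.

Lemma modulus_ge0 z : 0 <= modulus z.
Proof. by rewrite modulus_def sqrtr_ge0. Qed.

Lemma modulus_sqr z :
  modulus z ^+ 2 = complex.Re z ^+ 2 + complex.Im z ^+ 2.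
Proof. by rewrite modulus_def sqr_sqrtr// addr_ge0// sqr_ge0. Qed.

Lemma modulusM z w : modulus (z * w) = modulus z * modulus w.
Proof. by apply: rtoc_inj; rewrite rmorphM/= -!norm_rtoc normrM. Qed.

Lemma modulus_rtoc x : modulus (rtoc x) = `|x|.
Proof. by rewrite modulus_def/= expr0n addr0 sqrtr_sqr. Qed.

Lemma modulus0 : modulus (0 : CC R) = 0.
Proof. by rewrite -(rmorph0 rtoc) modulus_rtoc normr0. Qed.

Lemma modulus1 : modulus (1 : CC R) = 1.
Proof. by rewrite -(rmorph1 rtoc) modulus_rtoc normr1. Qed.

Lemma modulus_nat (n : nat) : modulus (n%:R : CC R) = n%:R.
Proof. by rewrite -(rmorph_nat rtoc) modulus_rtoc normr_nat. Qed.

Lemma modulusX z (n : nat) : modulus (z ^+ n) = modulus z ^+ n.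
Proof.
by elim: n => [|n ih]; rewrite ?expr0 ?modulus1// !exprS modulusM ih.
Qed.

Lemma modulusV z : modulus z^-1 = (modulus z)^-1.
Proof. by apply: rtoc_inj; rewrite fmorphV/= -!norm_rtoc normfV. Qed.

Lemma modulusN z : modulus (- z) = modulus z.
Proof. by apply: rtoc_inj; rewrite -!norm_rtoc normrN. Qed.

Lemma modulusB z w : modulus (z - w) = modulus (w - z).
Proof. by rewrite -modulusN opprB. Qed.

Lemma modulus_eq0 z : (modulus z == 0) = (z == 0).
Proof. by rewrite -(inj_eq rtoc_inj) rmorph0 -norm_rtoc normr_eq0. Qed.

Lemma modulus_gt0 z : (0 < modulus z) = (z != 0).
Proof. by rewrite lt_neqAle modulus_ge0 andbT eq_sym modulus_eq0. Qed.

Lemma le_modulusD z w : modulus (z + w) <= modulus z + modulus w.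
Proof. by rewrite -ler_rtoc rmorphD/= -!norm_rtoc ler_normD. Qed.

Lemma le_modulusB z w : modulus (z - w) <= modulus z + modulus w.
Proof. by rewrite (le_trans (le_modulusD _ _))// modulusN. Qed.

Lemma le_modulus_sum I (s : seq I) P (F : I -> CC R) :
  modulus (\sum_(i <- s | P i) F i) <= \sum_(i <- s | P i) modulus (F i).
Proof.
elim/big_ind2 : _ => //; first by rewrite modulus0.
by move=> ? ? ? ? h1 h2; rewrite (le_trans (le_modulusD _ _))// lerD.
Qed.

Lemma modulus_conj z : modulus (conj z) = modulus z.
Proof. by rewrite !modulus_def; case: z => a b /=; rewrite sqrrN. Qed.

Lemma mul_conj z : z * conj z = rtoc (modulus z ^+ 2).
Proof.
apply: complex_ext; rewrite ?ReM ?ImM modulus_sqr; case: z => a b /=; ring.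
Qed.

Lemma conjK z : conj (conj z) = z.
Proof. exact: conjcK. Qed.

Lemma conj_rtoc x : conj (rtoc x) = rtoc x.
Proof. exact: conjc_real. Qed.

Lemma Re_le_modulus z : `|complex.Re z| <= modulus z.
Proof.
rewrite modulus_def -sqrtr_sqr ler_wsqrtr// lerDl sqr_ge0 //.
Qed.

Lemma Im_le_modulus z : `|complex.Im z| <= modulus z.
Proof.
rewrite modulus_def -sqrtr_sqr ler_wsqrtr// lerDr sqr_ge0 //.
Qed.

Lemma modulus_le_ReIm z : modulus z <= `|complex.Re z| + `|complex.Im z|.
Proof.
rewrite -(@ler_pXn2r _ 2)// ?nnegrE ?modulus_ge0 ?addr_ge0//.
rewrite modulus_sqr -[X in X + _]real_normK ?num_real//.
rewrite -[X in _ + X]real_normK ?num_real// sqrrD.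
by rewrite addrAC lerDl mulrn_wge0// mulr_ge0.
Qed.

(** The norm of the field takes complex values; convergence is thereby expressed
    through real numbers. *)
Lemma cvgC_modulus T (F : set_system T) {FF : Filter F} (f : T -> CC R) (l : CC R) :
  f @ F --> l <-> (fun t => modulus (f t - l)) @ F --> (0 : R).
Proof.
split.
  move=> /cvgrPdist_lt fl; apply/cvgrPdist_lt => e e0.
  have := fl (rtoc e); rewrite -(rmorph0 rtoc) ltr_rtoc => /(_ e0).
  apply: filterS => t; rewrite norm_rtoc ltr_rtoc => h.
  by rewrite sub0r normrN ger0_norm ?modulus_ge0// modulusB.
move=> /cvgrPdist_lt fl; apply/cvgrPdist_lt => e e0.
have eE : e = rtoc (complex.Re e).
  by case: e e0 => a b /=; rewrite ltcE/= => /andP[/eqP-> _].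
have := fl (complex.Re e); rewrite eE -(rmorph0 rtoc) ltr_rtoc in e0 *.
move=> /(_ e0); apply: filterS => t.
rewrite sub0r normrN ger0_norm ?modulus_ge0// => h.
by rewrite norm_rtoc ltr_rtoc modulusB.
Qed.

Lemma cvgC_ReIm T (F : set_system T) {FF : Filter F} (f : T -> CC R) (l : CC R) :
  f @ F --> l <-> ((fun t => complex.Re (f t)) @ F --> complex.Re l /\
                   (fun t => complex.Im (f t)) @ F --> complex.Im l).
Proof.
rewrite cvgC_modulus; split=> [fl|[fl1 fl2]].
  split; apply/cvgrPdist_lt => e e0; move/cvgrPdist_lt : fl => /(_ e e0);
    apply: filterS => t; rewrite sub0r normrN ger0_norm ?modulus_ge0// => h;
    rewrite distrC -?ReN -?ImN -?ReD -?ImD.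
  - exact: le_lt_trans (Re_le_modulus _) h.
  - exact: le_lt_trans (Im_le_modulus _) h.
have fl3 : (fun t => `|complex.Re (f t) - complex.Re l| +
    `|complex.Im (f t) - complex.Im l|) @ F --> (0 : R).
  rewrite -[X in _ --> X](addr0 0); apply: cvgD; rewrite -(normr0 R) ;
    apply: cvg_norm; apply/subr_cvg0; rewrite ?subrr//.
apply: (squeeze_cvgr _ (cvg_cst (0:R)) fl3).
apply: nearW => t; rewrite modulus_ge0/= (le_trans (modulus_le_ReIm _))//.
by rewrite ReD ImD ReN ImN.
Qed.

Lemma cvg_rtoc T (F : set_system T) {FF : Filter F} (f : T -> R) (l : R) :
  f @ F --> l -> (fun t => rtoc (f t)) @ F --> rtoc l.
Proof. by move=> fl; apply/cvgC_ReIm; split => //=; exact: cvg_cst. Qed.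

Lemma cvgC_conj T (F : set_system T) {FF : Filter F} (f : T -> CC R) (l : CC R) :
  f @ F --> l -> (fun t => conj (f t)) @ F --> conj l.
Proof.
move=> /cvgC_modulus fl; apply/cvgC_modulus; apply: cvg_trans fl.
by apply: near_eq_cvg; apply: nearW => t; rewrite -rmorphB modulus_conj.
Qed.

Lemma cvg_modulus T (F : set_system T) {FF : Filter F} (f : T -> CC R) (l : CC R) :
  f @ F --> l -> (fun t => modulus (f t)) @ F --> modulus l.
Proof.
move=> /cvg_norm fl.
have [+ _] := (cvgC_ReIm _ _).1 fl.
by apply: cvg_trans; apply: near_eq_cvg; exact: nearW.
Qed.

Lemma Re_sum I (s : seq I) P (F : I -> CC R) :
  complex.Re (\sum_(i <- s | P i) F i) = \sum_(i <- s | P i) complex.Re (F i).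
Proof. by elim/big_ind2 : _ => // ? ? ? ? <- <-; rewrite ReD. Qed.
Lemma Im_sum I (s : seq I) P (F : I -> CC R) :
  complex.Im (\sum_(i <- s | P i) F i) = \sum_(i <- s | P i) complex.Im (F i).
Proof. by elim/big_ind2 : _ => // ? ? ? ? <- <-; rewrite ImD. Qed.

(** An absolutely convergent complex series converges: its real and imaginary
    parts do. *)
Lemma cvg_seriesC (u : nat -> CC R) (b : nat -> R) :
  (forall n, modulus (u n) <= b n) -> cvgn (series b) ->
  cvgn (series u).
Proof.
move=> ub cb.
have h (f : nat -> R) : (forall n, `|f n| <= b n) -> cvgn (series f).
  move=> fb; apply: normed_cvg; apply: series_le_cvg cb => n //=.
  exact: le_trans (fb n).
have c1 := h _ (fun n => le_trans (Re_le_modulus _) (ub n)).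
have c2 := h _ (fun n => le_trans (Im_le_modulus _) (ub n)).
apply/cvg_ex; exists (Complex (limn (series (fun n => complex.Re (u n))))
   (limn (series (fun n => complex.Im (u n)))) : CC R).
apply/cvgC_ReIm; split => /=; [move: c1|move: c2]; apply: cvg_trans;
  apply: near_eq_cvg; apply: nearW => n; rewrite /series/= ?Re_sum ?Im_sum//.
Qed.

Lemma nearC (z : CC R) (P : CC R -> Prop) :
  (\forall w \near z, P w) <->
  exists2 d : R, 0 < d & forall w, modulus (w - z) < d -> P w.
Proof.
split=> [/nbhs_normP[e /= e0 eP]|[d d0 dP]].
  have eE : e = rtoc (complex.Re e).
    by case: e e0 {eP} => a b /=; rewrite ltcE/= => /andP[/eqP-> _].
  exists (complex.Re e); first by rewrite eE -(rmorph0 rtoc) ltr_rtoc in e0.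
  by move=> w hd; apply: eP; rewrite /= eE norm_rtoc ltr_rtoc modulusB.
apply/nbhs_normP; exists (rtoc d) => /=; first by rewrite -(rmorph0 rtoc) ltr_rtoc.
by move=> w /=; rewrite norm_rtoc ltr_rtoc modulusB; exact: dP.
Qed.

(** Differentiability as an estimate of the linear approximation, without
    division: in this form the case of a zero increment needs no exception. *)
Lemma is_deriveCP (f : CC R -> CC R) (z d : CC R) :
  is_derive z 1 f d <->
  forall e : R, 0 < e -> exists2 dl : R, 0 < dl & forall h, modulus h < dl ->
    modulus (f (z + h) - f z - d * h) <= e * modulus h.
Proof.
split=> [[df fd] e e0|H].
  have : h^-1 *: ((f \o shift z) (h *: (1:CC R)) - f z) @[h --> 0^'] --> d.
    by rewrite -fd; exact: df.
  move=> /cvgrPdist_le/(_ (rtoc e)).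
  rewrite -(rmorph0 rtoc) ltr_rtoc => /(_ e0).
  move=> /nearC[dl dl0 H]; exists dl => // h hdl.
  have [->|h0] := eqVneq h 0.
    by rewrite addr0 mulr0 !subrr modulus0 mulr0.
  have := H h; rewrite subr0 => /(_ hdl h0); rewrite norm_rtoc ler_rtoc/= => H1.
  have -> : f (z + h) - f z - d * h =
     - (d - h^-1 *: (f (h *: (1 : CC R) + z) - f z)) * h.
    rewrite /GRing.scale/= mulr1 opprB mulrBl mulrAC mulVf// mul1r.
    by rewrite (addrC h).
  by rewrite modulusM modulusN ler_wpM2r ?modulus_ge0.
have fd : h^-1 *: ((f \o shift z) (h *: (1:CC R)) - f z) @[h --> 0^'] --> d.
  apply/cvgrPdist_le => e e0.
  have eE : e = rtoc (complex.Re e).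
    by case: e e0 => a b /=; rewrite ltcE/= => /andP[/eqP-> _].
  rewrite eE -(rmorph0 rtoc) ltr_rtoc in e0 *.
  have [dl dl0 {}H] := H _ e0; rewrite rmorph0.
  apply/nearC; exists dl => // h; rewrite subr0 => hdl /= h0.
  rewrite norm_rtoc ler_rtoc.
  rewrite -(@ler_pM2r _ (modulus h)) ?modulus_gt0// -modulusM.
  rewrite (le_trans _ (H h hdl))// -modulusN.
  rewrite /GRing.scale/= mulr1 -mulNr opprB mulrBl mulrAC mulVf// mul1r.
  by rewrite (addrC h).
split; first by apply/cvg_ex; exists d.
by apply/cvg_lim.
Qed.

End ComplexPlane.

(** * Sums of two-sided power series *)
Section LaurentSums.
Context {R : realType}.
Implicit Types (z w : CC R) (a : int -> CC R) (r s x y : R) (f : CC R -> CC R).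

(** Bounded terms on every circle of the punctured disc. This is what Laurent
    expansions and circle means provide directly, and moving the radius a little
    turns it into geometric decay. *)
Definition growth (r : R) a := forall rho, 0 < rho -> rho < r ->
  exists C : R, forall n : int, modulus (a n) * rho ^ n <= C.

(** The terms of degrees [k] and [- (k + 1)] are summed together, so that a
    two-sided series is an ordinary one. *)
Definition laurent_term a z (k : nat) : CC R :=
  a k%:Z * z ^ k%:Z + a (Negz k) * z ^ Negz k.

Definition laurent_sum a z : CC R := limn (series (laurent_term a z)).

Lemma modulusXz z (n : int) : modulus (z ^ n) = modulus z ^ n.
Proof. by case: n => n; rewrite ?modulusV modulusX. Qed.

Lemma exprz_Posz_le (x y : R) (k : nat) : 0 <= x -> x <= y -> x ^ k%:Z <= y ^ k%:Z.
Proof. by move=> x0 xy; rewrite lerXn2r// nnegrE (le_trans x0). Qed.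

Lemma exprz_Negz_le (x y : R) (k : nat) : 0 < x -> x <= y ->
  y ^ Negz k <= x ^ Negz k.
Proof.
move=> x0 xy; rewrite /exprz lef_pV2 ?posrE ?exprn_gt0// ?(lt_le_trans x0)//.
by rewrite lerXn2r// nnegrE ltW// (lt_le_trans x0).
Qed.

Lemma geometric_sum_le (q : R) n : 0 <= q -> q < 1 ->
  \sum_(i < n) q ^+ i <= (1 - q)^-1.
Proof.
move=> q0 q1; rewrite -[leRHS]mul1r ler_pdivlMr ?subr_gt0//.
have -> : (\sum_(i < n) q ^+ i) * (1 - q) = 1 - q ^+ n.
  by rewrite mulrC -opprB mulNr -subrX1 opprB.
by rewrite lerBlDr lerDl exprn_ge0.
Qed.

(** A factor [k + 1] is absorbed by a slightly larger ratio: with [q = u * s]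
    the number [(k + 1) u^k] is at most a geometric sum of ratio [u]. *)
Lemma natM_geometric_le (q : R) : 0 <= q -> q < 1 ->
  exists D s : R, [/\ 0 <= D, 0 <= s, s < 1 &
    forall k : nat, k.+1%:R * q ^+ k <= D * s ^+ k].
Proof.
move=> q0 q1; pose s := (1 + q) / 2; pose u := q / s.
have s0 : 0 < s by rewrite /s; lra.
have u0 : 0 <= u by rewrite /u divr_ge0// ltW.
have u1 : u < 1 by rewrite /u ltr_pdivrMr// mul1r /s; lra.
exists (1 - u)^-1, s; split => //; first by rewrite invr_ge0 subr_ge0 ltW.
- exact: ltW.
- by rewrite /s; lra.
move=> k; rewrite (_ : q = u * s); last by rewrite /u divfK// gt_eqF.
rewrite exprMn mulrA ler_wpM2r ?exprn_ge0 ?(ltW s0)//.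
apply: le_trans (geometric_sum_le k.+1 u0 u1).
rewrite mulr_natl -[X in _ *+ X]card_ord -sumr_const ler_sum// => i _.
by rewrite ler_wiXn2l// ?(ltW u1)// -ltnS.
Qed.

(** On a closed annulus the terms are compared with those on a slightly smaller
    and a slightly larger circle, which makes them uniformly geometric. *)
Lemma growth_bound r a r1 r2 : growth r a -> 0 < r1 -> r1 <= r2 -> r2 < r ->
  exists C q : R, [/\ 0 <= C, 0 <= q, q < 1 &
    forall k x, r1 <= x -> x <= r2 ->
      modulus (a k%:Z) * x ^ k%:Z <= C * q ^+ k /\
      modulus (a (Negz k)) * x ^ Negz k <= C * q ^+ k].
Proof.
move=> ga r10 r12 r2r.
pose s1 := r1 / 2; pose s2 := (r2 + r) / 2.
have s10 : 0 < s1 by rewrite /s1; lra.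
have s20 : 0 < s2 by rewrite /s2; lra.
have s1r1 : s1 < r1 by rewrite /s1; lra.
have r2s2 : r2 < s2 by rewrite /s2; lra.
have s2r : s2 < r by rewrite /s2; lra.
clearbody s1 s2.
have [C1 hC1] := ga s1 s10 ltac:(lra).
have [C2 hC2] := ga s2 s20 ltac:(lra).
have C10 : 0 <= C1 by apply: le_trans (hC1 0); rewrite mulr_ge0 ?modulus_ge0 ?exprz_ge0 ?ltW//.
have C20 : 0 <= C2 by apply: le_trans (hC2 0); rewrite mulr_ge0 ?modulus_ge0 ?exprz_ge0 ?ltW//.
pose q := Num.max (s1 / r1) (r2 / s2).
have q0 : 0 <= q by rewrite le_max (divr_ge0 (ltW s10) (ltW r10)).
exists (C1 + C2), q; split; [exact: addr_ge0|exact: q0| |].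
  rewrite gt_max !ltr_pdivrMr// !mul1r s1r1 r2s2//.
move=> k x r1x xr2; have x0 : 0 < x by apply: lt_le_trans r1x.
split.
  have : x ^ k%:Z <= s2 ^ k%:Z * q ^+ k.
    rewrite /exprz -exprMn lerXn2r ?nnegrE ?mulr_ge0 ?(ltW x0) ?(ltW s20)//.
    rewrite mulrC -ler_pdivrMr// le_max; apply/orP; right.
    by rewrite ler_wpM2r// invr_ge0 ltW.
  move=> h; apply: (le_trans (ler_wpM2l (modulus_ge0 _) h)).
  rewrite mulrA ler_wpM2r ?exprn_ge0//.
  by rewrite (le_trans (hC2 _))// lerDr.
have : x ^ Negz k <= s1 ^ Negz k * q ^+ k.
  have h : s1 ^+ k.+1 <= x ^+ k.+1 * q ^+ k.
    have s1q : s1 <= x * q.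
      rewrite mulrC -ler_pdivrMr// le_max; apply/orP; left.
      by rewrite ler_pM2l// lef_pV2 ?posrE.
    rewrite exprS [x ^+ k.+1]exprS -mulrA -exprMn.
    rewrite ler_pM ?exprn_ge0 ?(ltW s10)//; first by rewrite (le_trans (ltW s1r1)).
    by rewrite lerXn2r ?nnegrE ?mulr_ge0 ?(ltW x0) ?(ltW s10).
  rewrite /exprz mulrC ler_pdivlMr ?exprn_gt0// mulrC ler_pdivrMr ?exprn_gt0//.
  by rewrite mulrC.
move=> h; apply: (le_trans (ler_wpM2l (modulus_ge0 _) h)).
rewrite mulrA ler_wpM2r ?exprn_ge0//.
by rewrite (le_trans (hC1 _))// lerDl.
Qed.

Lemma cvg_geometric_seriesM (C q : R) : 0 <= q -> q < 1 ->
  cvgn (series (fun k => C * q ^+ k)).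
Proof. by move=> q0 q1; apply: is_cvg_geometric_series; rewrite ger0_norm. Qed.

Lemma growth_cvg r a z : growth r a -> z != 0 -> modulus z < r ->
  [/\ cvgn (series (fun k : nat => a k%:Z * z ^ k%:Z)),
      cvgn (series (fun k : nat => a (Negz k) * z ^ Negz k)) &
      series (laurent_term a z) @ \oo --> laurent_sum a z].
Proof.
move=> ga z0 zr; have z1 : 0 < modulus z by rewrite modulus_gt0.
have [C [q [C0 q0 q1 H]]] := growth_bound ga z1 (lexx _) zr.
have c := @cvg_geometric_seriesM C q q0 q1.
have c1 : cvgn (series (fun k : nat => a k%:Z * z ^ k%:Z)).
  apply: cvg_seriesC c => n; rewrite modulusM modulusXz.
  by have [] := H n _ (lexx _) (lexx _).
have c2 : cvgn (series (fun k : nat => a (Negz k) * z ^ Negz k)).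
  apply: cvg_seriesC c => n; rewrite modulusM modulusXz.
  by have [] := H n _ (lexx _) (lexx _).
split; [exact: c1|exact: c2|].
have E : series (laurent_term a z) = series (fun k : nat => a k%:Z * z ^ k%:Z)
    + series (fun k : nat => a (Negz k) * z ^ Negz k).
  by rewrite -seriesD.
by rewrite /laurent_sum E; exact: (is_cvgD c1 c2).
Qed.

Lemma laurent_sum_split r a z : growth r a -> z != 0 -> modulus z < r ->
  laurent_sum a z = limn (series (fun k : nat => a k%:Z * z ^ k%:Z)) +
    limn (series (fun k : nat => a (Negz k) * z ^ Negz k)).
Proof.
move=> ga z0 zr; have [c1 c2 _] := growth_cvg ga z0 zr.
have E : series (laurent_term a z) = series (fun k : nat => a k%:Z * z ^ k%:Z)
    + series (fun k : nat => a (Negz k) * z ^ Negz k).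
  by rewrite -seriesD.
by rewrite /laurent_sum E; exact: limD c1 c2.
Qed.

Lemma laurent_expansion_sum r a f : growth r a ->
  (forall z, pdisc r z -> f z = laurent_sum a z) -> laurent_expansion r f a.
Proof.
move=> ga fa z [zr z0]; have {}z0 : z != 0 by apply/eqP.
have [c1 c2 _] := growth_cvg ga z0 zr.
exists (limn (series (fun k : nat => a k%:Z * z ^ k%:Z))),
  (limn (series (fun k : nat => a (Negz k) * z ^ Negz k))).
split; [exact: c1|exact: c2|].
by rewrite fa; [rewrite (laurent_sum_split ga)|split=> //; exact/eqP].
Qed.

(** Where a power series converges its terms are bounded, so pointwise
    convergence of a two-sided expansion already forces its growth. *)
Lemma laurent_expansion_growth r a f : laurent_expansion r f a -> growth r a.
Proof.
move=> fa rho rho0 rhor; have pr : pdisc r (rtoc rho).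
  split; first by rewrite /disc/= modulus_rtoc gtr0_norm.
  by move=> /= /eqP; rewrite rtoc_eq0 gt_eqF.
have [s [t [c1 c2 _]]] := fa _ pr.
have bnd (u : nat -> CC R) (l : CC R) : series u @ \oo --> l ->
    exists C : R, forall n, modulus (u n) <= C.
  move=> us; have /cvg_series_cvg_0 u0 : cvgn (series u) by apply/cvg_ex; exists l.
  have m0 : modulus (u n) @[n --> \oo] --> (0 : R).
    by rewrite -modulus0; exact: cvg_modulus u0.
  have [M [_ /(_ (M + 1))]] := cvg_seq_bounded (cvgP _ m0).
  rewrite ltrDl ltr01 => /(_ isT) h; exists (M + 1) => n.
  by have := h n I; rewrite /= ger0_norm// modulus_ge0.
have [C1 h1] := bnd _ _ c1; have [C2 h2] := bnd _ _ c2.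
have rE n : modulus (rtoc rho ^ n) = rho ^ n.
  by rewrite modulusXz modulus_rtoc gtr0_norm.
exists (Num.max C1 C2) => -[] n; rewrite -rE -modulusM le_max.
  by rewrite h1.
by rewrite h2 orbT.
Qed.

End LaurentSums.

(** * Termwise differentiation *)
Section LaurentDerivative.
Context {R : realType}.
Implicit Types (z w : CC R) (a : int -> CC R) (r s x y : R) (f : CC R -> CC R).

Definition laurent_deriv a (n : int) : CC R := (n + 1)%:~R * a (n + 1).

Lemma modulus_int (n : int) : modulus (n%:~R : CC R) = `|n|%N%:R.
Proof.
case: n => n; first by rewrite -pmulrn modulus_nat.
by rewrite NegzE mulrNz -pmulrn modulusN modulus_nat abszN.
Qed.

Lemma growth_deriv r a : growth r a -> growth r (laurent_deriv a).
Proof.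
move=> ga rho rho0 rhor.
have [C [q [C0 q0 q1 H]]] := growth_bound ga rho0 (lexx _) rhor.
have [D [s [D0 s0 s1 HD]]] := natM_geometric_le q0 q1.
have HD' k : k.+1%:R * q ^+ k <= D.
  by rewrite (le_trans (HD k))// ler_piMr// exprn_ile1// ltW.
suff H2 (n : int) : `|n|%N%:R * (modulus (a n) * rho ^ n) <= C * D.
  exists (C * D / rho) => n; rewrite modulusM modulus_int.
  rewrite ler_pdivlMr// -!mulrA (_ : rho ^ n * rho = rho ^ (n + 1)) ?H2//.
  by rewrite expfzDr ?gt_eqF// expr1z.
have H3 (k : nat) y : y <= C * q ^+ k -> k.+1%:R * y <= C * D.
  move=> yC; rewrite (le_trans (ler_wpM2l _ yC))// mulrCA ler_wpM2l//.
case: n => [[|k]|k]; first by rewrite mul0r mulr_ge0.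
  apply: H3; have [h _] := H k.+1 rho (lexx _) (lexx _).
  rewrite (le_trans h)// ler_wpM2l// exprS ler_piMl ?exprn_ge0// ltW//.
by apply: H3; have [_] := H k rho (lexx _) (lexx _).
Qed.

(** The remainder of the first order expansion of [w^n] at [z]. Its recurrence
    in [n] bounds it by [n^2 |w - z|^2] times a power of the radius, in positive
    degrees going up and in negative degrees going down. *)
Let taylor_rest z w (n : int) : CC R :=
  w ^ n - z ^ n - n%:~R * z ^ (n - 1) * (w - z).

Let taylor_restS z w (n : int) : z != 0 -> w != 0 ->
  taylor_rest z w (n + 1) =
  w * taylor_rest z w n + n%:~R * z ^ (n - 1) * (w - z) ^+ 2.
Proof.
move=> z0 w0; rewrite /taylor_rest addrK.
rewrite (_ : z ^ (n + 1) = z ^+ 2 * z ^ (n - 1)); last first.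
  by rewrite -[z ^+ 2]/(z ^ 2%:Z) -expfzDr// addrCA.
rewrite (_ : z ^ n = z * z ^ (n - 1)); last first.
  by rewrite -{2}(expr1z z) -expfzDr// addrC subrK.
rewrite (_ : w ^ (n + 1) = w * w ^ n); last first.
  by rewrite -{2}(expr1z w) -expfzDr// addrC.
rewrite intrD rmorph1; ring.
Qed.

Let taylor_rest_le (r1 r2 : R) z w : 0 < r1 ->
  r1 <= modulus z -> modulus z <= r2 -> r1 <= modulus w -> modulus w <= r2 ->
  forall k : nat,
  modulus (taylor_rest z w k%:Z)
    <= k.+1%:R ^+ 2 * r2 ^ k%:Z * (modulus (w - z) ^+ 2 / r1 ^+ 2) /\
  modulus (taylor_rest z w (Negz k))
    <= k.+1%:R ^+ 2 * r1 ^ Negz k * (modulus (w - z) ^+ 2 / r1 ^+ 2).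
Proof.
move=> r10 r1z zr2 r1w wr2.
have z1 : 0 < modulus z by apply: lt_le_trans r1z.
have w1 : 0 < modulus w by apply: lt_le_trans r1w.
have z0 : z != 0 by rewrite -modulus_gt0.
have w0 : w != 0 by rewrite -modulus_gt0.
have r20 : 0 < r2 by apply: lt_le_trans zr2.
set e := modulus (w - z); have e0 : 0 <= e by exact: modulus_ge0.
have e2 : 0 <= e ^+ 2 / r1 ^+ 2 by rewrite divr_ge0// exprn_ge0// ltW.
have E0 : taylor_rest z w 0 = 0.
  by rewrite /taylor_rest !expr0z subrr mul0r mul0r subr0.
have step1 (k : nat) : modulus (taylor_rest z w k%:Z)
    <= k%:R ^+ 2 * r2 ^ k%:Z * (e ^+ 2 / r1 ^+ 2).
  elim: k => [|k ih]; first by rewrite E0 modulus0 expr0n !mul0r.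
  rewrite -addn1 PoszD taylor_restS// (le_trans (le_modulusD _ _))//.
  rewrite !modulusM -!expr2 -/e modulus_int/= modulusXz.
  have h1 : modulus w * modulus (taylor_rest z w k%:Z) <=
     k%:R ^+ 2 * r2 ^+ k.+1 * (e ^+ 2 / r1 ^+ 2).
    apply: (le_trans (ler_pM (modulus_ge0 _) (modulus_ge0 _) wr2 ih)).
    by rewrite -[r2 ^ k%:Z]/(r2 ^+ k) [r2 ^+ k.+1]exprS; rewrite le_eqVlt; apply/orP; left; apply/eqP; ring.
  have h2 : modulus z ^ (k%:Z - 1) * e ^+ 2 <= r2 ^+ k.+1 * (e ^+ 2 / r1 ^+ 2).
    rewrite [e ^+ 2 / _]mulrC [leRHS]mulrA ler_wpM2r ?exprn_ge0//.
    rewrite ler_pdivlMr ?exprn_gt0//.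
    apply: (@le_trans _ _ (modulus z ^ (k%:Z - 1) * modulus z ^+ 2)).
      rewrite ler_wpM2l ?exprz_ge0 ?modulus_ge0// lerXn2r ?nnegrE ?modulus_ge0//.
      exact: ltW.
    rewrite -[modulus z ^+ 2]/(modulus z ^ 2%:Z) -expfzDr ?gt_eqF//.
    rewrite -addrA [(-1 + _)%R]addrC -[(2%:Z - 1)%R]/(1%:Z) -PoszD addn1.
    exact: exprz_Posz_le (modulus_ge0 _) zr2.
  rewrite addn1; apply: (le_trans (lerD h1 (_ : _ <= k%:R * (r2 ^+ k.+1 * (e ^+ 2 / r1 ^+ 2))))).
    by rewrite -mulrA ler_wpM2l.
  rewrite -PoszD addn1 -[r2 ^ k.+1%:Z]/(r2 ^+ k.+1).
  rewrite -[X in X + _]mulrA -[leRHS]mulrA -mulrDl ler_wpM2r//.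
    by rewrite mulr_ge0// exprn_ge0// ltW.
  by rewrite -natr1; have := ler0n R k; nra.
have step2 (k : nat) : modulus (taylor_rest z w (- k%:Z))
    <= k%:R ^+ 2 * r1 ^- k * (e ^+ 2 / r1 ^+ 2).
  elim: k => [|k ih]; first by rewrite oppr0 E0 modulus0 expr0n !mul0r.
  have /eqP := @taylor_restS z w (- k.+1%:Z) z0 w0.
  rewrite -subr_eq -(inj_eq (mulfI (invr_neq0 w0))) mulKf// eq_sym.
  have -> : (- k.+1%:Z + 1 = - k%:Z)%R by rewrite -addn1 PoszD opprD subrK.
  move=> /eqP ->; rewrite modulusM modulusV.
  have h1 : (modulus w)^-1 <= r1^-1 by rewrite lef_pV2 ?posrE.
  have h2 : modulus (taylor_rest z w (- k%:Z) - (- k.+1%:Z)%:~R *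
     z ^ (- k.+1%:Z - 1) * (w - z) ^+ 2) <=
     (k%:R ^+ 2 + k.+1%:R) * r1 ^- k * (e ^+ 2 / r1 ^+ 2).
    rewrite (le_trans (le_modulusB _ _))// mulrDl mulrDl lerD//.
    rewrite !modulusM -!expr2 -/e modulus_int abszN/= modulusXz.
    have hz : modulus z ^ (- k.+1%:Z - 1) <= (r1 ^+ k.+2)^-1.
      have -> : (- k.+1%:Z - 1)%R = Negz k.+1 by rewrite NegzE -opprD -PoszD addn1.
      exact: exprz_Negz_le r1z.
    have -> : k.+1%:R / r1 ^+ k * (e ^+ 2 / r1 ^+ 2) =
              k.+1%:R * (r1 ^+ k.+2)^-1 * e ^+ 2.
      rewrite (exprS _ k.+1) (exprS _ k); field.
      by rewrite expf_neq0 gt_eqF.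
    by rewrite ler_wpM2r ?exprn_ge0// ler_wpM2l.
  apply: (le_trans (ler_pM _ (modulus_ge0 _) h1 h2)).
    by rewrite invr_ge0 ltW.
  rewrite (_ : r1^-1 * _ = (k%:R ^+ 2 + k.+1%:R) / r1 ^+ k.+1 *
    (e ^+ 2 / r1 ^+ 2)); last first.
    by rewrite (exprS _ k); field; rewrite expf_neq0 gt_eqF.
  rewrite ler_wpM2r// ler_wpM2r ?invr_ge0 ?exprn_ge0 ?(ltW r10)//.
  by rewrite -natr1; have := ler0n R k; nra.
move=> k; split.
  rewrite (le_trans (step1 k))// ler_wpM2r// ler_wpM2r ?exprn_ge0 ?(ltW r20)//.
  by rewrite lerXn2r ?nnegrE ?ler_nat.
by have := step2 k.+1; rewrite -NegzE.
Qed.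

Lemma modulus_lim_le (u : nat -> CC R) (l : CC R) (M : R) :
  u @ \oo --> l -> (forall n, modulus (u n) <= M) -> modulus l <= M.
Proof.
move=> ul uM; have ml : modulus (u n) @[n --> \oo] --> modulus l.
  exact: cvg_modulus ul.
rewrite -(cvg_lim _ ml)//; apply: limr_le; first by apply/cvg_ex; exists (modulus l).
exact: nearW.
Qed.

(** The termwise remainders are quadratic in the increment, with coefficients
    that still decay geometrically, so their sum is [O(|h|^2)]. *)
Lemma laurent_sum_derive r a z : growth r a -> z != 0 -> modulus z < r ->
  is_derive z 1 (laurent_sum a) (laurent_sum (laurent_deriv a) z).
Proof.
move=> ga z0 zr; have z1 : 0 < modulus z by rewrite modulus_gt0.
pose r1 := modulus z / 2; pose r2 := (modulus z + r) / 2.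
have r10 : 0 < r1 by rewrite /r1; lra.
have r2r : r2 < r by rewrite /r2; lra.
have r1z : r1 <= modulus z by rewrite /r1; lra.
have zr2 : modulus z <= r2 by rewrite /r2; lra.
have [C [q [C0 q0 q1 H]]] := growth_bound ga r10 (le_trans r1z zr2) r2r.
have [D1 [s1 [D10 s10 s11 HD1]]] := natM_geometric_le q0 q1.
have [D2 [s2 [D20 s20 s21 HD2]]] := natM_geometric_le s10 s11.
have HD k : k.+1%:R ^+ 2 * q ^+ k <= D1 * D2 * s2 ^+ k.
  rewrite expr2 -mulrA (le_trans (ler_wpM2l _ (HD1 k)))// mulrCA -mulrA.
  by rewrite ler_wpM2l.
have gd := growth_deriv ga.
have [d1 d2 dc] := growth_cvg gd z0 zr.
pose b (n : int) : CC R := n%:~R * a n * z ^ (n - 1).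
pose dterm (k : nat) : CC R := b k%:Z + b (Negz k).
have bE n : b (n + 1) = laurent_deriv a n * z ^ n by rewrite /b addrK.
(* Differentiation lowers the degree, so that pairing the degrees k and
   - (k + 1) leaves two boundary terms, of degrees N - 1 and - N - 1. *)
have dseries N : series dterm N = series (laurent_term (laurent_deriv a) z) N
    - b N%:Z + b (- N%:Z).
  elim: N => [|N ih]; first by rewrite /series/= !big_geq// add0r oppr0 addNr.
  rewrite !seriesSr ih /laurent_term /dterm -!bE NegzE.
  have -> : (- N.+1%:Z + 1 = - N%:Z)%R by rewrite -addn1 PoszD opprD subrK.
  rewrite -PoszD addn1; ring.
have dcvg : series dterm @ \oo --> laurent_sum (laurent_deriv a) z.
  have -> : series dterm = (fun N => series (laurent_term (laurent_deriv a) z) N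
    - b N%:Z + b (- N%:Z)) by apply/funext => N; exact: dseries.
  rewrite -[X in _ --> X]addr0; apply: cvgD; last first.
    have := cvg_series_cvg_0 d2; apply: cvg_trans; apply: near_eq_cvg.
    apply: nearW => N; rewrite -bE; congr b.
    by rewrite NegzE -addn1 PoszD opprD subrK.
  rewrite -[X in _ --> X]subr0; apply: cvgB; first exact: dc.
  rewrite -cvg_shiftS; have := cvg_series_cvg_0 d1; apply: cvg_trans.
  by apply: near_eq_cvg; apply: nearW => N; rewrite -bE -PoszD addn1.
pose M := 2 * (C * (D1 * D2)) / r1 ^+ 2 / (1 - s2).
have M0 : 0 <= M.
  rewrite /M; apply: divr_ge0; last by rewrite subr_ge0 ltW.
  by apply: divr_ge0; [rewrite !mulr_ge0|exact: exprn_ge0 (ltW r10)].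
pose dl := Num.min (modulus z / 2) ((r - modulus z) / 2).
have dl0 : 0 < dl by rewrite lt_min; apply/andP; split; lra.
have main h : modulus h < dl ->
    modulus (laurent_sum a (z + h) - laurent_sum a z -
      laurent_sum (laurent_deriv a) z * h) <= M * modulus h ^+ 2.
  rewrite lt_min => /andP[h1 h2]; set w := z + h.
  have wz : w - z = h by rewrite /w addrC addKr.
  have zw1 : r1 <= modulus w.
    have := le_modulusB w h; rewrite /w addrK -/w /r1; lra.
  have w1 : 0 < modulus w by apply: lt_le_trans zw1.
  have wr2 : modulus w <= r2 by have := le_modulusD z h; rewrite -/w /r2; lra.
  have wr : modulus w < r by apply: le_lt_trans wr2 _.
  have w0 : w != 0 by rewrite -modulus_gt0.
  have [_ _ wc] := growth_cvg ga w0 wr.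
  have [_ _ zc] := growth_cvg ga z0 zr.
  apply: (@modulus_lim_le (fun N => series (laurent_term a w) N -
    series (laurent_term a z) N - series dterm N * h)).
    apply: cvgB; first by apply: cvgB; [exact: wc|exact: zc].
    by apply: cvgMl; exact: dcvg.
  move=> N; have -> : series (laurent_term a w) N -
    series (laurent_term a z) N - series dterm N * h =
    \sum_(k < N) (a k%:Z * taylor_rest z w k%:Z
       + a (Negz k) * taylor_rest z w (Negz k)).
    rewrite /series/= !big_mkord mulr_suml -!sumrB; apply: eq_bigr => k _.
    rewrite /laurent_term /dterm /b /taylor_rest wz; ring.
  rewrite (le_trans (le_modulus_sum _ _ _))//.
  have bnd (k : 'I_N) : modulus (a k%:Z * taylor_rest z w k%:Z
       + a (Negz k) * taylor_rest z w (Negz k)) <=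
       2 * (C * (D1 * D2)) / r1 ^+ 2 * modulus h ^+ 2 * s2 ^+ k.
    have [t1 t2] := taylor_rest_le r10 r1z zr2 zw1 wr2 k.
    have [u1 _] := H k r2 (le_trans r1z zr2) (lexx _).
    have [_ u2] := H k r1 (lexx _) (le_trans r1z zr2).
    rewrite wz in t1 t2.
    have aux (c e t : R) : 0 <= c -> t <= k.+1%:R ^+ 2 * e * (modulus h ^+ 2 / r1 ^+ 2) ->
        c * e <= C * q ^+ k ->
        c * t <= C * (D1 * D2) / r1 ^+ 2 * modulus h ^+ 2 * s2 ^+ k.
      move=> c0 te ce; rewrite (le_trans (ler_wpM2l c0 te))//.
      have -> : c * (k.+1%:R ^+ 2 * e * (modulus h ^+ 2 / r1 ^+ 2)) =
        (c * e) * k.+1%:R ^+ 2 * (modulus h ^+ 2 / r1 ^+ 2) by ring.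
      have -> : C * (D1 * D2) / r1 ^+ 2 * modulus h ^+ 2 * s2 ^+ k =
        C * (D1 * D2 * s2 ^+ k) * (modulus h ^+ 2 / r1 ^+ 2) by ring.
      rewrite ler_wpM2r//.
        by rewrite divr_ge0// exprn_ge0 ?modulus_ge0// ltW.
      apply: (le_trans (ler_wpM2r (exprn_ge0 2 (ler0n _ k.+1)) ce)).
      rewrite -[leLHS]mulrA ler_wpM2l//.
      by rewrite mulrC; exact: HD.
    rewrite (le_trans (le_modulusD _ _))// !modulusM.
    have -> : 2 * (C * (D1 * D2)) / r1 ^+ 2 * modulus h ^+ 2 * s2 ^+ k =
      C * (D1 * D2) / r1 ^+ 2 * modulus h ^+ 2 * s2 ^+ k +
      C * (D1 * D2) / r1 ^+ 2 * modulus h ^+ 2 * s2 ^+ k by ring.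
    by apply: lerD; [apply: (aux _ _ _ _ t1 u1)|apply: (aux _ _ _ _ t2 u2)];
      exact: modulus_ge0.
  rewrite (le_trans (ler_sum _ (fun k _ => bnd k)))// -mulr_sumr /M.
  rewrite -[leRHS]mulrA (mulrC _^-1 (modulus h ^+ 2)) [leRHS]mulrA.
  rewrite ler_wpM2l ?geometric_sum_le// mulr_ge0 ?exprn_ge0 ?modulus_ge0//.
  by rewrite divr_ge0 ?mulr_ge0 ?exprn_ge0// ltW.
apply/is_deriveCP => e e0; exists (Num.min dl (e / (M + 1))).
  by rewrite lt_min dl0/= divr_gt0//; lra.
move=> h; rewrite lt_min => /andP[/main hM].
rewrite ltr_pdivlMr; last by lra.
move=> he; rewrite (le_trans hM)// expr2 mulrA ler_wpM2r ?modulus_ge0//.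
by have := modulus_ge0 h; lra.
Qed.

End LaurentDerivative.

(** * Higher derivatives of Laurent sums *)
Section DerivativesOfSums.
Context {R : realType}.
Implicit Types (z w : CC R) (a : int -> CC R) (r s x y : R) (f : CC R -> CC R).

Lemma pdiscP r z : pdisc r z <-> z != 0 /\ modulus z < r.
Proof. by split=> [[zr /eqP z0]|[/eqP z0 zr]]. Qed.

Lemma pdisc_near r z : pdisc r z -> \forall w \near z, pdisc r w.
Proof.
move=> /pdiscP[z0 zr]; apply/nearC.
have z1 : 0 < modulus z by rewrite modulus_gt0.
exists (Num.min (modulus z) (r - modulus z)).
  by rewrite lt_min z1 subr_gt0.
move=> w; rewrite lt_min => /andP[h1 h2]; apply/pdiscP.
have := le_modulusD (w - z) z; rewrite subrK => h3.
have := le_modulusD (z - w) w; rewrite subrK modulusB => h4.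
by rewrite -modulus_gt0; split; lra.
Qed.

Lemma growth_iter_deriv r a m : growth r a -> growth r (iter m laurent_deriv a).
Proof. by move=> ga; elim: m => //= m; exact: growth_deriv. Qed.

Lemma derive1n_laurent_sum r a f m : growth r a ->
  (forall z, pdisc r z -> f z = laurent_sum a z) ->
  forall z, pdisc r z ->
    derive1n m f z = laurent_sum (iter m laurent_deriv a) z.
Proof.
move=> ga fa; elim: m => [|m ih] z zr; first exact: fa.
rewrite /derive1n iterS -/(derive1n m f) derive1E.
have /pdiscP[z0 z1] := zr.
have H := laurent_sum_derive (growth_iter_deriv m ga) z0 z1.
suff : is_derive z 1 (derive1n m f) (laurent_sum (iter m.+1 laurent_deriv a) z).
  by move=> ?; exact: derive_val.
apply: near_eq_is_derive H.
by near=> w; apply/esym/ih; near: w; exact: pdisc_near.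
Unshelve. all: by end_near. Qed.

Lemma holomorphic_laurent_sum r a f : growth r a ->
  (forall z, pdisc r z -> f z = laurent_sum a z) -> holomorphic_on (pdisc r) f.
Proof.
move=> ga fa z zr; have /pdiscP[z0 z1] := zr.
have H := laurent_sum_derive ga z0 z1.
suff : is_derive z 1 f (laurent_sum (laurent_deriv a) z).
  by move=> ?; exact: ex_derive.
apply: near_eq_is_derive H.
by near=> w; apply/esym/fa; near: w; exact: pdisc_near.
Unshelve. all: by end_near. Qed.

Lemma derivable_exprz (n : int) z : z != 0 -> derivable (fun w => w ^ n) z 1.
Proof.
move=> z0; have dX k : derivable (fun w : CC R => w ^+ k) z 1.
  have -> : (fun w : CC R => w ^+ k) = (@idfun (CC R)) ^+ k.
    by apply/funext => w; elim: k => // k ih; rewrite !exprS ih.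
  exact/derivableX/derivable_id.
case: n => n; first exact: dX.
by apply: derivableV; [rewrite expf_neq0|exact: dX].
Qed.

Lemma derivable_continuousC f z : derivable f z 1 -> f @ z --> f z.
Proof. by move=> df; exact/differentiable_continuous/derivable1_diffP. Qed.

End DerivativesOfSums.

(** * Integrals of complex functions *)
Section ComplexIntegral.
Context d (T : measurableType d) (R : realType).
Variable mu : {measure set T -> \bar R}.
Implicit Types (D : set T) (F G : T -> CC R).

Definition Cintegral D F : CC R :=
  Complex (\int[mu]_(x in D) complex.Re (F x)) (\int[mu]_(x in D) complex.Im (F x)).

Definition Cmeasurable D F :=
  measurable_fun D (fun x => complex.Re (F x)) /\
  measurable_fun D (fun x => complex.Im (F x)).

Definition Cintegrable D F :=
  mu.-integrable D (EFin \o (fun x => complex.Re (F x))) /\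
  mu.-integrable D (EFin \o (fun x => complex.Im (F x))).

Lemma eq_Cintegral D F G : (forall x, D x -> F x = G x) ->
  Cintegral D F = Cintegral D G.
Proof.
by move=> FG; congr Complex; apply: eq_Rintegral => x; rewrite inE => /FG ->.
Qed.

Lemma eq_Cintegrable D F G : measurable D -> (forall x, D x -> F x = G x) ->
  Cintegrable D F -> Cintegrable D G.
Proof.
move=> mD FG [h1 h2]; split; [move: h1|move: h2]; apply: eq_integrable => // x;
  by rewrite inE => /FG /= ->.
Qed.

Lemma eq_Cmeasurable D F G : (forall x, D x -> F x = G x) ->
  Cmeasurable D F -> Cmeasurable D G.
Proof.
move=> FG [h1 h2]; split; [move: h1|move: h2]; apply: eq_measurable_fun => x;
  by rewrite inE => /FG ->.
Qed.

Lemma CmeasurableD D F G : Cmeasurable D F -> Cmeasurable D G ->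
  Cmeasurable D (fun x => F x + G x).
Proof.
move=> [F1 F2] [G1 G2]; split.
  by under eq_fun do rewrite ReD; exact: measurable_funD.
by under eq_fun do rewrite ImD; exact: measurable_funD.
Qed.

Lemma CmeasurableM D F G : Cmeasurable D F -> Cmeasurable D G ->
  Cmeasurable D (fun x => F x * G x).
Proof.
move=> [F1 F2] [G1 G2]; split.
  under eq_fun do rewrite ReM.
  by apply: measurable_funB; exact: measurable_funM.
under eq_fun do rewrite ImM.
by apply: measurable_funD; exact: measurable_funM.
Qed.

Lemma Cmeasurable_cst D c : Cmeasurable D (fun=> c).
Proof. by split; exact: measurable_cst. Qed.

Lemma Cmeasurable_rtoc D (f : T -> R) : measurable_fun D f ->
  Cmeasurable D (fun x => rtoc (f x)).
Proof. by move=> mf; split => //=; exact: measurable_cst. Qed.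

Lemma Cmeasurable_conj D F : Cmeasurable D F -> Cmeasurable D (fun x => conj (F x)).
Proof.
move=> [F1 F2]; split.
  rewrite (_ : (fun x => _) = (fun x => complex.Re (F x)))//.
  by apply/funext => x; case: (F x).
rewrite (_ : (fun x => _) = (fun x => - complex.Im (F x))).
  exact: measurable_funN.
by apply/funext => x; case: (F x).
Qed.

Lemma CmeasurableX D F n : Cmeasurable D F -> Cmeasurable D (fun x => F x ^+ n).
Proof.
move=> mF; elim: n => [|n ih]; first exact: Cmeasurable_cst.
by under [X in Cmeasurable _ X]eq_fun do rewrite exprS; exact: CmeasurableM.
Qed.

Lemma measurable_modulus D F : measurable D -> Cmeasurable D F ->
  measurable_fun D (fun x => modulus (F x)).
Proof.
move=> mD [F1 F2]; rewrite (_ : (fun x => _) = Num.sqrt \o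
    ((fun x => complex.Re (F x) ^+ 2) \+ (fun x => complex.Im (F x) ^+ 2))).
  apply: measurableT_comp.
    by apply: continuous_measurable_fun; exact: sqrt_continuous.
  by apply: measurable_funD; exact: measurable_funX.
by apply/funext => x; rewrite modulus_def.
Qed.

Lemma CmeasurableV D F : measurable D -> Cmeasurable D F ->
  Cmeasurable D (fun x => (F x)^-1).
Proof.
move=> mD mF.
have E x : (F x)^-1 = conj (F x) * rtoc (((modulus (F x)) ^-1) ^+ 2).
  by have := invc_norm (F x); rewrite mulrC norm_rtoc exprVn fmorphV/= rmorphXn.
under [X in Cmeasurable _ X]eq_fun do rewrite E.
apply: CmeasurableM; first exact: Cmeasurable_conj.
apply: Cmeasurable_rtoc; apply: measurable_funX.
rewrite (_ : (fun x => _) = (@powR R)^~ (-1) \o (fun x => modulus (F x))).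
  by apply: measurableT_comp; [exact: measurable_powR|exact: measurable_modulus].
by apply/funext => x; rewrite /= powR_inv1 ?modulus_ge0.
Qed.

Lemma Cmeasurable_cvg D (F_ : nat -> T -> CC R) F : measurable D ->
  (forall n, Cmeasurable D (F_ n)) ->
  (forall x, D x -> F_ n x @[n --> \oo] --> F x) -> Cmeasurable D F.
Proof.
move=> mD mF FF; split.
  apply: (measurable_fun_cvg (fun n => (mF n).1)) => x Dx.
  by have [h _] := (cvgC_ReIm _ _).1 (FF x Dx).
apply: (measurable_fun_cvg (fun n => (mF n).2)) => x Dx.
by have [_ h] := (cvgC_ReIm _ _).1 (FF x Dx).
Qed.

Lemma le_Cintegrable D F (g : T -> R) : measurable D -> Cmeasurable D F ->
  mu.-integrable D (EFin \o g) -> (forall x, D x -> modulus (F x) <= g x) ->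
  Cintegrable D F.
Proof.
move=> mD [m1 m2] ig Fg.
split; apply: le_integrable ig => //; try exact/measurable_EFinP;
  move=> x Dx /=; rewrite lee_fin (le_trans _ (ler_norm _))//;
  apply: le_trans (Fg x Dx); [exact: Re_le_modulus|exact: Im_le_modulus].
Qed.

Lemma Cintegrable_measurable D F : Cintegrable D F -> Cmeasurable D F.
Proof.
by case=> /integrableP[/measurable_EFinP ? _] /integrableP[/measurable_EFinP ? _].
Qed.

Lemma Cintegrable_modulus D F : measurable D -> Cintegrable D F ->
  mu.-integrable D (EFin \o (fun x => modulus (F x))).
Proof.
move=> mD iF; have [m1 m2] := Cintegrable_measurable iF; case: iF => i1 i2.
have : mu.-integrable D (EFin \o (fun x =>
    `|complex.Re (F x)| + `|complex.Im (F x)|)).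
  rewrite (_ : EFin \o _ = (fun x => `|(complex.Re (F x))%:E| +
     `|(complex.Im (F x))%:E|)%E); last by apply/funext => x /=; rewrite EFinD.
  by apply: integrableD => //; exact: integrable_norm.
apply: le_integrable => //.
  exact/measurable_EFinP/measurable_modulus.
move=> x Dx /=; rewrite lee_fin ger0_norm ?modulus_ge0//.
by rewrite (le_trans (modulus_le_ReIm _))// ler_norm.
Qed.

Lemma CintegrableD D F G : measurable D -> Cintegrable D F -> Cintegrable D G ->
  Cintegrable D (fun x => F x + G x).
Proof.
move=> mD [F1 F2] [G1 G2]; split.
  rewrite (_ : EFin \o _ = (fun x => (complex.Re (F x))%:E +
     (complex.Re (G x))%:E)%E); last by apply/funext => x /=; rewrite ReD EFinD.
  exact: integrableD.
rewrite (_ : EFin \o _ = (fun x => (complex.Im (F x))%:E +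
   (complex.Im (G x))%:E)%E); last by apply/funext => x /=; rewrite ImD EFinD.
exact: integrableD.
Qed.

Lemma CintegralD D F G : measurable D -> Cintegrable D F -> Cintegrable D G ->
  Cintegral D (fun x => F x + G x) = Cintegral D F + Cintegral D G.
Proof.
move=> mD [F1 F2] [G1 G2]; apply: complex_ext; rewrite ?ReD ?ImD/= -RintegralD//.
  by apply: eq_Rintegral => x _; rewrite ReD.
by apply: eq_Rintegral => x _; rewrite ImD.
Qed.

Lemma CintegrableZ D F c : measurable D -> Cintegrable D F ->
  Cintegrable D (fun x => c * F x).
Proof.
move=> mD iF; have im := Cintegrable_modulus mD iF.
have i2 : mu.-integrable D (EFin \o (fun x => modulus c * modulus (F x))).
  rewrite (_ : EFin \o _ = (fun x => (modulus c)%:E * (modulus (F x))%:E)%E).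
    exact: integrableZl.
  by apply/funext => x.
apply: le_Cintegrable i2 _ => //.
  apply: CmeasurableM; [exact: Cmeasurable_cst|exact: Cintegrable_measurable].
by move=> x _; rewrite modulusM.
Qed.

Lemma CintegralZ D F c : measurable D -> Cintegrable D F ->
  Cintegral D (fun x => c * F x) = c * Cintegral D F.
Proof.
move=> mD [F1 F2]; apply: complex_ext; rewrite ?ReM ?ImM/=.
  under eq_Rintegral do rewrite ReM.
  have h1 : mu.-integrable D (EFin \o (fun x => complex.Re c * complex.Re (F x))).
    rewrite (_ : EFin \o _ = (fun x => (complex.Re c)%:E * (complex.Re (F x))%:E)%E);
      [exact: integrableZl|by apply/funext].
  have h2 : mu.-integrable D (EFin \o (fun x => complex.Im c * complex.Im (F x))).
    rewrite (_ : EFin \o _ = (fun x => (complex.Im c)%:E * (complex.Im (F x))%:E)%E);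
      [exact: integrableZl|by apply/funext].
  by rewrite RintegralB// !RintegralZl.
under eq_Rintegral do rewrite ImM.
have h1 : mu.-integrable D (EFin \o (fun x => complex.Re c * complex.Im (F x))).
  rewrite (_ : EFin \o _ = (fun x => (complex.Re c)%:E * (complex.Im (F x))%:E)%E);
    [exact: integrableZl|by apply/funext].
have h2 : mu.-integrable D (EFin \o (fun x => complex.Im c * complex.Re (F x))).
  rewrite (_ : EFin \o _ = (fun x => (complex.Im c)%:E * (complex.Re (F x))%:E)%E);
    [exact: integrableZl|by apply/funext].
by rewrite RintegralD// !RintegralZl.
Qed.

Lemma CintegrableB D F G : measurable D -> Cintegrable D F -> Cintegrable D G ->
  Cintegrable D (fun x => F x - G x).
Proof.
move=> mD iF iG; have := CintegrableD mD iF (CintegrableZ (-1) mD iG).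
by apply: eq_Cintegrable => // x _; rewrite mulN1r.
Qed.

Lemma CintegralB D F G : measurable D -> Cintegrable D F -> Cintegrable D G ->
  Cintegral D (fun x => F x - G x) = Cintegral D F - Cintegral D G.
Proof.
move=> mD iF iG; rewrite -mulN1r -CintegralZ// -CintegralD//.
  by apply: eq_Cintegral => x _; rewrite mulN1r.
exact: CintegrableZ.
Qed.

Lemma Cintegrable0 D : measurable D -> Cintegrable D (fun=> 0).
Proof. by move=> mD; split; exact: integrable0. Qed.

Lemma Cintegral0 D : Cintegral D (fun=> 0) = 0.
Proof. by congr Complex; rewrite /Rintegral integral0. Qed.

Lemma Cintegral_sum D (I : Type) (s : seq I) (F : I -> T -> CC R) :
  measurable D -> (forall i, Cintegrable D (F i)) ->
  Cintegrable D (fun x => \sum_(i <- s) F i x) /\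
  Cintegral D (fun x => \sum_(i <- s) F i x) = \sum_(i <- s) Cintegral D (F i).
Proof.
move=> mD iF; elim: s => [|i s [ih1 ih2]].
  under [X in Cintegrable _ X]eq_fun do rewrite big_nil.
  under [X in Cintegral _ X]eq_fun do rewrite big_nil.
  by rewrite big_nil Cintegral0; split => //; exact: Cintegrable0.
under [X in Cintegrable _ X]eq_fun do rewrite big_cons.
under [X in Cintegral _ X]eq_fun do rewrite big_cons.
by rewrite big_cons -ih2 CintegralD//; split => //; exact: CintegrableD.
Qed.

(** Rotating the integral onto the positive axis reduces the bound to the real
    part of the integrand. *)
Lemma modulus_Cintegral_le D F (g : T -> R) : measurable D -> Cintegrable D F ->
  mu.-integrable D (EFin \o g) -> (forall x, D x -> modulus (F x) <= g x) ->
  modulus (Cintegral D F) <= \int[mu]_(x in D) g x.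
Proof.
move=> mD iF ig Fg; set I := Cintegral D F.
have [->|I0] := eqVneq I 0.
  rewrite modulus0 Rintegral_ge0// => x Dx.
  exact: le_trans (modulus_ge0 _) (Fg x Dx).
have I1 : 0 < modulus I by rewrite modulus_gt0.
pose c := conj I * rtoc (modulus I)^-1.
have cI : c * I = rtoc (modulus I).
  rewrite /c mulrAC (mulrC (conj I)) mul_conj -rmorphM; congr rtoc.
  by rewrite expr2 mulfK// gt_eqF.
have mc : modulus c = 1.
  by rewrite /c modulusM modulus_conj modulus_rtoc gtr0_norm ?invr_gt0// divff ?gt_eqF.
have -> : modulus I = complex.Re (Cintegral D (fun x => c * F x)).
  by rewrite CintegralZ// -/I cI.
have [i1 i2] := CintegrableZ c mD iF.
apply: le_Rintegral => //= x Dx.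
apply: le_trans (Fg x Dx); apply: (le_trans (ler_norm _)).
by apply: le_trans (Re_le_modulus _) _; rewrite modulusM mc mul1r.
Qed.

(** Dominated convergence, applied to the real and imaginary parts. *)
Lemma cvg_Cintegral D (F_ : nat -> T -> CC R) F (g : T -> R) : measurable D ->
  (forall n, Cmeasurable D (F_ n)) ->
  mu.-integrable D (EFin \o g) ->
  (forall n x, D x -> modulus (F_ n x) <= g x) ->
  (forall x, D x -> F_ n x @[n --> \oo] --> F x) ->
  Cintegrable D F /\ Cintegral D (F_ n) @[n --> \oo] --> Cintegral D F.
Proof.
move=> mD mF ig Fg FF.
have mFl : Cmeasurable D F := Cmeasurable_cvg mD mF FF.
have iF : Cintegrable D F.
  apply: (le_Cintegrable mD mFl ig) => x Dx.
  by apply: (modulus_lim_le (FF x Dx)) => n; exact: Fg.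
split => //.
have aux (p : CC R -> R) : measurable_fun D (fun x => p (F x)) ->
    (forall n, measurable_fun D (fun x => p (F_ n x))) ->
    (forall z, `|p z| <= modulus z) ->
    (forall x, D x -> p (F_ n x) @[n --> \oo] --> p (F x)) ->
    mu.-integrable D (EFin \o (fun x => p (F x))) ->
    \int[mu]_(x in D) p (F_ n x) @[n --> \oo] --> \int[mu]_(x in D) p (F x).
  move=> m1 m2 pl pc ip.
  have [|||||_ _] := @dominated_convergence _ _ _ mu D mD
    (fun n x => (p (F_ n x))%:E) (fun x => (p (F x))%:E) (EFin \o g).
  - by move=> n; exact/measurable_EFinP.
  - exact/measurable_EFinP.
  - by apply: aeW => x Dx; apply: cvg_EFin; [exact: nearW|exact: pc].
  - exact: ig.
  - apply: aeW => x n Dx; rewrite /= lee_fin.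
    exact: le_trans (pl _) (Fg n x Dx).
  move=> h; apply: fine_cvg; rewrite fineK; first exact: h.
  exact: integrable_fin_num.
case: iF => i1 i2; apply/cvgC_ReIm; split => /=; apply: aux => //.
- exact: mFl.1.
- by move=> n; exact: (mF n).1.
- exact: Re_le_modulus.
- by move=> x Dx; have [] := (cvgC_ReIm _ _).1 (FF x Dx).
- exact: mFl.2.
- by move=> n; exact: (mF n).2.
- exact: Im_le_modulus.
- by move=> x Dx; have [] := (cvgC_ReIm _ _).1 (FF x Dx).
Qed.

End ComplexIntegral.

(** * Cauchy's theorem for rectangles *)
Section Goursat.
Context {R : realType}.
Implicit Types (F : R -> R -> CC R) (g : R -> CC R) (a b c d x y : R).

Let leb : {measure set (measurableTypeR R) -> \bar R} := @lebesgue_measure R.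

Lemma within_continuous_Cintegrable g a b :
  {within `[a, b], continuous g} -> Cintegrable leb `[a, b] g.
Proof.
move=> /subspace_continuousP cg.
split; apply: continuous_compact_integrable;
  try exact: segment_compact; apply/subspace_continuousP => x xab;
  by have [] := (cvgC_ReIm _ _).1 (cg x xab).
Qed.

Lemma Cintegral_itv_split g a m b : a <= m -> m <= b ->
  Cintegrable leb `[a, b] g ->
  Cintegral leb `[a, b] g = Cintegral leb `[a, m] g + Cintegral leb `[m, b] g.
Proof.
move=> am mb [i1 i2].
have aux (f : R -> R) : leb.-integrable `[a, b] (EFin \o f) ->
   \int[leb]_(x in `[a, b]) f x =
   \int[leb]_(x in `[a, m]) f x + \int[leb]_(x in `[m, b]) f x.
  move=> fi; apply/eqP; rewrite addrC -subr_eq.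
  rewrite (@Rintegral_itvB _ f (BLeft a) (BRight b) m)//.
  rewrite Rintegral_itv_obnd_cbnd//.
  by apply: integrableS fi => //; apply: subset_itvr; rewrite bnd_simp.
by apply: complex_ext; rewrite ?ReD ?ImD/=; exact: aux.
Qed.

Lemma Rintegral_cst_itv (a b k : R) : a <= b ->
  \int[leb]_(x in `[a, b]) k = k * (b - a).
Proof.
move=> ab; rewrite Rintegral_cst//= lebesgue_measure_itv/= lte_fin.
by move: ab; rewrite le_eqVlt => /predU1P[->|->]; rewrite ?ltxx ?subrr.
Qed.

Lemma integrable_cst_itv (a b k : R) :
  leb.-integrable `[a, b] (EFin \o (fun=> k)).
Proof.
apply: continuous_compact_integrable; first exact: segment_compact.
by apply: continuous_subspaceT => x; exact: cvg_cst.
Qed.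

Lemma Cintegral_cst_itv a b (k : CC R) : a <= b ->
  Cintegral leb `[a, b] (fun=> k) = rtoc (b - a) * k.
Proof.
move=> ab; apply: complex_ext.
  by rewrite rtocM_Re/= Rintegral_cst_itv// mulrC.
by rewrite rtocM_Im/= Rintegral_cst_itv// mulrC.
Qed.

(** Differentiability at the point of coordinates [x0] and [y0] with respect to
    the complex variable [x + i y]; the two coordinates are kept apart because
    the sides of a rectangle are parametrised by them. *)
Definition rect_derivable F x0 y0 := exists A : CC R,
  forall e : R, 0 < e -> exists2 dl : R, 0 < dl & forall x y,
    `|x - x0| < dl -> `|y - y0| < dl ->
    modulus (F x y - F x0 y0 - A * Complex (x - x0) (y - y0))
      <= e * (`|x - x0| + `|y - y0|).

(** The counterclockwise integral over the boundary of the rectangle, opposite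
    sides being grouped together. *)
Definition rect_integral F a b c d : CC R :=
  Cintegral leb `[a, b] (fun x => F x c - F x d)
  + Complex 0 1 * Cintegral leb `[c, d] (fun y => F b y - F a y).

Lemma modulus_Complex_le x y : modulus (Complex x y) <= `|x| + `|y|.
Proof. exact: modulus_le_ReIm. Qed.

Lemma modulus_i : modulus (Complex 0 1 : CC R) = 1.
Proof. by rewrite modulus_def/= expr0n expr1n add0r sqrtr1. Qed.

Lemma rect_derivable_lipschitz F x0 y0 : rect_derivable F x0 y0 ->
  exists2 dl : R, 0 < dl & exists M : R, forall x y,
    `|x - x0| < dl -> `|y - y0| < dl ->
    modulus (F x y - F x0 y0) <= M * (`|x - x0| + `|y - y0|).
Proof.
move=> [A /(_ 1 ltr01)[dl dl0 H]]; exists dl => //; exists (1 + modulus A) => x y h1 h2.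
rewrite -(subrK (A * Complex (x - x0) (y - y0)) (F x y - F x0 y0)).
rewrite (le_trans (le_modulusD _ _))// mulrDl lerD ?H//.
by rewrite modulusM ler_wpM2l ?modulus_ge0// modulus_Complex_le.
Qed.

Lemma near_dist_lt x0 (e : R) : 0 < e -> \forall x \near x0, `|x - x0| < e.
Proof.
by move=> e0; near do rewrite distrC; exact: (@cvgr_dist_lt _ _ _ _ _ id _ cvg_id).
Unshelve. all: by end_near. Qed.

Lemma cvg_dist0 x0 : `|x - x0| @[x --> x0] --> (0 : R).
Proof.
apply/cvgrPdist_lt => e e0; apply: filterS (near_dist_lt x0 e0) => x.
by rewrite sub0r normrN normr_id.
Qed.

Lemma rect_derivable_cvgx F x0 y0 : rect_derivable F x0 y0 ->
  F x y0 @[x --> x0] --> F x0 y0.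
Proof.
move=> /rect_derivable_lipschitz[dl dl0 [M H]]; apply/cvgC_modulus.
apply: (@squeeze_cvgr _ (nbhs x0) _ _ (cst 0) (fun x => M * `|x - x0|)).
- apply: filterS (near_dist_lt x0 dl0) => x h; rewrite modulus_ge0/= (le_trans (H x y0 _ _))//;
    by rewrite subrr normr0 ?addr0 ?add0r.
- exact: cvg_cst.
- by rewrite -(mulr0 M); apply: cvgMl_tmp; exact: cvg_dist0.
Unshelve. all: by end_near. Qed.

Lemma rect_derivable_cvgy F x0 y0 : rect_derivable F x0 y0 ->
  F x0 y @[y --> y0] --> F x0 y0.
Proof.
move=> /rect_derivable_lipschitz[dl dl0 [M H]]; apply/cvgC_modulus.
apply: (@squeeze_cvgr _ (nbhs y0) _ _ (cst 0) (fun y => M * `|y - y0|)).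
- apply: filterS (near_dist_lt y0 dl0) => y h; rewrite modulus_ge0/= (le_trans (H x0 y _ _))//;
    by rewrite subrr normr0 ?addr0 ?add0r.
- exact: cvg_cst.
- by rewrite -(mulr0 M); apply: cvgMl_tmp; exact: cvg_dist0.
Unshelve. all: by end_near. Qed.

Let midpoint a b : a <= b -> [/\ a <= (a + b) / 2, (a + b) / 2 <= b,
  (a + b) / 2 - a = (b - a) / 2 & b - (a + b) / 2 = (b - a) / 2].
Proof. by move=> ab; split; [lra|lra|field|field]. Qed.

Let pigeonhole (j0 j1 j2 j3 j4 : R) : j0 <= (j1 + j2) + (j3 + j4) ->
  4 * j1 < j0 -> 4 * j2 < j0 -> 4 * j3 < j0 -> j0 <= 4 * j4.
Proof. lra. Qed.

Let dist_le x y a b : a <= x -> x <= b -> a <= y -> y <= b -> `|x - y| <= b - a.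
Proof. by move=> *; rewrite ler_norml; apply/andP; split; lra. Qed.

Section Rectangle.
Variables (F : R -> R -> CC R) (a0 b0 c0 d0 : R).
Hypothesis dF : forall x y, a0 <= x -> x <= b0 -> c0 <= y -> y <= d0 ->
  rect_derivable F x y.

Let inside a b c d := [/\ a0 <= a, a <= b, b <= b0 & [/\ c0 <= c, c <= d & d <= d0]].

Let Fx_int a b y : a0 <= a -> b <= b0 -> c0 <= y -> y <= d0 ->
  Cintegrable leb `[a, b] (fun x => F x y).
Proof.
move=> h1 h2 h3 h4; apply: within_continuous_Cintegrable.
apply/subspace_continuousP => x; rewrite /= in_itv/= => /andP[ax xb].
apply: cvg_within_filter; apply: rect_derivable_cvgx; apply: dF => //.
  exact: le_trans ax.
exact: le_trans h2.
Qed.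

Let Fy_int c d x : c0 <= c -> d <= d0 -> a0 <= x -> x <= b0 ->
  Cintegrable leb `[c, d] (fun y => F x y).
Proof.
move=> h1 h2 h3 h4; apply: within_continuous_Cintegrable.
apply/subspace_continuousP => y; rewrite /= in_itv/= => /andP[cy yd].
apply: cvg_within_filter; apply: rect_derivable_cvgy; apply: dF => //.
  exact: le_trans cy.
exact: le_trans h2.
Qed.

Let splitx a m b c d : inside a b c d -> a <= m -> m <= b ->
  rect_integral F a b c d = rect_integral F a m c d + rect_integral F m b c d.
Proof.
move=> [h1 h2 h3 [h4 h5 h6]] am mb; rewrite /rect_integral.
rewrite (Cintegral_itv_split am mb); last first.
  by apply: CintegrableB => //; apply: Fx_int => //; lra.
rewrite addrACA -mulrDr -CintegralD//; last 2 first.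
- by apply: CintegrableB => //; apply: Fy_int => //; lra.
- by apply: CintegrableB => //; apply: Fy_int => //; lra.
congr (_ + _ * _); apply: eq_Cintegral => y _.
by rewrite [RHS]addrC addrA subrK.
Qed.

Let splity a b c m d : inside a b c d -> c <= m -> m <= d ->
  rect_integral F a b c d = rect_integral F a b c m + rect_integral F a b m d.
Proof.
move=> [h1 h2 h3 [h4 h5 h6]] cm md; rewrite /rect_integral.
rewrite (Cintegral_itv_split cm md); last first.
  by apply: CintegrableB => //; apply: Fy_int => //; lra.
rewrite addrACA -mulrDr -CintegralD//; last 2 first.
- by apply: CintegrableB => //; apply: Fx_int => //; lra.
- by apply: CintegrableB => //; apply: Fx_int => //; lra.
congr (_ + _); apply: eq_Cintegral => y _.
by rewrite addrA subrK.
Qed.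

(** The boundary integral does not see affine functions of the complex
    variable, so it is controlled by the distance to one. *)
Let near_affine a b c d (B A : CC R) x0 y0 (E : R) : inside a b c d -> 0 <= E ->
  (forall x y, a <= x -> x <= b -> c <= y -> y <= d ->
     modulus (F x y - B - A * Complex (x - x0) (y - y0)) <= E) ->
  modulus (rect_integral F a b c d) <= 2 * E * ((b - a) + (d - c)).
Proof.
move=> [h1 h2 h3 [h4 h5 h6]] E0 H.
have ic u v (k : CC R) : Cintegrable leb `[u, v] (fun=> k).
  by split; exact: integrable_cst_itv.
pose k : CC R := A * Complex 0 (c - d).
pose k' : CC R := A * rtoc (b - a).
have i1 : Cintegrable leb `[a, b] (fun x => F x c - F x d).
  by apply: CintegrableB => //; apply: Fx_int => //; lra.
have i2 : Cintegrable leb `[c, d] (fun y => F b y - F a y).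
  by apply: CintegrableB => //; apply: Fy_int => //; lra.
have E1 : rect_integral F a b c d =
    Cintegral leb `[a, b] (fun x => F x c - F x d - k) +
    Complex 0 1 * Cintegral leb `[c, d] (fun y => F b y - F a y - k').
  rewrite (CintegralB _ i1 (ic _ _ _))// (CintegralB _ i2 (ic _ _ _))//.
  rewrite !Cintegral_cst_itv// /rect_integral /k /k'.
  rewrite (_ : Complex 0 (c - d) = - (Complex 0 1 * rtoc (d - c))); last first.
    by apply: complex_ext; rewrite ?ReN ?ImN ?ReM ?ImM/=; ring.
  by ring.
have E2 : 0 <= 2 * E by rewrite mulr_ge0.
rewrite E1 (le_trans (le_modulusD _ _))// mulrDr lerD//.
  rewrite -Rintegral_cst_itv//; apply: modulus_Cintegral_le => //.
  - exact: CintegrableB.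
  - exact: integrable_cst_itv.
  move=> x; rewrite /= in_itv/= => /andP[ax xb].
  rewrite (_ : _ - k = (F x c - B - A * Complex (x - x0) (c - y0)) -
      (F x d - B - A * Complex (x - x0) (d - y0))); last first.
    rewrite /k (_ : Complex 0 (c - d) = Complex (x - x0) (c - y0) -
       Complex (x - x0) (d - y0)); first by ring.
    by apply: complex_ext; rewrite ?ReD ?ImD ?ReN ?ImN/=; ring.
  rewrite (le_trans (le_modulusB _ _))// mulr_natl mulr2n lerD// H//.
rewrite modulusM modulus_i mul1r -Rintegral_cst_itv//.
apply: modulus_Cintegral_le => //.
- exact: CintegrableB.
- exact: integrable_cst_itv.
move=> y; rewrite /= in_itv/= => /andP[cy yd].
rewrite (_ : _ - k' = (F b y - B - A * Complex (b - x0) (y - y0)) -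
    (F a y - B - A * Complex (a - x0) (y - y0))); last first.
  rewrite /k' (_ : rtoc (b - a) = Complex (b - x0) (y - y0) -
     Complex (a - x0) (y - y0)); first by ring.
  by apply: complex_ext; rewrite ?ReD ?ImD ?ReN ?ImN/=; ring.
rewrite (le_trans (le_modulusB _ _))// mulr_natl mulr2n lerD// H//.
Qed.

Let st : Type := (R * R * (R * R))%type.
Let J (q : st) := modulus (rect_integral F q.1.1 q.1.2 q.2.1 q.2.2).
Let ins (q : st) := inside q.1.1 q.1.2 q.2.1 q.2.2.

(** By the triangle inequality, one of the four quarters carries at least a
    quarter of the boundary integral. *)
Let bisect (q : st) : exists q' : st, ins q ->
  [/\ ins q', J q <= 4 * J q',
     [/\ q.1.1 <= q'.1.1, q'.1.2 <= q.1.2, q.2.1 <= q'.2.1 & q'.2.2 <= q.2.2] &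
     q'.1.2 - q'.1.1 = (q.1.2 - q.1.1) / 2 /\ q'.2.2 - q'.2.1 = (q.2.2 - q.2.1) / 2].
Proof.
case: q => [[a b] [c d]].
have [iQ|] := pselect (ins ((a, b), (c, d))); last by exists ((a, b), (c, d)).
have [h1 h2 h3 [h4 h5 h6]] := iQ; rewrite /= in h1 h2 h3 h4 h5 h6.
pose m := (a + b) / 2; pose n := (c + d) / 2.
have [am mb wm wm'] := midpoint h2; have [cn nd wn wn'] := midpoint h5.
rewrite -/m -/n in am mb wm wm' cn nd wn wn'.
clearbody m n.
have mb0 : m <= b0 by exact: le_trans h3.
have nd0 : n <= d0 by exact: le_trans h6.
have am0 : a0 <= m by exact: le_trans am.
have cn0 : c0 <= n by exact: le_trans cn.
have I1 : ins ((a, m), (c, n)) by split=> //=; split.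
have I2 : ins ((a, m), (n, d)) by split=> //=; split.
have I3 : ins ((m, b), (c, n)) by split=> //=; split.
have I4 : ins ((m, b), (n, d)) by split=> //=; split.
have IA : inside a m c d by split.
have IB : inside m b c d by split.
have S : rect_integral F a b c d =
   (rect_integral F a m c n + rect_integral F a m n d) +
   (rect_integral F m b c n + rect_integral F m b n d).
  by rewrite (splitx iQ am mb) (splity IA cn nd) (splity IB cn nd).
have hle : J ((a, b), (c, d)) <= (J ((a, m), (c, n)) + J ((a, m), (n, d))) +
   (J ((m, b), (c, n)) + J ((m, b), (n, d))).
  by rewrite /J/= S !(le_trans (le_modulusD _ _))// lerD ?le_modulusD.
have [k1|k1] := lerP (J ((a, b), (c, d))) (4 * J ((a, m), (c, n))).
  by exists ((a, m), (c, n)) => _; split => //; split.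
have [k2|k2] := lerP (J ((a, b), (c, d))) (4 * J ((a, m), (n, d))).
  by exists ((a, m), (n, d)) => _; split => //; split.
have [k3|k3] := lerP (J ((a, b), (c, d))) (4 * J ((m, b), (c, n))).
  by exists ((m, b), (c, n)) => _; split => //; split.
exists ((m, b), (n, d)) => _; split => //.
exact: pigeonhole hle k1 k2 k3.
Qed.

Let nested_point (u v : nat -> R) : (forall n, u n <= u n.+1) ->
  (forall n, v n.+1 <= v n) -> (forall n, u n <= v n) ->
  exists x, forall n, u n <= x /\ x <= v n.
Proof.
move=> uS vS uv; have uvn n k : u n <= v k.
  have ndu : {homo u : i j / (i <= j)%N >-> i <= j}.
    by apply: homo_leq => // i; exact: le_trans.
  have niv : {homo v : i j / (i <= j)%N >-> j <= i}.
    by apply: (@homo_leq _ v (fun x y => y <= x)) => // i j l h1 h2; exact: le_trans h1.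
  have [nk|kn] := leqP n k; first exact: le_trans (ndu _ _ nk) (uv k).
  exact: le_trans (uv n) (niv _ _ (ltnW kn)).
have hub k : ubound (range u) (v k) by move=> _ [n _ <-].
exists (sup (range u)) => n; split.
  apply: ub_le_sup; last by exists n.
  by exists (v 0%N); exact: hub.
by apply: ge_sup; [exists (u 0%N); exists 0%N|exact: hub].
Qed.

(** Cauchy's theorem for a rectangle without any continuity assumption on the
    derivative: by repeated bisection some quarter always keeps a quarter of the
    boundary integral, while around the limit point the integral of a quarter
    is negligible compared to its area. *)
Lemma rect_integral_eq0 : a0 <= b0 -> c0 <= d0 -> rect_integral F a0 b0 c0 d0 = 0.
Proof.
move=> ab0 cd0; have [nx nxP] := choice bisect.
pose q n := iter n nx ((a0, b0), (c0, d0)).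
have insq n : ins (q n).
  elim: n => [|n ih]; first by split => //=; split.
  by have [] := nxP (q n) ih.
have [x0 hx] := @nested_point (fun n => (q n).1.1) (fun n => (q n).1.2)
  (fun n => let: And4 p _ _ _ := let: And4 _ _ p _ := nxP (q n) (insq n) in p in p)
  (fun n => let: And4 _ p _ _ := let: And4 _ _ p _ := nxP (q n) (insq n) in p in p)
  (fun n => let: And4 _ p _ _ := insq n in p).
have [y0 hy] := @nested_point (fun n => (q n).2.1) (fun n => (q n).2.2)
  (fun n => let: And4 _ _ p _ := let: And4 _ _ p _ := nxP (q n) (insq n) in p in p)
  (fun n => let: And4 _ _ _ p := let: And4 _ _ p _ := nxP (q n) (insq n) in p in p)
  (fun n => let: And4 _ _ _ (And3 _ p _) := insq n in p).
have wx n : (q n).1.2 - (q n).1.1 = (b0 - a0) / 2 ^+ n.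
  elim: n => [|n ih]; first by rewrite expr0 divr1.
  have [_ _ _ [-> _]] := nxP (q n) (insq n).
  by rewrite ih exprSr invfM mulrA.
have wy n : (q n).2.2 - (q n).2.1 = (d0 - c0) / 2 ^+ n.
  elim: n => [|n ih]; first by rewrite expr0 divr1.
  have [_ _ _ [_ ->]] := nxP (q n) (insq n).
  by rewrite ih exprSr invfM mulrA.
have Jq n : J (q 0%N) <= 4 ^+ n * J (q n).
  elim: n => [|n ih]; first by rewrite expr0 mul1r.
  have [_ h _ _] := nxP (q n) (insq n).
  rewrite (le_trans ih)// exprSr -mulrA ler_wpM2l// exprn_ge0//.
have [hx1 hx2] := hx 0%N; have [hy1 hy2] := hy 0%N.
have [A HA] := dF hx1 hx2 hy1 hy2.
pose L := (b0 - a0) + (d0 - c0).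
have L0 : 0 <= L by rewrite /L; lra.
suff : J (q 0%N) <= 0.
  by move=> h; apply/eqP; rewrite -modulus_eq0 eq_le h modulus_ge0.
apply/ler_addgt0Pr => e e0; rewrite add0r.
have e1 : 0 < e / (2 * L ^+ 2 + 1).
  by rewrite divr_gt0// ltr_wpDl// mulr_ge0// sqr_ge0.
have [dl dl0 {}HA] := HA _ e1.
have [n nL] : exists n, L / 2 ^+ n < dl.
  have h : L * (2^-1) ^+ n @[n --> \oo] --> (0 : R).
    rewrite -(mulr0 L); apply: cvgMr; apply: cvg_expr.
    by rewrite ger0_norm ?invr_ge0// invf_lt1// ltr1n.
  have [N _ /(_ N (leqnn N))] := cvgr_lt _ h _ dl0.
  by rewrite exprVn => h1; exists N.
apply: le_trans (Jq n) _.
set E := e / (2 * L ^+ 2 + 1) * (L / 2 ^+ n).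
have LE : L / 2 ^+ n = ((q n).1.2 - (q n).1.1) + ((q n).2.2 - (q n).2.1).
  by rewrite wx wy -mulrDl.
have p2 : 0 < 2 ^+ n :> R by rewrite exprn_gt0.
have Ln0 : 0 <= L / 2 ^+ n by rewrite divr_ge0// ltW.
have E0 : 0 <= E by rewrite mulr_ge0// ltW.
(* The n-th quarter has sides of length at most L / 2^n, on which F is affine
   up to a small multiple of that length: the 4^n quarters are compensated by the
   square of the side. *)
have {}Jn : J (q n) <= 2 * E * (L / 2 ^+ n).
  rewrite LE; apply: (@near_affine _ _ _ _ (F x0 y0) A x0 y0 E (insq n) E0).
  move=> x y k1 k2 k3 k4.
  have [l1 l2] := hx n; have [l3 l4] := hy n.
  have xx : `|x - x0| <= (q n).1.2 - (q n).1.1.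
    exact: dist_le.
  have yy : `|y - y0| <= (q n).2.2 - (q n).2.1.
    exact: dist_le.
  have px : 0 <= `|x - x0| by [].
  have py : 0 <= `|y - y0| by [].
  have xL : `|x - x0| < dl.
    by apply: le_lt_trans nL; rewrite LE (le_trans xx)// lerDl; exact: le_trans yy.
  have yL : `|y - y0| < dl.
    by apply: le_lt_trans nL; rewrite LE (le_trans yy)// lerDr; exact: le_trans xx.
  rewrite (le_trans (HA x y xL yL))//.
  by rewrite /E ler_wpM2l ?(ltW e1)// LE lerD.
rewrite (le_trans (ler_wpM2l _ Jn)) ?exprn_ge0//.
have -> : 4 ^+ n * (2 * E * (L / 2 ^+ n)) = e * (2 * L ^+ 2) / (2 * L ^+ 2 + 1).
  have -> : 4 ^+ n = 2 ^+ n * 2 ^+ n :> R.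
    by rewrite -exprMn; congr (_ ^+ _); rewrite -natrM.
  rewrite /E; field.
  by rewrite (gt_eqF p2) gt_eqF// ltr_wpDl// mulr_ge0// sqr_ge0.
rewrite ler_pdivrMr; last by rewrite ltr_wpDl// mulr_ge0// sqr_ge0.
by rewrite ler_pM2l// lerDl.
Qed.

End Rectangle.
End Goursat.

(** * Means over circles *)
Section Polar.
Context {R : realType}.
Implicit Types (x y u v : R) (z : CC R) (h f : CC R -> CC R).

Let leb : {measure set (measurableTypeR R) -> \bar R} := @lebesgue_measure R.

Definition cis y : CC R := Complex (cos y) (sin y).

Definition polar (rho y : R) : CC R := rtoc rho * cis y.

Lemma cisD x y : cis (x + y) = cis x * cis y.
Proof. by apply: complex_ext; rewrite ?ReM ?ImM/= ?cosD ?sinD; ring. Qed.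

Lemma modulus_cis y : modulus (cis y) = 1.
Proof. by rewrite modulus_def/= cos2Dsin2 sqrtr1. Qed.

Lemma modulus_polar (rho y : R) : 0 <= rho -> modulus (polar rho y) = rho.
Proof. by move=> h; rewrite modulusM modulus_cis mulr1 modulus_rtoc ger0_norm. Qed.

Lemma cis2pi : cis (2 * pi) = cis 0.
Proof. by rewrite /cis mulr_natl cos2pi sin2pi cos0 sin0. Qed.

Lemma is_derive_approx (f : R -> R) (x0 d : R) : is_derive x0 1 f d ->
  forall e, 0 < e -> exists2 dl : R, 0 < dl & forall u, `|u| < dl ->
    `|f (x0 + u) - f x0 - d * u| <= e * `|u|.
Proof.
move=> [df fd] e e0.
have : t^-1 *: ((f \o shift x0) (t *: (1 : R)) - f x0) @[t --> 0^'] --> d.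
  by rewrite -fd; exact: df.
move=> /cvgrPdist_le/(_ e e0)/nbhs_normP[dl /= dl0 H]; exists dl => // u udl.
have [->|u0] := eqVneq u 0; first by rewrite addr0 mulr0 !subrr normr0 mulr0.
have := H u; rewrite /= sub0r normrN => /(_ udl u0) H1.
have -> : f (x0 + u) - f x0 - d * u =
   - (d - u^-1 *: (f (u *: (1 : R) + x0) - f x0)) * u.
  rewrite /GRing.scale/= mulr1 opprB mulrBl mulrAC mulVf// mul1r.
  by rewrite (addrC u).
by rewrite normrM normrN ler_wpM2r.
Qed.

(** The complex exponential [exp(u + i v)] has derivative 1 at the origin. *)
Lemma expi_approx (e : R) : 0 < e -> exists2 dl : R, 0 < dl & forall u v,
  `|u| < dl -> `|v| < dl ->
  modulus (polar (expR u) v - 1 - Complex u v) <= e * (`|u| + `|v|).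
Proof.
move=> e0; pose e1 := Num.min (e / 5) 1.
have e10 : 0 < e1 by rewrite lt_min ltr01 divr_gt0.
have e1e : e1 <= e / 5 by rewrite ge_min lexx.
have e11 : e1 <= 1 by rewrite ge_min lexx orbT.
have [d1 d10 H1] := is_derive_approx (is_derive_expR (0 : R)) e10.
have [d2 d20 H2] := is_derive_approx (is_derive_sin (0 : R)) e10.
have [d3 d30 H3] := is_derive_approx (is_derive_cos (0 : R)) e10.
exists (Num.min (Num.min d1 d2) (Num.min d3 (e1 / 2))).
  by rewrite !lt_min d10 d20 d30 divr_gt0.
move=> u v; rewrite !lt_min => /andP[/andP[u1 u2] /andP[u3 u4]].
move=> /andP[/andP[v1 v2] /andP[v3 v4]].
have := H1 u u1; rewrite add0r expR0 mul1r => h1.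
have := H2 v v2; rewrite add0r sin0 cos0 subr0 mul1r => h2.
have := H3 v v3; rewrite add0r sin0 cos0 oppr0 mul0r subr0 => h3.
move: h1 h2 h3; set E := expR u; set c := cos v; set s := sin v => h1 h2 h3.
have hE : `|E - 1| <= e1.
  have := ler_normD (E - 1 - u) u; rewrite subrK => h.
  have : `|u| * e1 <= `|u| by rewrite ler_piMr.
  lra.
have hE2 : `|E| <= 2.
  by have := ler_normD (E - 1) 1; rewrite subrK normr1; lra.
apply: (le_trans (modulus_le_ReIm _)).
rewrite /polar !ReD !ImD !ReN !ImN rtocM_Re rtocM_Im /= -/E -/c -/s oppr0 addr0.
have -> : E * c - 1 - u = (E - 1 - u) + E * (c - 1) by ring.
have -> : E * s - v = E * (s - v) + (E - 1) * v by ring.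
have k1 := ler_normD (E - 1 - u) (E * (c - 1)).
have k2 := ler_normD (E * (s - v)) ((E - 1) * v).
have k3 : `|E * (c - 1)| <= 2 * (e1 * `|v|) by rewrite normrM ler_pM.
have k4 : `|E * (s - v)| <= 2 * (e1 * `|v|) by rewrite normrM ler_pM.
have k5 : `|(E - 1) * v| <= e1 * `|v| by rewrite normrM ler_wpM2r.
have k6 : e1 * `|u| <= e / 5 * `|u| by rewrite ler_wpM2r.
have k7 : e1 * `|v| <= e / 5 * `|v| by rewrite ler_wpM2r.
have k8 : 0 <= e * `|u| by rewrite mulr_ge0// ltW.
lra.
Qed.

(** Chain rule for [h] composed with the complex exponential. *)
Lemma rect_derivable_polar h x0 y0 : derivable h (polar (expR x0) y0) 1 ->
  rect_derivable (fun x y => h (polar (expR x) y)) x0 y0.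
Proof.
set z0 := polar _ _ => dh.
have z0m : modulus z0 = expR x0 by rewrite modulus_polar// expR_ge0.
have z01 : 0 < modulus z0 by rewrite z0m expR_gt0.
have /is_deriveCP H := derivableP dh; set A := 'D_1 h z0 in H.
exists (A * z0) => e e0.
pose M := modulus A * modulus z0 + 1.
have M0 : 0 < M by rewrite ltr_wpDl// mulr_ge0 ?modulus_ge0.
have [d1 d10 H1] := H (e / (4 * modulus z0)) ltac:(by rewrite divr_gt0// mulr_gt0).
pose e2 := Num.min 1 (e / (2 * M)).
have e20 : 0 < e2 by rewrite lt_min ltr01 divr_gt0// mulr_gt0.
have e21 : e2 <= 1 by rewrite ge_min lexx.
have e22 : e2 * M <= e / 2.
  have : e2 <= e / (2 * M) by rewrite ge_min lexx orbT.
  move=> h1; apply: (le_trans (ler_wpM2r (ltW M0) h1)).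
  by rewrite invfM mulrA divfK// gt_eqF.
have [d2 d20 H2] := expi_approx e20.
exists (Num.min d2 (d1 / (4 * modulus z0))).
  by rewrite lt_min d20 divr_gt0// mulr_gt0.
move=> x y; rewrite !lt_min => /andP[x2 x3] /andP[y2 y3].
set u := x - x0 in x2 x3 *; set v := y - y0 in y2 y3 *.
set t := polar (expR u) v - 1 - Complex u v.
have tle : modulus t <= e2 * (`|u| + `|v|) by exact: H2.
have zE : polar (expR x) y = z0 + z0 * (Complex u v + t).
  have -> : z0 + z0 * (Complex u v + t) = z0 * polar (expR u) v by rewrite /t; ring.
  rewrite /z0 /polar mulrACA -rmorphM -expRD -cisD /u /v.
  by rewrite !(addrC _ (_ - _)) !subrK.
set s := `|u| + `|v| in tle *.
have s0 : 0 <= s by rewrite addr_ge0.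
have wle : modulus (Complex u v) <= s by exact: modulus_le_ReIm.
set eta := z0 * (Complex u v + t) in zE *.
have etale : modulus eta <= modulus z0 * (2 * s).
  rewrite modulusM ler_wpM2l ?modulus_ge0// (le_trans (le_modulusD _ _))//.
  have : e2 * s <= s by rewrite ler_piMl.
  lra.
have eta1 : modulus eta < d1.
  apply: le_lt_trans etale _.
  have : s < d1 / (2 * modulus z0).
    have -> : d1 / (2 * modulus z0) = d1 / (4 * modulus z0) + d1 / (4 * modulus z0).
      by field; rewrite gt_eqF.
    by rewrite /s ltrD.
  by rewrite ltr_pdivlMr ?mulr_gt0//; lra.
rewrite zE; have := H1 eta eta1.
set X := h _ - h z0 => h1.
have -> : X - A * z0 * Complex u v = (X - A * eta) + A * z0 * t.
  by rewrite /eta; ring.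
rewrite (le_trans (le_modulusD _ _))// (modulusM (A * z0)) (modulusM A z0).
have k1 : e / (4 * modulus z0) * modulus eta <= e / 2 * s.
  apply: (le_trans (ler_wpM2l _ etale)); first by rewrite divr_ge0 ?mulr_ge0 ?ltW.
  rewrite le_eqVlt; apply/orP; left; apply/eqP; field.
  by rewrite gt_eqF.
have k2 : modulus A * modulus z0 * modulus t <= e / 2 * s.
  have k3 : modulus A * modulus z0 <= M by rewrite /M lerDl.
  apply: (@le_trans _ _ (M * (e2 * s))).
    by rewrite ler_pM ?modulus_ge0// mulr_ge0 ?modulus_ge0.
  by rewrite mulrA (mulrC M) ler_wpM2r.
lra.
Qed.

Lemma cvg_polar T (F : set_system T) {FF : Filter F} (p q : T -> R) (a b : R) :
  p @ F --> a -> q @ F --> b -> polar (p t) (q t) @[t --> F] --> polar a b.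
Proof.
move=> pa qb; rewrite /polar; apply: cvgM; first exact: cvg_rtoc.
apply/cvgC_ReIm; split => /=.
  by apply: (cvg_comp _ _ qb); exact: continuous_cos.
by apply: (cvg_comp _ _ qb); exact: continuous_sin.
Qed.

Definition circle_mean h (rho : R) : CC R :=
  rtoc (2 * pi)^-1 * Cintegral leb `[0, 2 * pi] (fun y => h (polar rho y)).

Lemma circle_Cintegrable h (rho : R) : 0 <= rho ->
  (forall z, modulus z = rho -> h @ z --> h z) ->
  Cintegrable leb `[0, 2 * pi] (fun y => h (polar rho y)).
Proof.
move=> r0 ch; apply: within_continuous_Cintegrable.
apply/subspace_continuousP => y _; apply: cvg_within_filter.
have c : polar rho t @[t --> y] --> polar rho y.
  by apply: cvg_polar; [exact: cvg_cst|exact: cvg_id].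
by apply: (cvg_comp _ _ c); apply: ch; exact: modulus_polar.
Qed.

Lemma pi2_ge0 : 0 <= 2 * pi :> R.
Proof. by rewrite mulr_ge0// pi_ge0. Qed.

(** In logarithmic coordinates an annulus is a rectangle whose horizontal sides
    carry the same values, so only the two circles contribute. *)
Lemma circle_mean_const h (s1 s2 : R) : 0 < s1 -> s1 <= s2 ->
  (forall z, s1 <= modulus z -> modulus z <= s2 -> derivable h z 1) ->
  circle_mean h s1 = circle_mean h s2.
Proof.
move=> s10 s12 dh; have s20 : 0 < s2 by exact: lt_le_trans s12.
have l12 : ln s1 <= ln s2 by rewrite ler_ln ?posrE.
pose F x y := h (polar (expR x) y).
have dF x y : ln s1 <= x -> x <= ln s2 -> 0 <= y -> y <= 2 * pi ->
    rect_derivable F x y.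
  move=> h1 h2 _ _; apply: rect_derivable_polar.
  apply: dh; rewrite modulus_polar ?expR_ge0//.
    by rewrite -(lnK s10) ler_expR.
  by rewrite -(lnK s20) ler_expR.
have := rect_integral_eq0 dF l12 pi2_ge0.
have E0 : Cintegral leb `[ln s1, ln s2] (fun x => F x 0 - F x (2 * pi)) = 0.
  rewrite -(Cintegral0 leb `[ln s1, ln s2]); apply: eq_Cintegral => x _.
  by rewrite /F /polar cis2pi subrr.
rewrite /rect_integral E0 add0r => /eqP; rewrite mulf_eq0 => /orP[/eqP/(congr1 (@complex.Im R))/eqP|].
  by rewrite /= oner_eq0.
rewrite /F !lnK ?posrE//.
rewrite CintegralB//; last 2 first.
- apply: circle_Cintegrable; first exact: ltW.
  by move=> z zs; apply/derivable_continuousC/dh; rewrite zs.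
- apply: circle_Cintegrable; first exact: ltW.
  by move=> z zs; apply/derivable_continuousC/dh; rewrite zs.
by rewrite subr_eq0 => /eqP H; rewrite /circle_mean H.
Qed.

Lemma polar_bounded h (s1 s2 : R) : 0 <= s1 ->
  (forall z, s1 <= modulus z -> modulus z <= s2 -> h @ z --> h z) ->
  exists M : R, forall rho y, s1 <= rho -> rho <= s2 -> 0 <= y -> y <= 2 * pi ->
    modulus (h (polar rho y)) <= M.
Proof.
move=> s10 ch.
pose K0 : set (R * R) := [set` `[s1, s2]] `*` [set` `[0, 2 * pi]].
have K : compact K0.
  by apply: compact_setX; exact: segment_compact.
pose g (p : R * R) := modulus (h (polar p.1 p.2)).
have : {within K0, continuous g}.
  apply/subspace_continuousP => -[a b] [/= ha hb]; apply: cvg_within_filter.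
  rewrite in_itv/= in ha; case/andP : ha => sa as2.
  have a0 : 0 <= a by exact: le_trans sa.
  have c : polar p.1 p.2 @[p --> (a, b)] --> polar a b.
    by apply: cvg_polar; [exact: (@cvg_fst _ _ (nbhs a) (nbhs b))
                         |exact: (@cvg_snd _ _ (nbhs a) (nbhs b))].
  apply: cvg_modulus; apply: (cvg_comp _ _ c).
  by apply: ch; rewrite modulus_polar.
move=> /(continuous_compact)/(_ K)/compact_bounded[M [_ HM]].
exists (M + 1) => rho y h1 h2 h3 h4.
have := HM (M + 1) (ltr_pwDr ltr01 (lexx M)) (g (rho, y)).
rewrite /= ger0_norm ?modulus_ge0//; apply.
by exists (rho, y) => //; split; rewrite /= in_itv/= ?h1 ?h2 ?h3 ?h4.
Qed.

Lemma circle_mean_cvg h (s1 s2 s : R) (rho : nat -> R) : 0 < s1 ->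
  (forall z, s1 <= modulus z -> modulus z <= s2 -> h @ z --> h z) ->
  s1 <= s -> s <= s2 -> (forall n, s1 <= rho n) -> (forall n, rho n <= s2) ->
  rho @ \oo --> s ->
  circle_mean h (rho n) @[n --> \oo] --> circle_mean h s.
Proof.
move=> s10 ch s1s ss2 r1 r2 rs.
have [M HM] := polar_bounded (ltW s10) ch.
rewrite /circle_mean; apply: cvgMl_tmp.
have hr x : s1 <= x -> x <= s2 -> Cintegrable leb `[0, 2 * pi] (fun y => h (polar x y)).
  move=> h1 h2; apply: circle_Cintegrable; first by rewrite (le_trans _ h1)// ltW.
  by move=> z zx; apply: ch; rewrite zx.
apply: (proj2 (@cvg_Cintegral _ _ R leb _ _ _ (fun=> M) _ _ _ _ _)) => //.
- by move=> n; exact/Cintegrable_measurable/hr.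
- exact: integrable_cst_itv.
- move=> n y; rewrite /= in_itv/= => /andP[y0 y1]; exact: HM.
- move=> y _; have c : polar (rho n) y @[n --> \oo] --> polar s y.
    by apply: cvg_polar; [exact: rs|exact: cvg_cst].
  apply: (cvg_comp _ _ c).
  by apply: ch; rewrite modulus_polar// (le_trans _ s1s)// ltW.
Qed.

End Polar.

(** * Laurent expansion on a punctured disc *)
Section LaurentExpansion.
Context {R : realType}.
Implicit Types (x y : R) (z : CC R) (h f : CC R -> CC R).

Let leb : {measure set (measurableTypeR R) -> \bar R} := @lebesgue_measure R.

Variables (r : R) (r_gt0 : 0 < r).

Definition laurent_integral h (n : int) : CC R :=
  circle_mean (fun z => h z * z ^ (- n)) (r / 2).

(** The two properties of holomorphic functions from which the growth of the
    coefficients follows. They are isolated because the difference quotient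
    at a point has them without being known to be differentiable there. *)
Definition circle_invariant h := (forall z, pdisc r z -> h @ z --> h z) /\
  forall (n : int) (rho : R), 0 < rho -> rho < r ->
    circle_mean (fun z => h z * z ^ (- n)) rho = laurent_integral h n.

Let pdisc_modulus z : 0 < modulus z -> modulus z < r -> pdisc r z.
Proof. by move=> z0 zr; apply/pdiscP; rewrite -modulus_gt0. Qed.

Let cvg_mul_exprz h (n : int) z : z != 0 -> h @ z --> h z ->
  (fun z => h z * z ^ (- n)) @ z --> h z * z ^ (- n).
Proof. move=> z0 hz; have dz := derivable_continuousC (@derivable_exprz R (- n) z z0).
exact: (cvgM hz dz). Qed.

(** One circle of continuous singularities does no harm, since the mean over a
    circle is a continuous function of the radius. *)
Lemma circle_invariant_off_circle h (s : R) : 0 < s -> s < r ->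
  (forall z, pdisc r z -> h @ z --> h z) ->
  (forall z, pdisc r z -> modulus z != s -> derivable h z 1) ->
  circle_invariant h.
Proof.
move=> s0 sr ch dh; split; [exact: ch|move=> n].
pose H z := h z * z ^ (- n).
have cH z : pdisc r z -> H @ z --> H z.
  by move=> zr; have /pdiscP[z0 _] := zr; apply: cvg_mul_exprz; [exact: z0|exact: ch].
have dH z : pdisc r z -> modulus z != s -> derivable H z 1.
  move=> zr zs; have /pdiscP[z0 _] := zr.
  by apply: derivableM; [exact: dh|exact: derivable_exprz].
have near_s (rho : nat -> R) A : rho @ \oo --> s ->
    (forall k, s / 2 <= rho k) -> (forall k, rho k <= (s + r) / 2) ->
    (forall k, circle_mean H (rho k) = A) -> circle_mean H s = A.
  move=> rs r1 r2 hA.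
  have := @circle_mean_cvg R H (s / 2) ((s + r) / 2) s rho.
  have -> : (fun k => circle_mean H (rho k)) = cst A by apply/funext => k; exact: hA.
  move=> c; have e : cst A @ \oo --> circle_mean H s.
    apply: (c _ _ _ _ r1 r2 rs); [by rewrite divr_gt0| |by lra|by lra].
    by move=> z z1 z2; apply/cH/pdisc_modulus; lra.
  exact: (cvg_unique (@norm_hausdorff _ (CC R)) e (cvg_cst A)).
have inner rho : 0 < rho -> rho < s -> circle_mean H rho = circle_mean H s.
  move=> rho0 rhos; apply/esym.
  pose rk (k : nat) := s - (s - Num.max rho (s / 2)) * k.+1%:R^-1.
  have m1 : Num.max rho (s / 2) < s by rewrite gt_max rhos/=; lra.
  have k01 k : 0 < k.+1%:R^-1 :> R by rewrite invr_gt0.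
  have k11 k : k.+1%:R^-1 <= 1 :> R by rewrite invf_le1// ler1n.
  have rk1 k : Num.max rho (s / 2) <= rk k.
    have : (s - Num.max rho (s / 2)) * k.+1%:R^-1 <= s - Num.max rho (s / 2).
      by rewrite ler_piMr// subr_ge0 ltW.
    by rewrite /rk lerBrDr addrC -lerBrDr.
  have rk2 k : rk k < s by rewrite /rk ltrBlDr ltrDl mulr_gt0// subr_gt0.
  apply: (near_s rk).
  - rewrite /rk -[X in _ --> X]subr0; apply: cvgB; first exact: cvg_cst.
    by rewrite -[X in _ --> X](mulr0 (s - Num.max rho (s / 2))); apply: cvgMl_tmp; exact: cvg_harmonic.
  - by move=> k; apply: le_trans (rk1 k); rewrite le_max lexx orbT.
  - by move=> k; have := rk2 k; lra.
  - move=> k; apply/esym/circle_mean_const => //.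
      by apply: le_trans (rk1 k); rewrite le_max lexx.
    move=> z z1 z2; apply: dH; first by apply: pdisc_modulus; have := rk2 k; lra.
    by rewrite lt_eqF// (le_lt_trans z2).
have outer rho : s < rho -> rho < r -> circle_mean H rho = circle_mean H s.
  move=> rho0 rhos; apply/esym.
  pose rk (k : nat) := s + (Num.min rho ((s + r) / 2) - s) * k.+1%:R^-1.
  have m1 : s < Num.min rho ((s + r) / 2) by rewrite lt_min rho0/=; lra.
  have k01 k : 0 < k.+1%:R^-1 :> R by rewrite invr_gt0.
  have k11 k : k.+1%:R^-1 <= 1 :> R by rewrite invf_le1// ler1n.
  have rk1 k : rk k <= Num.min rho ((s + r) / 2).
    have : (Num.min rho ((s + r) / 2) - s) * k.+1%:R^-1 <= Num.min rho ((s + r) / 2) - s.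
      by rewrite ler_piMr// subr_ge0 ltW.
    by rewrite /rk -lerBrDl.
  have rk2 k : s < rk k by rewrite /rk ltrDl mulr_gt0// subr_gt0.
  apply: (near_s rk).
  - rewrite /rk -[X in _ --> X]addr0; apply: cvgD; first exact: cvg_cst.
    by rewrite -[X in _ --> X](mulr0 (Num.min rho ((s + r) / 2) - s)); apply: cvgMl_tmp; exact: cvg_harmonic.
  - by move=> k; have := rk2 k; lra.
  - by move=> k; apply: le_trans (rk1 k) _; rewrite ge_min lexx orbT.
  - move=> k; apply: circle_mean_const; first exact: lt_trans (rk2 k).
      by apply: le_trans (rk1 k) _; rewrite ge_min lexx.
    move=> z z1 z2; apply: dH; first by apply: pdisc_modulus; have := rk2 k; lra.
    by rewrite gt_eqF// (lt_le_trans _ z1).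
have all rho : 0 < rho -> rho < r -> circle_mean H rho = circle_mean H s.
  by move=> h1 h2; have [h3|h3|->//] := ltgtP rho s; [exact: inner|exact: outer].
by move=> rho h1 h2; rewrite /laurent_integral -/H (all _ h1 h2) all//; have := r_gt0; lra.
Qed.

Lemma circle_invariant_holomorphic f : holomorphic_on (pdisc r) f ->
  circle_invariant f.
Proof.
have r0 := r_gt0.
move=> hf; apply: (@circle_invariant_off_circle f (r / 2)); [lra|lra| |].
  by move=> z zr; apply: derivable_continuousC; exact: hf.
by move=> z zr _; exact: hf.
Qed.

Lemma circle_invariant_integrable h (n : int) (rho : R) :
  circle_invariant h -> 0 < rho -> rho < r ->
  Cintegrable leb `[0, 2 * pi] (fun y => h (polar rho y) * polar rho y ^ (- n)).
Proof.
move=> [ch _] rho0 rhor.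
apply: (@circle_Cintegrable _ (fun z => h z * z ^ (- n))); first exact: ltW.
move=> z zrho; apply: cvg_mul_exprz; first by rewrite -modulus_gt0 zrho.
by apply: ch; apply: pdisc_modulus; rewrite zrho.
Qed.

Lemma growth_laurent_integral h : circle_invariant h ->
  growth r (laurent_integral h).
Proof.
move=> ih rho rho0 rhor; have [ch eh] := ih.
have ih0 := circle_invariant_integrable 0 ih rho0 rhor.
pose c := \int[leb]_(y in `[0, 2 * pi]) modulus (h (polar rho y)).
exists ((2 * pi)^-1 * c) => n; rewrite -(eh n rho)// /circle_mean modulusM.
have p0 : 0 <= (2 * pi)^-1 :> R by rewrite invr_ge0 pi2_ge0.
rewrite modulus_rtoc ger0_norm// -mulrA ler_wpM2l//.
have im : leb.-integrable `[0, 2 * pi] (EFin \o (fun y => modulus (h (polar rho y)))).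
  apply: Cintegrable_modulus => //; apply: eq_Cintegrable ih0 => // y _.
  by rewrite oppr0 expr0z mulr1.
rewrite -ler_pdivlMr ?exprz_gt0// [leRHS]mulrC -RintegralZl//.
apply: modulus_Cintegral_le => //.
- exact: circle_invariant_integrable.
- rewrite (_ : EFin \o _ = (fun y => (rho ^ n)^-1%:E * (modulus (h (polar rho y)))%:E)%E);
    [exact: integrableZl|by apply/funext].
- have rE : rho ^ (- n) = (rho ^ n)^-1 by rewrite invr_expz.
  by move=> y _; rewrite modulusM modulusXz modulus_polar ?(ltW rho0)// rE mulrC.
Qed.

(** The mean of [z^(- n)] over a circle is homogeneous of degree [- n] in the
    radius, and does not depend on the radius; hence it vanishes unless
    [n = 0]. *)
Lemma laurent_integral_cst (c : CC R) (n : int) :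
  laurent_integral (fun=> c) n = if n == 0 then c else 0.
Proof.
have r0 := r_gt0.
have hol : holomorphic_on (pdisc r) (fun=> c) by move=> z _; exact: derivable_cst.
have ic := circle_invariant_holomorphic hol; have [_ eh] := ic.
case: eqP => [->|n0].
  rewrite /laurent_integral /circle_mean.
  rewrite (@eq_Cintegral _ _ _ _ _ _ (fun=> c)); last first.
    by move=> y _; rewrite oppr0 expr0z mulr1.
  rewrite Cintegral_cst_itv ?pi2_ge0// subr0 mulrA -rmorphM/= mulVf ?rmorph1 ?mul1r//.
  by rewrite gt_eqF// mulr_gt0// pi_gt0.
have scale rho : 0 < rho -> rho < r ->
   laurent_integral (fun=> c) n = rtoc rho ^ (- n) * circle_mean (fun z => c * z ^ (- n)) 1.
  move=> h1 h2; rewrite -(eh n rho)// /circle_mean mulrCA; congr (_ * _).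
  rewrite -CintegralZ//.
    apply: eq_Cintegral => y _.
    by rewrite /polar rmorph1 mul1r expfzMl mulrCA.
  apply: (@circle_Cintegrable _ (fun z => c * z ^ (- n)) 1) => // z z1.
  have z0 : z != 0 by rewrite -modulus_gt0 z1.
  have dz := derivable_continuousC (@derivable_exprz R (- n) z z0).
  exact: cvgMl_tmp dz.
(* Two radii of ratio 2: the ratio 2^(- n) of the two values is not 1. *)
have [a [a0 a2 a2r]] : exists a : R, [/\ 0 < a, 0 < a * 2 & a * 2 < r].
  by exists (r / 4); split; lra.
have e1 := scale (a * 2) a2 a2r.
have e2 := scale a a0 ltac:(lra).
apply/eqP; rewrite e1 mulf_eq0; apply/orP; right; move: e1; rewrite e2.
move/eqP; rewrite -subr_eq0 -mulrBl mulf_eq0 => /orP[|//].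
have mE x : 0 < x -> modulus (rtoc x ^ (- n)) = x ^ (- n).
  by move=> x0; rewrite modulusXz modulus_rtoc gtr0_norm.
rewrite subr_eq0 => /eqP/(congr1 (@modulus R)) he.
have {}he := etrans (esym (mE _ a0)) (etrans he (mE _ a2)).
move: he; rewrite expfzMl -{1}[a ^ (- n)]mulr1 => /mulfI h.
have /eqP := h (expfz_neq0 _ (lt0r_neq0 a0)).
rewrite eq_sym.
case: n n0 {ic eh e2 scale h mE} => [[|n]|n] // _.
  rewrite -exprnN invr_eq1 -natrX (eqr_nat _ _ 1).
  by rewrite -[1%N](expn0 2) eqn_exp2l.
by rewrite NegzE opprK -[(2 : R) ^ _]/((2 : R) ^+ n.+1) -natrX (eqr_nat _ _ 1) -[1%N](expn0 2) eqn_exp2l.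
Qed.

(** The difference quotient at [z0] has Laurent coefficients whose recurrence
    makes the expansion at [z0] telescope; growth kills the boundary terms. *)
Theorem laurent_sum_integral f : holomorphic_on (pdisc r) f ->
  growth r (laurent_integral f) /\
  forall z, pdisc r z -> f z = laurent_sum (laurent_integral f) z.
Proof.
move=> hf; have r0 := r_gt0; have iF := circle_invariant_holomorphic hf.
have gF := growth_laurent_integral iF; split => // z0 z0r.
have /pdiscP[z00 z01] := z0r.
pose g z := if z == z0 then 'D_1 f z0 else (f z - f z0) / (z - z0).
have gE z : f z - f z0 = (z - z0) * g z.
  rewrite /g; case: eqP => [->|/eqP zz]; first by rewrite !subrr mul0r.
  by rewrite mulrC divfK// subr_eq0.
have dg z : pdisc r z -> z != z0 -> derivable g z 1.
  move=> zr zz.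
  have dq : derivable (fun z => (f z - f z0) / (z - z0)) z 1.
    apply: derivableM.
      by apply: derivableB; [exact: hf|exact: derivable_cst].
    apply: derivableV; first by rewrite subr_eq0.
    by apply: derivableB; [exact: derivable_id|exact: derivable_cst].
  have /derivableP q := dq.
  suff : is_derive z 1 g ('D_1 (fun z => (f z - f z0) / (z - z0)) z).
    by move=> ?; exact: ex_derive.
  apply: near_eq_is_derive q.
  apply/nearC; exists (modulus (z - z0)); first by rewrite modulus_gt0 subr_eq0.
  move=> w wz; rewrite /g ifF//; apply/negbTE; apply: contraTneq wz => ->.
  by rewrite modulusB ltxx.
have cg z : pdisc r z -> g @ z --> g z.
  move=> zr; have [->|zz] := eqVneq z z0; last by apply/derivable_continuousC/dg.
  have /is_deriveCP H := derivableP (hf _ z0r).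
  apply/(@cvgC_modulus _ _ (nbhs z0))/cvgrPdist_le => e e0.
  have [dl dl0 Hd] := H e e0.
  apply/nearC; exists dl => // w wd.
  rewrite sub0r normrN ger0_norm ?modulus_ge0// /g eqxx.
  case: eqP => [_|/eqP wz]; first by rewrite subrr modulus0 ltW.
  have wz1 : 0 < modulus (w - z0) by rewrite modulus_gt0 subr_eq0.
  have := Hd (w - z0) wd; rewrite (addrC z0) subrK => h.
  rewrite -(ler_pM2r wz1) -modulusM mulrBl divfK ?subr_eq0//.
have z0m : 0 < modulus z0 by rewrite modulus_gt0.
have iG : circle_invariant g.
  apply: (@circle_invariant_off_circle g (modulus z0)) => // z zr zz.
  by apply: dg => //; apply: contraNneq zz => ->.
have gG := growth_laurent_integral iG.
pose c := laurent_integral g.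
(* The coefficients of f(z) = (z - z0) g(z) + f(z0). *)
have rec (n : int) : laurent_integral f n =
    c (n - 1) - z0 * c n + (if n == 0 then f z0 else 0).
  have ri : 0 < r / 2 by lra.
  have rr : r / 2 < r by lra.
  have hcst : holomorphic_on (pdisc r) (fun=> f z0) by move=> z _; exact: derivable_cst.
  have icst := circle_invariant_holomorphic hcst.
  rewrite -(laurent_integral_cst (f z0) n) /c /laurent_integral /circle_mean.
  rewrite mulrCA -mulrBr -mulrDr; congr (_ * _).
  have i1 := circle_invariant_integrable (n - 1) iG ri rr.
  have i2 := circle_invariant_integrable n iG ri rr.
  have i3 := circle_invariant_integrable n icst ri rr.
  rewrite -CintegralZ// -CintegralB//; last exact: CintegrableZ.
  rewrite -CintegralD//; last by apply: CintegrableB => //; exact: CintegrableZ.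
  apply: eq_Cintegral => y _; set z := polar _ _.
  have z_neq0 : z != 0 by rewrite -modulus_gt0 modulus_polar// ltW.
  have -> : z ^ (- (n - 1)) = z * z ^ (- n).
    by rewrite opprB expfzDr// expr1z.
  have -> : f z = (z - z0) * g z + f z0 by rewrite -gE subrK.
  ring.
pose T (n : int) := c n * z0 ^ (n + 1).
(* The natural number N counts the terms of degrees 0, ..., N - 1 and
   - 1, ..., - N; the constant f(z0) enters with the degree 0. *)
have part N : series (laurent_term (laurent_integral f) z0) N =
    z0 * (c (Negz N) * z0 ^ Negz N) - T (N%:Z - 1) + (if N is 0%N then 0 else f z0).
  elim: N => [|N ih].
    rewrite /series/= big_geq// /T addr0 sub0r addNr.
    by rewrite expr0z mulr1 [Negz 0]NegzE exprN1 mulrCA divff// mulr1 subrr.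
  rewrite seriesSr ih /laurent_term !rec /T.
  have e1 : z0 ^ (N%:Z + 1) = z0 * z0 ^ N%:Z by rewrite expfzDr// expr1z mulrC.
  have e2 : z0 ^ Negz N = z0 * z0 ^ Negz N.+1.
    by rewrite -[X in X * _](expr1z z0) -expfzDr//; congr (_ ^ _); rewrite !NegzE; lia.
  have -> : (N%:Z - 1 + 1 = N%:Z)%R by lia.
  have -> : (N.+1%:Z - 1 = N%:Z)%R by lia.
  have -> : (Negz N - 1 = Negz N.+1)%R by rewrite !NegzE; lia.
  rewrite e1 e2.
  move: (c (Negz N)) (c (Negz N.+1)) (c (N%:Z - 1)) (c N%:Z) (z0 ^ Negz N.+1).
  case: N {ih e1 e2} => [|N] /= c1 c2 c3 c4 d; first by rewrite expr0z; clear; ring.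
  by move: (z0 ^ _) (f z0) => e s; clear; ring.
have [c1 c2 _] := growth_cvg gG z00 z01.
have lim2 : (fun n : nat => z0 * (c (Negz n.+1) * z0 ^ Negz n.+1) -
    z0 * (c n%:Z * z0 ^ n%:Z) + f z0) @ \oo --> (f z0 : CC R).
  rewrite -[X in _ --> X]add0r; apply: cvgD; last exact: cvg_cst.
  rewrite -(subrr (z0 * 0)); apply: cvgB; apply: cvgMl_tmp.
    rewrite (cvg_shiftS (fun n => c (Negz n) * z0 ^ Negz n)).
    exact: (cvg_series_cvg_0 c2).
  exact: (cvg_series_cvg_0 c1).
have lim1 : series (laurent_term (laurent_integral f) z0) @ \oo --> f z0.
  rewrite -cvg_shiftS.
  have -> : (fun n => series (laurent_term (laurent_integral f) z0) n.+1) =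
     (fun n => z0 * (c (Negz n.+1) * z0 ^ Negz n.+1) - z0 * (c n%:Z * z0 ^ n%:Z) + f z0).
    apply/funext => n; rewrite part /T; congr (_ - _ + _).
    have -> : (n.+1%:Z - 1 = n%:Z)%R by lia.
    by rewrite mulrCA expfzDr// expr1z (mulrC _ z0).
  exact: lim2.
apply/esym; apply: cvg_lim lim1; exact: norm_hausdorff.
Qed.

End LaurentExpansion.

(** * Improper integrals *)
Section Exhaustion.
Context {R : realType}.
Implicit Types (f F : R -> R) (a b x : R) (D : set R).

Let leb : {measure set (measurableTypeR R) -> \bar R} := @lebesgue_measure R.

Lemma FTC_segment f F a b : a <= b ->
  (forall x, a <= x -> x <= b -> is_derive x 1 F (f x)) ->
  (forall x, a <= x -> x <= b -> f @ x --> f x) ->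
  (\int[leb]_(x in `[a, b]) (f x)%:E = (F b - F a)%:E)%E.
Proof.
rewrite le_eqVlt => /predU1P[->|ab] dF cf.
  by rewrite set_itv1 integral_set1 subrr.
have cF x : a <= x -> x <= b -> F @ x --> F x.
  move=> h1 h2; apply/differentiable_continuous/derivable1_diffP.
  by have ? := dF x h1 h2; exact: ex_derive.
rewrite EFinB; apply: continuous_FTC2 => //.
- apply/subspace_continuousP => x; rewrite /= in_itv/= => /andP[h1 h2].
  by apply: cvg_within_filter; exact: cf.
- split.
  + move=> x; rewrite in_itv/= => /andP[h1 h2].
    by have ? := dF x (ltW h1) (ltW h2); exact: ex_derive.
  + by apply: cvg_at_right_filter; exact: cF (lexx _) (ltW ab).
  + by apply: cvg_at_left_filter; exact: cF (ltW ab) (lexx _).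
- move=> x; rewrite in_itv/= => /andP[h1 h2]; rewrite derive1E.
  by have ? := dF x (ltW h1) (ltW h2); exact: derive_val.
Qed.

(** Improper integrals of both kinds used below, at a singular end point and at
    infinity, are limits over an increasing sequence of segments. *)
Definition exhausts (u v : nat -> R) D :=
  [/\ forall n, u n.+1 <= u n, forall n, u n <= v n, forall n, v n <= v n.+1 &
      D = \bigcup_n [set` `[u n, v n]]].

Let exhausts_nd u v D : exhausts u v D ->
  {homo (fun n => [set` `[u n, v n]]) : n m / (n <= m)%N >-> (n <= m)%O}.
Proof.
move=> [uS uv vS DE]; apply/nondecreasing_seqP => n.
by rewrite subsetEset; apply: subset_itv; rewrite bnd_simp.
Qed.

Lemma exhausts_measurable u v D : exhausts u v D ->
  measurable (D : set (measurableTypeR R)).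
Proof. by move=> [_ _ _ ->]; apply: bigcupT_measurable => n. Qed.

Lemma exhausts_segment_measurable u v D f : exhausts u v D ->
  (forall x, D x -> f @ x --> f x) ->
  forall n, measurable_fun `[u n, v n] f.
Proof.
move=> [_ _ _ DE] cf n; apply: subspace_continuous_measurable_fun => //.
apply/subspace_continuousP => x xn; apply: cvg_within_filter; apply: cf.
by rewrite DE; exists n.
Qed.

Lemma exhausts_measurable_fun u v D f : exhausts u v D ->
  (forall x, D x -> f @ x --> f x) -> measurable_fun D f.
Proof.
move=> ex cf; have := ex => -[_ _ _ DE]; rewrite DE.
apply/measurable_fun_bigcup => // n; exact: exhausts_segment_measurable ex cf n.
Qed.

Lemma ge0_cvg_integral_exhausts u v D (f : R -> \bar R) : exhausts u v D ->
  measurable_fun (D : set (measurableTypeR R)) f -> (forall x, D x -> (0 <= f x)%E) ->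
  (\int[leb]_(x in `[u n, v n]) f x @[n --> \oo] --> \int[leb]_(x in D) f x)%E.
Proof.
move=> ex mf f0; have := ex => -[uS uv vS DE].
have sub n : [set` `[u n, v n]] `<=` D by move=> x h; rewrite DE; exists n.
have h := @ge0_nondecreasing_set_cvg_integral _ (measurableTypeR R) R (fun n => [set` `[u n, v n]])
  f leb (exhausts_nd ex).
rewrite [in X in _ --> X]DE; apply: h.
- by move=> n; exact: measurable_itv.
- by move=> n; apply: (measurable_funS (exhausts_measurable ex) (sub n)).
- by move=> n x xn; exact/f0/(sub n).
Qed.

Lemma ge0_FTC_exhausts u v D f F (l : \bar R) : exhausts u v D ->
  (forall x, D x -> is_derive x 1 F (f x)) ->
  (forall x, D x -> f @ x --> f x) ->
  (forall x, D x -> 0 <= f x) ->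
  (F (v n) - F (u n))%:E @[n --> \oo] --> l ->
  (\int[leb]_(x in D) (f x)%:E = l)%E.
Proof.
move=> ex dF cf f0 Fl; have := ex => -[uS uv vS DE].
have sub n x : `[u n, v n]%classic x -> D x by move=> h; rewrite DE; exists n.
have h : (\int[leb]_(x in `[u n, v n]) (f x)%:E @[n --> \oo] -->
    \int[leb]_(x in D) (f x)%:E)%E.
  apply: ge0_cvg_integral_exhausts => //.
  by apply/measurable_EFinP; exact: exhausts_measurable_fun ex cf.
have E : (fun n => (\int[leb]_(x in `[u n, v n]) (f x)%:E)%E) =
    (fun n => (F (v n) - F (u n))%:E).
  apply/funext => n; apply: FTC_segment => // x h1 h2.
    by apply/dF/(sub n); rewrite /= in_itv/= h1.
  by apply/cf/(sub n); rewrite /= in_itv/= h1.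
rewrite E in h; exact: (cvg_unique (@ereal_hausdorff R) h Fl).
Qed.

Lemma cvg_integral_exhausts u v D f : exhausts u v D ->
  leb.-integrable D (EFin \o f) ->
  (\int[leb]_(x in `[u n, v n]) (f x)%:E @[n --> \oo] -->
    \int[leb]_(x in D) (f x)%:E)%E.
Proof.
move=> ex fi; have := ex => -[uS uv vS DE]; have mD := exhausts_measurable ex.
have mf : measurable_fun D (EFin \o f) by exact: measurable_int fi.
rewrite [in X in _ --> X]integralE.
under eq_fun do rewrite integralE.
apply: cvgeB.
- apply: fin_num_adde_defl; rewrite fin_numN.
  by apply: integrable_neg_fin_num.
- by apply: ge0_cvg_integral_exhausts => //; exact: measurable_funepos.
- by apply: ge0_cvg_integral_exhausts => //; exact: measurable_funeneg.
Qed.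

Lemma FTC_exhausts u v D f F (l : R) : exhausts u v D ->
  (forall x, D x -> is_derive x 1 F (f x)) ->
  (forall x, D x -> f @ x --> f x) ->
  leb.-integrable D (EFin \o f) ->
  F (v n) - F (u n) @[n --> \oo] --> l ->
  \int[leb]_(x in D) f x = l.
Proof.
move=> ex dF cf fi Fl; have := ex => -[uS uv vS DE].
have sub n x : `[u n, v n]%classic x -> D x by move=> h; rewrite DE; exists n.
have h := cvg_integral_exhausts ex fi.
have E : (fun n => (\int[leb]_(x in `[u n, v n]) (f x)%:E)%E) =
    (fun n => (F (v n) - F (u n))%:E).
  apply/funext => n; apply: FTC_segment => // x h1 h2.
    by apply/dF/(sub n); rewrite /= in_itv/= h1.
  by apply/cf/(sub n); rewrite /= in_itv/= h1.
rewrite E in h.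
have {}Fl : (F (v n) - F (u n))%:E @[n --> \oo] --> l%:E.
  by apply: cvg_EFin; [exact: nearW|exact: Fl].
by rewrite /Rintegral (cvg_unique (@ereal_hausdorff R) h Fl).
Qed.

End Exhaustion.

(** * Rotation invariance of the area *)
Section PlaneRotations.
Context {R : realType}.

Let leb : {measure set (measurableTypeR R) -> \bar R} := @lebesgue_measure R.
Let plane := (measurableTypeR R * measurableTypeR R)%type.
Let leb2 : {measure set plane -> \bar R} :=
  (@lebesgue_measure R \x @lebesgue_measure R)%E.

Lemma measurable_shift (t : R) :
  measurable_fun [set: measurableTypeR R] (fun x : measurableTypeR R => x + t : measurableTypeR R).
Proof. by apply: measurable_funD => //; exact: measurable_cst. Qed.

Lemma lebesgue_measure_shift (t : R) (A : set (measurableTypeR R)) :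
  measurable A -> leb ((fun x => x + t) @^-1` A) = leb A.
Proof.
move=> mA; apply/esym.
apply: (@lebesgue_measure_unique R (pushforward leb (fun x : measurableTypeR R => x + t : measurableTypeR R)));
  [exact: measurable_shift| |exact: mA].
move=> ? X [[a b] _ <-] /=; rewrite /pushforward.
have -> : (fun x => x + t) @^-1` [set` `]a, b]] = [set` `]a - t, b - t]].
  by apply/seteqP; split => x /=; rewrite !in_itv/= ltrBlDr lerBrDr.
rewrite /leb !lebesgue_measure_itv/= !lte_fin ltrD2r.
by case: ifP => // _; rewrite -!EFinB; congr EFin; ring.
Qed.

Lemma ge0_integral_shift (t : R) (f : measurableTypeR R -> \bar R) :
  measurable_fun setT f -> (forall x, (0 <= f x)%E) ->
  (\int[leb]_x f (x + t)%R = \int[leb]_x f x)%E.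
Proof.
move=> mf f0; rewrite -[LHS](@ge0_integral_pushforward _ _ _ _ _ _
    (measurable_shift t) leb setT f)//.
apply: eq_measure_integral; first exact: measurable_shift.
by move=> ? A mA _; have := lebesgue_measure_shift t mA.
Qed.

Lemma measurable_affine2 (a b : R) :
  measurable_fun [set: plane] (fun u : plane => a * u.1 + b * u.2 : measurableTypeR R).
Proof.
apply: measurable_funD; apply: measurable_funM => //; exact: measurable_cst.
Qed.

Lemma measurable_linear2 (a b c d : R) :
  measurable_fun [set: plane] (fun u : plane => (a * u.1 + b * u.2, c * u.1 + d * u.2) : plane).
Proof. by apply: measurable_fun_pair; exact: measurable_affine2. Qed.

Lemma ge0_integral_shear2 (t : R) (f : plane -> \bar R) :
  measurable_fun setT f -> (forall u, (0 <= f u)%E) ->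
  (\int[leb2]_u f (1 * u.1 + 0 * u.2, t * u.1 + 1 * u.2)%R = \int[leb2]_u f u)%E.
Proof.
move=> mf f0.
have mg := measurableT_comp mf (measurable_linear2 1 0 t 1).
rewrite (@fubini_tonelli1 _ _ _ _ _ leb leb _ mg (fun=> f0 _)).
rewrite (@fubini_tonelli1 _ _ _ _ _ leb leb _ mf f0).
apply: eq_integral => x _; rewrite /fubini_F/=.
rewrite -(@ge0_integral_shift (t * x) (fun y => f (x, y)) (measurable_fun_pair2 x mf) (fun=> f0 _)).
by apply: eq_integral => y _; rewrite !mul1r mul0r addr0 addrC.
Qed.

Lemma ge0_integral_shear1 (t : R) (f : plane -> \bar R) :
  measurable_fun setT f -> (forall u, (0 <= f u)%E) ->
  (\int[leb2]_u f (1 * u.1 + t * u.2, 0 * u.1 + 1 * u.2)%R = \int[leb2]_u f u)%E.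
Proof.
move=> mf f0.
have mg := measurableT_comp mf (measurable_linear2 1 t 0 1).
rewrite (@fubini_tonelli2 _ _ _ _ _ leb leb _ mg (fun=> f0 _)).
rewrite (@fubini_tonelli2 _ _ _ _ _ leb leb _ mf f0).
apply: eq_integral => y _; rewrite /fubini_G/=.
rewrite -(@ge0_integral_shift (t * y) (fun x => f (x, y)) (measurable_fun_pair1 y mf) (fun=> f0 _)).
by apply: eq_integral => x _; rewrite !mul1r mul0r add0r.
Qed.

Definition rotation (c s : R) (u : plane) : plane :=
  (c * u.1 + - s * u.2, s * u.1 + c * u.2).

(** A rotation is a product of three shears, each of which preserves area by
    Fubini and the translation invariance on lines. *)
Lemma ge0_integral_rotation (c s : R) (f : plane -> \bar R) :
  c ^+ 2 + s ^+ 2 = 1 -> s != 0 ->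
  measurable_fun setT f -> (forall u, (0 <= f u)%E) ->
  (\int[leb2]_u f (rotation c s u) = \int[leb2]_u f u)%E.
Proof.
move=> cs1 s0 mf f0; pose t := (c - 1) / s.
pose f1 (u : plane) := f (1 * u.1 + t * u.2, 0 * u.1 + 1 * u.2).
have mf1 : measurable_fun setT f1.
  by apply: (measurableT_comp mf); exact: measurable_linear2.
pose f2 (u : plane) := f1 (1 * u.1 + 0 * u.2, s * u.1 + 1 * u.2).
have mf2 : measurable_fun setT f2.
  by apply: (measurableT_comp mf1); exact: measurable_linear2.
rewrite -(ge0_integral_shear1 t mf f0) -/f1.
rewrite -(@ge0_integral_shear2 s f1 mf1 (fun=> f0 _)) -/f2.
rewrite -(@ge0_integral_shear1 t f2 mf2 (fun=> f0 _)) /f2 /f1.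
apply: eq_integral => -[x y] _ /=; rewrite /rotation/=; congr (f (_, _)).
  have e : s ^+ 2 = 1 - c ^+ 2 by rewrite -cs1 addrC addKr.
  have -> : - s = (c ^+ 2 - 1) / s.
    by apply: (mulIf s0); rewrite divfK// mulNr -expr2 e opprB.
  by rewrite /t; field.
by rewrite /t; field.
Qed.

Lemma integral_rotation (c s : R) (f : plane -> \bar R) :
  c ^+ 2 + s ^+ 2 = 1 -> s != 0 -> measurable_fun setT f ->
  (\int[leb2]_u f (rotation c s u) = \int[leb2]_u f u)%E.
Proof.
move=> cs1 s0 mf; rewrite integralE [RHS]integralE; congr (_ - _)%E.
  have h := ge0_integral_rotation cs1 s0 (measurable_funepos mf) (funepos_ge0 f).
  by apply: etrans h; apply: eq_integral => u _; rewrite !funeposE.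
have h := ge0_integral_rotation cs1 s0 (measurable_funeneg mf) (funeneg_ge0 f).
by apply: etrans h; apply: eq_integral => u _; rewrite !funenegE.
Qed.

End PlaneRotations.

(** * Integrals of radial functions *)
Section RadialIntegrals.
Context {R : realType}.
Implicit Types (a b s x y : R).

Let leb : {measure set (measurableTypeR R) -> \bar R} := @lebesgue_measure R.
Let plane := (measurableTypeR R * measurableTypeR R)%type.
Let leb2 : {measure set plane -> \bar R} :=
  (@lebesgue_measure R \x @lebesgue_measure R)%E.

Lemma exhausts_intro (u v : nat -> R) (D : set R) :
  (forall n, u n.+1 <= u n) -> (forall n, u n <= v n) -> (forall n, v n <= v n.+1) ->
  (forall n x, u n <= x -> x <= v n -> D x) ->
  (forall x, D x -> \forall n \near \oo, u n <= x /\ x <= v n) -> exhausts u v D.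
Proof.
move=> uS uv vS sub cov; split => //; apply/seteqP; split => [x /cov|x [n _]].
  move=> [N _ /(_ N (leqnn N))[h1 h2]]; exists N => //=.
  by rewrite in_itv/= h1.
by rewrite /= in_itv/= => /andP[]; exact: sub.
Qed.

Let leb_itv (i : interval R) : leb [set` i] =
  (if i.1 < i.2 then (i.2 : \bar R) - i.1 else 0)%E.
Proof. exact: lebesgue_measure_itv. Qed.

Definition qsq (u : plane) : measurableTypeR R := u.1 ^+ 2 + u.2 ^+ 2.

Lemma measurable_qsq : measurable_fun setT qsq.
Proof. by apply: measurable_funD; exact: measurable_funX. Qed.

(** Angles increasing to [pi / 2]: the substitution [x = a sin t] evaluates the
    primitive of a chord without leaving the domain of differentiability of
    [asin]. *)
Let tn (n : nat) : R := (pi / 2) * (1 - n.+1%:R^-1).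

Let tn_itv n : 0 <= tn n /\ tn n < pi / 2.
Proof.
have k0 : 0 < n.+1%:R^-1 :> R by rewrite invr_gt0.
have k1 : n.+1%:R^-1 <= 1 :> R by rewrite invf_le1// ler1n.
have p0 : 0 < pi / 2 :> R by rewrite divr_gt0// pi_gt0.
split; first by rewrite mulr_ge0 ?(ltW p0)// subr_ge0.
by rewrite /tn gtr_pMr// ltrBlDr ltrDl.
Qed.

Let tnS n : tn n <= tn n.+1.
Proof.
rewrite ler_wpM2l ?divr_ge0 ?pi_ge0// lerD2l lerN2 lef_pV2 ?posrE//.
by rewrite ler_nat.
Qed.

Let cvg_tn : tn @ \oo --> (pi / 2 : R).
Proof.
rewrite -[X in _ --> X]mulr1; apply: cvgMl_tmp.
rewrite -[X in _ --> X]subr0; apply: cvgB; first exact: cvg_cst.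
exact: cvg_harmonic.
Qed.

Let is_derive1_sqrt_comp (g : R -> R) x dg : is_derive x 1 g dg -> 0 < g x ->
  is_derive x 1 (Num.sqrt \o g) ((2 * Num.sqrt (g x))^-1 * dg).
Proof. by move=> h g0; apply: is_derive1_comp; exact: is_derive1_sqrt. Qed.

(** A primitive of the length [2 sqrt(a^2 - x^2)] of a chord of the disc of
    radius [a]. *)
Let circle_arc a x : 0 < a -> - a < x -> x < a ->
  is_derive x 1 (fun x => x * Num.sqrt (a ^+ 2 - x ^+ 2) + a ^+ 2 * asin (x / a))
    (2 * Num.sqrt (a ^+ 2 - x ^+ 2)).
Proof.
move=> a0 ax xa; have d0 : 0 < a ^+ 2 - x ^+ 2 by rewrite subr_sqr mulr_gt0; lra.
have xa1 : -1 < x / a < 1.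
  by rewrite ltr_pdivlMr// ltr_pdivrMr// mulN1r mul1r ax.
set S := Num.sqrt _; have S0 : 0 < S by rewrite sqrtr_gt0.
have S2 : S ^+ 2 = a ^+ 2 - x ^+ 2 by rewrite sqr_sqrtr// ltW.
have h1 : is_derive x 1 (fun x : R => a ^+ 2 - x ^+ 2) (- (2 * x)).
  by apply: is_derive_eq; rewrite /GRing.scale/=; ring.
have h2 := is_derive1_sqrt_comp h1 d0.
have h3 : is_derive x 1 (fun x : R => x / a) a^-1.
  have -> : (fun x : R => x / a) = (fun x => a^-1 *: x).
    by apply/funext => t; rewrite mulrC.
  by apply: is_derive_eq; rewrite /GRing.scale/= mulr1.
have h4 : is_derive x 1 (@asin R \o (fun x : R => x / a))
    ((Num.sqrt (1 - (x / a) ^+ 2))^-1 * a^-1).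
  by apply: is_derive1_comp; exact: is_derive1_asin.
have E : Num.sqrt (1 - (x / a) ^+ 2) = S / a.
  apply/eqP; rewrite -(@eqrXn2 _ 2) ?sqrtr_ge0 ?divr_ge0 ?ltW//.
  rewrite sqr_sqrtr; last first.
    by have /andP[h h'] := xa1; rewrite subr_ge0; move: (x / a) h h' => q h h'; nra.
  rewrite !exprMn S2; apply/eqP; field; exact: lt0r_neq0.
have := is_deriveD (is_deriveM (is_derive_id x 1) h2) (is_deriveZ (a ^+ 2) h4).
move=> h5; apply: (@is_derive_eq _ _ _ _ _ _ _ _ h5).
rewrite E /GRing.scale/= -/S.
have -> : a ^+ 2 * ((S / a)^-1 / a) = a ^+ 2 / S by field; rewrite !lt0r_neq0.
have -> : a ^+ 2 = S ^+ 2 + x ^+ 2 by rewrite S2; ring.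
by field; exact: lt0r_neq0.
Qed.

Let arc_integral s : 0 < s ->
  (\int[leb]_(x in `](- Num.sqrt s)%R, (Num.sqrt s)%R[) (2 * Num.sqrt (s - x ^+ 2))%:E =
   (pi * s)%:E)%E.
Proof.
move=> s0; set a := Num.sqrt s; have a0 : 0 < a by rewrite sqrtr_gt0.
have sE : s = a ^+ 2 by rewrite sqr_sqrtr// ltW.
have tI n : tn n \in `[- (pi / 2), pi / 2] /\ - tn n \in `[- (pi / 2), pi / 2].
  have [h1 h2] := tn_itv n; have p0 : 0 < pi :> R by exact: pi_gt0.
  by rewrite !in_itv/=; split; apply/andP; split; lra.
have p2I : pi / 2 \in `[- (pi / 2), pi / 2 :> R].
  have p0 : 0 < pi :> R by exact: pi_gt0.
  by rewrite in_itv/=; apply/andP; split; lra.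
have sin_le x y : x \in `[- (pi / 2), pi / 2] -> y \in `[- (pi / 2), pi / 2] ->
    x <= y -> sin x <= sin y.
  move=> xI yI; rewrite le_eqVlt => /predU1P[->//|xy].
  by apply: ltW; rewrite ltr_sin.
have vlt n : a * sin (tn n) < a.
  rewrite gtr_pMr// -sin_pihalf ltr_sin//; first by have [] := tn_itv n.
  by have [] := tI n.
have v0 n : 0 <= a * sin (tn n).
  rewrite mulr_ge0 ?(ltW a0)// -(sin0 R); apply: sin_le.
  - by rewrite in_itv/= oppr_le0 !divr_ge0 ?pi_ge0.
  - by have [] := tI n.
  - by have [] := tn_itv n.
have vS n : a * sin (tn n) <= a * sin (tn n.+1).
  by rewrite ler_pM2l//; apply: sin_le => //; have [] := tI n; have [] := tI n.+1.
have cv : a * sin (tn n) @[n --> \oo] --> a.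
  rewrite -[X in _ --> X]mulr1 -sin_pihalf; apply: cvgMl_tmp.
  by apply: (cvg_comp _ _ cvg_tn); exact: continuous_sin.
apply: (@ge0_FTC_exhausts _ (fun n => - (a * sin (tn n))) (fun n => a * sin (tn n)) _ _
   (fun x => x * Num.sqrt (a ^+ 2 - x ^+ 2) + a ^+ 2 * asin (x / a))).
- apply: exhausts_intro.
  + by move=> n; rewrite lerN2.
  + by move=> n; have := v0 n; lra.
  + by [].
  + move=> n x h1 h2; rewrite /= in_itv/=; have := vlt n.
    by move=> h3; apply/andP; split; lra.
  + move=> x; rewrite /= in_itv/= => /andP[h1 h2].
    have k1 : \forall n \near \oo, x < a * sin (tn n) by apply: (cvgr_gt _ cv).
    have k2 : \forall n \near \oo, - x < a * sin (tn n).
      by apply: (cvgr_gt _ cv); lra.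
    by near=> n; split; [rewrite lerNl|]; apply: ltW; near: n.
- move=> x; rewrite /= in_itv/= => /andP[h1 h2]; rewrite sE; exact: circle_arc.
- move=> x _; rewrite sE; apply: cvgMl_tmp.
  have c : a ^+ 2 - y ^+ 2 @[y --> x] --> a ^+ 2 - x ^+ 2.
    apply: cvgB; first exact: cvg_cst.
    exact: exprn_continuous.
  by apply: (cvg_comp _ _ c); exact: sqrt_continuous.
- by move=> x _; rewrite mulr_ge0// sqrtr_ge0.
- pose G (n : nat) := 2 * a ^+ 2 * (sin (tn n) * cos (tn n) + tn n).
  have GE n : a * sin (tn n) * Num.sqrt (a ^+ 2 - (a * sin (tn n)) ^+ 2) +
     a ^+ 2 * asin (a * sin (tn n) / a) -
     (- (a * sin (tn n)) * Num.sqrt (a ^+ 2 - (- (a * sin (tn n))) ^+ 2) +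
     a ^+ 2 * asin (- (a * sin (tn n)) / a)) = G n.
    have [I1 I2] := tI n.
    have -> : a * sin (tn n) / a = sin (tn n) by rewrite mulrAC divff ?mul1r// gt_eqF.
    have -> : - (a * sin (tn n)) / a = sin (- tn n).
      by rewrite sinN mulNr mulrAC divff ?mul1r// gt_eqF.
    rewrite !sinK// sqrrN.
    have -> : a ^+ 2 - (a * sin (tn n)) ^+ 2 = (a * cos (tn n)) ^+ 2.
      by rewrite !exprMn cos2sin2; ring.
    rewrite sqrtr_sqr ger0_norm; last first.
      by rewrite mulr_ge0 ?(ltW a0)// cos_ge0_pihalf// -in_itv.
    by rewrite /G; ring.
  apply: cvg_EFin; first exact: nearW.
  rewrite (_ : fine \o _ = G); last by apply/funext => n; rewrite /= GE.
  have -> : pi * s = 2 * a ^+ 2 * (sin (pi / 2) * cos (pi / 2) + pi / 2).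
    by rewrite sin_pihalf cos_pihalf sE; field.
  apply: cvgMl_tmp; apply: cvgD; last exact: cvg_tn.
  apply: cvgM.
    by apply: (cvg_comp _ _ cvg_tn); exact: continuous_sin.
  by apply: (cvg_comp _ _ cvg_tn); exact: continuous_cos.
Unshelve. all: by end_near. Qed.

Let measurable_disc s : measurable ([set u | qsq u <= s] : set plane).
Proof.
rewrite (_ : [set u | _] = qsq @^-1` [set` `]-oo, s]]); last first.
  by apply/seteqP; split => u /=; rewrite in_itv.
by rewrite -[X in measurable X]setTI; exact: measurable_qsq.
Qed.

Lemma area_disc s : 0 <= s -> leb2 [set u | qsq u <= s] = (pi * s)%:E.
Proof.
move=> s0; transitivity (\int[leb]_x leb (xsection [set u | (qsq u <= s)%R] x))%E; first by [].
have sec x : leb (xsection [set u | qsq u <= s] x) = (2 * Num.sqrt (s - x ^+ 2))%:E.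
  have [xs|xs] := lerP (x ^+ 2) s; last first.
    rewrite (_ : xsection _ _ = set0) ?measure0; last first.
      apply/seteqP; split => // y; rewrite /xsection/= inE/= /qsq/= => h.
      by have := sqr_ge0 y; move: h xs; move: (x ^+ 2) (y ^+ 2) => X Y; lra.
    by rewrite ler0_sqrtr ?mulr0// subr_le0 ltW.
  rewrite (_ : xsection _ _ = [set` `[- Num.sqrt (s - x ^+ 2), Num.sqrt (s - x ^+ 2)]]).
    rewrite leb_itv/= lte_fin.
    have := sqrtr_ge0 (s - x ^+ 2); set S := Num.sqrt _; rewrite le_eqVlt.
    case/predU1P => [<-|S0]; first by rewrite oppr0 ltxx mulr0.
    by rewrite gtrN// -EFinD; congr EFin; ring.
  apply/seteqP; split => y; rewrite /xsection/= inE/= /qsq/= in_itv/=.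
    move=> h; rewrite -ler_norml -sqrtr_sqr ler_wsqrtr//.
    by move: h; move: (x ^+ 2) (y ^+ 2) => X Y; lra.
  rewrite -ler_norml => h; have : `|y| ^+ 2 <= Num.sqrt (s - x ^+ 2) ^+ 2.
    by rewrite lerXn2r ?nnegrE ?sqrtr_ge0.
  rewrite real_normK ?num_real// sqr_sqrtr ?subr_ge0//.
  by move: (x ^+ 2) (y ^+ 2) => X Y; lra.
under eq_integral do rewrite sec.
move: s0; rewrite le_eqVlt => /predU1P[<-|s0].
  rewrite mulr0 integral0_eq// => x _; rewrite ler0_sqrtr ?mulr0//.
  by rewrite sub0r oppr_le0 sqr_ge0.
rewrite -(arc_integral s0) [RHS]integral_mkcond; apply: eq_integral => x _.
rewrite patchE; case: ifPn => // /negP xn; rewrite ler0_sqrtr ?mulr0//.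
rewrite subr_le0 leNgt; apply/negP => xs; apply: xn.
rewrite inE/= in_itv/= -ltr_norml -sqrtr_sqr ltr_sqrt//.
Qed.

Lemma area_annulus a b : 0 <= a -> a <= b ->
  leb2 (qsq @^-1` [set` `]a, b]]) = (pi * (b - a))%:E.
Proof.
move=> a0 ab; rewrite (_ : _ @^-1` _ = [set u | qsq u <= b] `\` [set u | qsq u <= a]).
  have fin : (leb2 [set u | (qsq u <= b)%R] < +oo)%E.
    by rewrite area_disc ?ltry// (le_trans a0).
  have h := measureD (measurable_disc b) (measurable_disc a) fin.
  rewrite [LHS]h (_ : _ `&` _ = [set u | qsq u <= a]); last first.
    by apply/seteqP; split => [u []//|u /= h1]; split => //=; exact: le_trans ab.
  transitivity ((pi * b)%:E - (pi * a)%:E)%E; last by rewrite -EFinB mulrBr.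
  by congr (_ - _)%E; apply: area_disc => //; exact: le_trans a0 ab.
apply/seteqP; split => u /=; rewrite in_itv/=.
  by move=> /andP[h1 h2]; split => //; apply/negP; rewrite -ltNge.
by move=> [-> /negP]; rewrite -ltNge => ->.
Qed.

Let posR : set (measurableTypeR R) := [set` `]0, +oo[].
Let mposR : measurable posR. Proof. exact: measurable_itv. Qed.

(** The squared modulus pushes the area measure forward to [pi] times the
    length, since the area of a disc is proportional to its squared radius. *)
Lemma pushforward_qsq (A : set (measurableTypeR R)) : measurable A -> A `<=` posR ->
  leb2 (qsq @^-1` A) = (pi%:E * leb A)%E.
Proof.
move=> mA Ap.
pose piN : {nonneg R} := NngNum (pi_ge0 R).
pose push : {measure set (measurableTypeR R) -> \bar R} :=
  measure_function_pushforward__canonical__measure_function_Measure leb2 measurable_qsq.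
have key (X : set (measurableTypeR R)) : ocitv X ->
   mrestr push mposR X = mrestr (mscale piN leb) mposR X.
  move=> [[a b] _ <-] /=; rewrite /mrestr /mscale/= /pushforward.
  have -> : [set` `]a, b]] `&` posR = [set` `]Num.max a 0, b]].
    apply/seteqP; split => x; rewrite /posR /= !in_itv/= gt_max andbT.
      by move=> [/andP[-> ->] ->].
    by move=> /andP[/andP[-> ->] ->].
  have m0 : 0 <= Num.max a 0 by rewrite le_max lexx orbT.
  rewrite leb_itv/= lte_fin.
  case: ltP => [mb|bm].
    by rewrite area_annulus ?(ltW mb)// -EFinD.
  rewrite mule0 set_itv_ge ?preimage_set0 ?measure0// bnd_simp -leNgt.
  exact: bm.
pose mu1 : {measure set (measurableTypeR R) -> \bar R} :=
  [the measure _ _ of mrestr push mposR].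
pose mu2 : {measure set (measurableTypeR R) -> \bar R} :=
  [the measure _ _ of mrestr (mscale piN leb) mposR].
have := @measure_unique _ R (measurableTypeR R) (@ocitv R)
  (fun k => [set` `]- k%:R, k%:R]]) _ _ _ _ mu1 mu2 key _ A mA.
rewrite /mu1 /mu2/= /mrestr/= /mscale/= /pushforward (setIidl Ap).
apply => //.
- exact: ocitvI.
- by move=> k; exists (- k%:R, k%:R).
- apply/seteqP; split => // x _.
  have [N _ /(_ N (leqnn N))] := nbhs_infty_gtr `|x|.
  by rewrite ltr_norml => /andP[h1 h2]; exists N => //=; rewrite in_itv/= h1 ltW.
- move=> k; rewrite [X in (X < _)%E]key; last by exists (- k%:R, k%:R).
  rewrite /mrestr /mscale/=.
  pose I : set (measurableTypeR R) := [set` `]- k%:R, k%:R]].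
  have le1 : (leb (I `&` posR) <= leb I)%E.
    have mI : measurable I by exact: measurable_itv.
    by apply: le_measure; rewrite ?inE => //; apply: (@measurableI _ (measurableTypeR R)).
  rewrite lte_mul_pinfty ?lee_fin ?pi_ge0//; apply: (le_lt_trans le1).
  by rewrite /I leb_itv/=; case: ifP => _; rewrite ?ltry// -EFinD ltry.
Qed.

Lemma ge0_integral_radial (D : set (measurableTypeR R)) (phi : measurableTypeR R -> \bar R) :
  measurable D -> D `<=` posR -> measurable_fun D phi -> (forall x, D x -> (0 <= phi x)%E) ->
  (\int[leb2]_(u in qsq @^-1` D) phi (qsq u) = pi%:E * \int[leb]_(s in D) phi s)%E.
Proof.
move=> mD Dp mphi phi0.
pose piN : {nonneg R} := NngNum (pi_ge0 R).
have phi0' : {in D, forall x, (0 <= phi x)%E} by move=> x; rewrite inE; exact: phi0.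
have <- := @ge0_integral_pushforward _ _ _ _ _ _ measurable_qsq leb2 D phi mD mphi phi0'.
rewrite -(@ge0_integral_mscale _ (measurableTypeR R) R leb D mD piN phi mphi phi0).
apply: eq_measure_integral; first exact: measurable_qsq.
move=> ? A mA AD; exact: pushforward_qsq (subset_trans AD Dp).
Qed.

End RadialIntegrals.

(** * The Beta and Gamma integrals *)
Section EulerIntegrals.
Context {R : realType}.
Implicit Types (a b c s t x : R).

Let leb : {measure set (measurableTypeR R) -> \bar R} := @lebesgue_measure R.

Lemma is_derive_powR_subl b rho s : s < rho ->
  is_derive s 1 (fun s => (rho - s) `^ b) (- (b * (rho - s) `^ (b - 1))).
Proof.
move=> h; have p : 0 < rho - s by rewrite subr_gt0.
have -> : - (b * (rho - s) `^ (b - 1)) = b * (rho - s) `^ (b - 1) * -1 by rewrite mulrN1.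
have h1 : is_derive s 1 (fun s : R => rho - s) (-1).
  have h0 := is_deriveB (is_derive_cst rho s 1) (is_derive_id s 1).
  by apply: (@is_derive_eq _ _ _ _ _ _ _ _ h0); rewrite sub0r.
have h2 : is_derive (rho - s) 1 (@powR R ^~ b) (b * (rho - s) `^ (b - 1)).
  exact: is_derive1_powR.
exact: (@is_derive1_comp R (@powR R ^~ b) (fun s : R => rho - s)).
Qed.

Lemma powR_continuous_gt0 b s : 0 < s -> t `^ b @[t --> s] --> s `^ b.
Proof.
move=> s0; suff : {for s, continuous (@powR R ^~ b)} by [].
apply/differentiable_continuous/derivable1_diffP.
by apply: derivable_powR; rewrite in_itv/= andbT.
Qed.

Lemma powR_subl_continuous b rho s : s < rho ->
  (rho - t) `^ b @[t --> s] --> (rho - s) `^ b.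
Proof.
move=> h; have c : rho - t @[t --> s] --> rho - s.
  by apply: cvgB; [exact: cvg_cst|exact: cvg_id].
have p : 0 < rho - s by rewrite subr_gt0.
exact: (cvg_comp _ _ c (powR_continuous_gt0 (b := b) p)).
Qed.

Lemma cvg_powR0 (u : nat -> R) c : 0 < c -> (forall n, 0 < u n) ->
  u @ \oo --> 0 -> (u n) `^ c @[n --> \oo] --> 0.
Proof.
move=> c0 u0 cu; have cr : u @ \oo --> 0^'+.
  move=> A hA; have h : \forall n \near \oo, 0 < u n -> A (u n) := cu _ hA.
  have : \forall n \near \oo, A (u n) by apply: filterS h => n; apply.
  by [].
exact: (cvg_comp _ _ cr (powR_cvg0 c0)).
Qed.

(** The distance to the end points of the segments that exhaust the interval
    from 0 to [rho]; the denominator starts at 2 so that none of them is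
    reversed. *)
Definition margin rho (n : nat) : R := rho * (n.+2%:R)^-1.

Lemma margin_gt0 rho n : 0 < rho -> 0 < margin rho n.
Proof. by move=> h; rewrite divr_gt0. Qed.

Lemma margin_le rho n : 0 < rho -> margin rho n <= rho / 2.
Proof. by move=> h; rewrite ler_pM2l// lef_pV2 ?posrE// ler_nat. Qed.

Lemma cvg_margin rho : margin rho @ \oo --> 0.
Proof.
rewrite -(mulr0 rho); apply: cvgMl_tmp.
have h := @cvg_harmonic R; rewrite -(cvg_shiftS (@harmonic R)) in h; exact: h.
Qed.

Lemma exhausts_margin rho : 0 < rho ->
  exhausts (margin rho) (fun n => rho - margin rho n) `]0, rho[.
Proof.
move=> r0; have eS n : margin rho n.+1 <= margin rho n.
  by rewrite ler_pM2l// lef_pV2 ?posrE// ler_nat.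
apply: exhausts_intro => //.
- by move=> n; have := margin_le n r0; move: (margin rho n) => e; lra.
- by move=> n; rewrite lerD2l lerN2.
- move=> n x h1 h2; rewrite /= in_itv/=; have := margin_gt0 n r0.
  by move: (margin rho n) h1 h2 => e h1 h2 h3; apply/andP; split; lra.
- move=> x; rewrite /= in_itv/= => /andP[x0 xr].
  have k1 : \forall n \near \oo, margin rho n < x by apply: (cvgr_lt _ (@cvg_margin rho)).
  have k2 : \forall n \near \oo, margin rho n < rho - x.
    by apply: (cvgr_lt _ (@cvg_margin rho)); rewrite subr_gt0.
  near=> n; split; first by apply: ltW; near: n.
  by rewrite lerBrDl -lerBrDr; apply: ltW; near: n.
Unshelve. all: by end_near. Qed.

Let leb_itv (i : interval R) : leb [set` i] =
  (if i.1 < i.2 then (i.2 : \bar R) - i.1 else 0)%E.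
Proof. exact: lebesgue_measure_itv. Qed.

Let powRS s b : 0 < s -> s `^ (b + 1) = s * s `^ b.
Proof.
move=> s0; rewrite powRD; last by rewrite (@gt_eqF _ _ s)// implybT.
by rewrite powRr1 ?(ltW s0)// mulrC.
Qed.

Let powRV c s : 0 < s -> s^-1 `^ c = (s `^ c)^-1.
Proof.
move=> s0; have p0 : s `^ c != 0 by rewrite gt_eqF// powR_gt0.
apply: (mulIf p0); rewrite -powRM ?invr_ge0 ?(ltW s0)// mulVf ?gt_eqF//.
by rewrite powR1 mulVf.
Qed.

Definition beta_weight rho a b s := s `^ b * (rho - s) `^ a.

Lemma beta_weight_ge0 rho a b s : 0 <= beta_weight rho a b s.
Proof. by rewrite mulr_ge0// powR_ge0. Qed.

Lemma beta_weight_continuous rho a b s : 0 < s -> s < rho ->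
  beta_weight rho a b t @[t --> s] --> beta_weight rho a b s.
Proof.
move=> s0 sr; apply: cvgM; first exact: powR_continuous_gt0.
exact: powR_subl_continuous.
Qed.

Lemma measurable_beta_weight rho a b : 0 < rho ->
  measurable_fun (`]0, rho[ : set (measurableTypeR R)) (beta_weight rho a b).
Proof.
move=> r0; apply: (exhausts_measurable_fun (exhausts_margin r0)) => x.
by rewrite /= in_itv/= => /andP[]; exact: beta_weight_continuous.
Qed.

Let powR_le_ends x a b c : 0 < a -> a <= x -> x <= b -> x `^ c <= a `^ c + b `^ c.
Proof.
move=> a0 ax xb; have [c0|c0] := leP 0 c.
  apply: (@le_trans _ _ (b `^ c)); last by rewrite lerDr powR_ge0.
  by apply: ge0_ler_powR => //; rewrite nnegrE; lra.
apply: (@le_trans _ _ (a `^ c)); last by rewrite lerDl powR_ge0.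
have -> : c = - (- c) by rewrite opprK.
rewrite powRN [leRHS]powRN lef_pV2 ?posrE ?powR_gt0//; last lra.
by apply: ge0_ler_powR => //; rewrite ?nnegrE; lra.
Qed.

(** On each half of the interval one factor is bounded, and the power that
    remains has an explicit primitive. *)
Lemma beta_weight_integrable rho a b : 0 < rho -> -1 < a -> -1 < b ->
  leb.-integrable `]0, rho[ (EFin \o beta_weight rho a b).
Proof.
move=> r0 a1 b1.
pose C1 := (rho / 2) `^ a + rho `^ a; pose C2 := (rho / 2) `^ b + rho `^ b.
have C10 : 0 <= C1 by rewrite addr_ge0// powR_ge0.
have C20 : 0 <= C2 by rewrite addr_ge0// powR_ge0.
pose g s := C1 * s `^ b + C2 * (rho - s) `^ a.
have g0 s : 0 <= g s by rewrite addr_ge0// mulr_ge0// powR_ge0.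
have cg s : `]0, rho[%classic s -> g t @[t --> s] --> g s.
  rewrite /= in_itv/= => /andP[s0 sr]; apply: cvgD; apply: cvgMl_tmp.
    exact: powR_continuous_gt0.
  exact: powR_subl_continuous.
have ig : leb.-integrable `]0, rho[ (EFin \o g).
  apply/integrableP; split.
    by apply/measurable_EFinP; apply: (exhausts_measurable_fun (exhausts_margin r0)).
  under eq_integral do rewrite /= ger0_norm//.
  have b2 : 0 < b + 1 by lra.
  have a2 : 0 < a + 1 by lra.
  pose F s := C1 / (b + 1) * s `^ (b + 1) + - (C2 / (a + 1)) * (rho - s) `^ (a + 1).
  pose l := C1 / (b + 1) * rho `^ (b + 1) + C2 / (a + 1) * rho `^ (a + 1).
  suff -> : (\int[leb]_(x in `]0%R, rho[) (g x)%:E = l%:E)%E by rewrite ltry.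
  apply: (@ge0_FTC_exhausts R _ _ _ g F l%:E (exhausts_margin r0)).
  - move=> s; rewrite /= in_itv/= => /andP[s0 sr].
    have h1 : is_derive s 1 (@powR R ^~ (b + 1)) ((b + 1) * s `^ (b + 1 - 1)).
      exact: is_derive1_powR.
    have h2 := @is_derive_powR_subl (a + 1) rho s sr.
    have h3 := is_deriveD (is_deriveZ (C1 / (b + 1)) h1) (is_deriveZ (- (C2 / (a + 1))) h2).
    apply: (@is_derive_eq _ _ _ _ _ _ _ _ h3).
    rewrite /GRing.scale/= !addrK /g.
    move: (s `^ b) ((rho - s) `^ a) => X Y; field.
    by rewrite !gt_eqF.
  - exact: cg.
  - by [].
  apply: cvg_EFin; first exact: nearW.
  have e1 : (margin rho n) `^ (b + 1) @[n --> \oo] --> 0.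
    apply: cvg_powR0; [by []|by move=> n; exact: margin_gt0|exact: cvg_margin].
  have e2 : (margin rho n) `^ (a + 1) @[n --> \oo] --> 0.
    apply: cvg_powR0; [by []|by move=> n; exact: margin_gt0|exact: cvg_margin].
  have e3 c : (rho - margin rho n) `^ c @[n --> \oo] --> rho `^ c.
    have h := @powR_subl_continuous c rho 0 r0; rewrite subr0 in h.
    exact: (cvg_comp _ _ (@cvg_margin rho) h).
  have -> : fine \o (fun n => (F (rho - margin rho n) - F (margin rho n))%:E) = (fun n =>
     (C1 / (b + 1) * (rho - margin rho n) `^ (b + 1) + - (C2 / (a + 1)) * (margin rho n) `^ (a + 1)) -
     (C1 / (b + 1) * (margin rho n) `^ (b + 1) + - (C2 / (a + 1)) * (rho - margin rho n) `^ (a + 1))).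
    by apply/funext => n /=; rewrite /F subKr.
  have -> : l =
     (C1 / (b + 1) * rho `^ (b + 1) + - (C2 / (a + 1)) * 0) -
     (C1 / (b + 1) * 0 + - (C2 / (a + 1)) * rho `^ (a + 1)).
    by rewrite !mulr0 addr0 add0r mulNr opprK.
  by apply: cvgB; apply: cvgD; apply: cvgMl_tmp.
have m1 : measurable_fun (`]0, rho[ : set (measurableTypeR R)) (beta_weight rho a b).
  exact: measurable_beta_weight.
apply: le_integrable ig => //; first exact/measurable_EFinP.
move=> s; rewrite /= in_itv/= => /andP[s0 sr].
rewrite lee_fin ger0_norm ?beta_weight_ge0// ger0_norm// /g /beta_weight.
have sb0 := powR_ge0 s b; have sa0 := powR_ge0 (rho - s) a.
have [h|h] := leP s (rho / 2).
  have k : (rho - s) `^ a <= C1 by apply: powR_le_ends; lra.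
  apply: (@le_trans _ _ (C1 * s `^ b)); last by rewrite lerDl mulr_ge0.
  by rewrite mulrC ler_wpM2r.
have k : s `^ b <= C2 by apply: powR_le_ends; lra.
apply: (@le_trans _ _ (C2 * (rho - s) `^ a)); last by rewrite lerDr mulr_ge0.
by rewrite ler_wpM2r.
Qed.

(** Near 0 the weight is at least a constant times [1 / s], whose primitive is
    unbounded. *)
Lemma beta_weight_divergent rho a b : 0 < rho -> b <= -1 ->
  (\int[leb]_(s in `]0%R, rho[) (beta_weight rho a b s)%:E = +oo)%E.
Proof.
move=> r0 b1; pose h := rho / 2; have h0 : 0 < h by rewrite divr_gt0.
have hr : rho = h + h by rewrite /h; lra.
pose M := (h `^ (- a) + rho `^ (- a)); have M0 : 0 < M by rewrite addr_gt0// powR_gt0.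
pose K := rho `^ (b + 1) / M; have K0 : 0 < K by rewrite divr_gt0// powR_gt0.
have sub : `]0, h[%classic `<=` `]0, rho[%classic.
  move=> s; rewrite /= !in_itv/= => /andP[s0 sh]; rewrite s0 hr (lt_trans sh)//.
  by rewrite ltrDl.
apply/eqP; rewrite -leye_eq.
have mw := @measurable_beta_weight rho a b r0.
have le1 : (\int[leb]_(s in `]0%R, h[) (beta_weight rho a b s)%:E <=
    \int[leb]_(s in `]0%R, rho[) (beta_weight rho a b s)%:E)%E.
  apply: ge0_subset_integral => //; first exact/measurable_EFinP.
  by move=> s _; rewrite lee_fin beta_weight_ge0.
apply: (le_trans _ le1).
have le2 : (\int[leb]_(s in `]0%R, h[) (K * s^-1)%:E <=
    \int[leb]_(s in `]0%R, h[) (beta_weight rho a b s)%:E)%E.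
  apply: ge0_le_integral => //.
  - move=> s; rewrite /= in_itv/= => /andP[s0 _].
    by rewrite lee_fin mulr_ge0 ?invr_ge0 ?(ltW K0) ?(ltW s0).
  - apply/measurable_EFinP; apply: (exhausts_measurable_fun (exhausts_margin h0)) => s.
    rewrite /= in_itv/= => /andP[s0 _]; apply: cvgMl_tmp.
    by apply: inv_continuous; rewrite gt_eqF.
  - by apply/measurable_EFinP; exact: measurable_funS mw.
  - move=> s; rewrite /= in_itv/= => /andP[s0 sh]; rewrite lee_fin.
    have k1 : M^-1 <= (rho - s) `^ a.
      have -> : a = - (- a) by rewrite opprK.
      rewrite powRN lef_pV2 ?posrE//; last by rewrite powR_gt0 ?hr; lra.
      by apply: powR_le_ends; rewrite ?hr; lra.
    have k2 : rho `^ (b + 1) <= s `^ (b + 1).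
      have -> : b + 1 = - (- (b + 1)) by rewrite opprK.
      rewrite powRN [leRHS]powRN lef_pV2 ?posrE ?powR_gt0//.
      by apply: ge0_ler_powR; rewrite ?nnegrE ?hr; lra.
    have -> : beta_weight rho a b s = s^-1 * s `^ (b + 1) * (rho - s) `^ a.
      by rewrite powRS// mulKf// gt_eqF.
    rewrite /K [leLHS]mulrC -!mulrA ler_wpM2l ?invr_ge0 ?(ltW s0)//.
    by rewrite ler_pM ?powR_ge0 ?invr_ge0 ?(ltW M0).
apply: (le_trans _ le2).
suff -> : (\int[leb]_(s in `]0%R, h[) (K * s^-1)%:E = +oo)%E by [].
apply: (@ge0_FTC_exhausts R _ _ _ (fun s => K * s^-1) (fun s => K * ln s) +oo%E
  (exhausts_margin h0)).
- move=> s; rewrite /= in_itv/= => /andP[s0 _].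
  have h1 := is_deriveZ K (is_derive1_ln s0).
  exact: (@is_derive_eq _ _ _ _ _ _ _ _ h1).
- move=> s; rewrite /= in_itv/= => /andP[s0 _]; apply: cvgMl_tmp.
  by apply: inv_continuous; rewrite gt_eqF.
- move=> s; rewrite /= in_itv/= => /andP[s0 _].
  by rewrite mulr_ge0 ?invr_ge0 ?(ltW K0) ?(ltW s0).
have E n : K * ln (h - margin h n) - K * ln (margin h n) = K * ln n.+1%:R.
  have e0 := margin_gt0 n h0.
  have d0 : 0 < h - margin h n by have := margin_le n h0; move: (margin h n) => e; lra.
  rewrite -mulrBr -ln_div ?posrE//; congr (K * ln _).
  by rewrite /margin; field; rewrite !gt_eqF// -natr1; lra.
under eq_fun do rewrite E.
apply/cvgeryP/cvgryPge => A; near=> n.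
rewrite -ler_pdivrMl// -(expRK (K^-1 * A)) ler_ln ?posrE ?expR_gt0//.
rewrite ltW//; near: n.
have [N _ NP] := nbhs_infty_gtr (expR (K^-1 * A)).
exists N => // n /= Nn; apply: (lt_trans (NP N (leqnn N))).
by rewrite ltr_nat ltnS.
Unshelve. all: by end_near. Qed.

(** A nonnegative function with zero integral vanishes almost everywhere. *)
Lemma Rintegral_gt0 (D : set (measurableTypeR R)) (f : R -> R) : measurable D ->
  (0 < leb D)%E -> leb.-integrable D (EFin \o f) -> (forall x, D x -> 0 < f x) ->
  0 < \int[leb]_(x in D) f x.
Proof.
move=> mD D0 fi f0; rewrite lt_neqAle Rintegral_ge0 ?andbT; last first.
  by move=> x Dx; exact: ltW (f0 x Dx).
apply/eqP => I0; have mf := measurable_int _ fi.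
have := (ae_eq_integral_abs leb mD mf).1 _.
have -> : (\int[leb]_(x in D) `|(EFin \o f) x| = 0)%E.
  transitivity (\int[leb]_(x in D) (f x)%:E)%E.
    by apply: eq_integral => x; rewrite inE => Dx; rewrite /= gtr0_norm ?f0.
  by rewrite -[LHS]fineK ?integrable_fin_num// -[fine _]/(\int[leb]_(x in D) f x) -I0.
move=> /(_ erefl) [N [mN N0 NP]].
have DN : D `<=` N.
  move=> x Dx; apply: NP => /= h; have fx0 : f x = 0 := EFin_inj (h Dx).
  by have := f0 x Dx; rewrite fx0 ltxx.
have : (leb D <= leb N)%E by apply: le_measure; rewrite ?inE.
by rewrite N0 leNgt D0.
Qed.

Let integrableZ (D : set (measurableTypeR R)) (f : R -> R) k : measurable D ->
  leb.-integrable D (EFin \o f) -> leb.-integrable D (EFin \o (fun s => k * f s)).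
Proof.
by move=> mD fi; have := @integrableZl _ (measurableTypeR R) R leb D mD k _ fi; apply: eq_integrable.
Qed.

Definition beta_integral rho a b := \int[leb]_(s in `]0, rho[) beta_weight rho a b s.

Lemma beta_integral_gt0 rho a b : 0 < rho -> -1 < a -> -1 < b ->
  0 < beta_integral rho a b.
Proof.
move=> r0 a1 b1; apply: Rintegral_gt0.
- exact: measurable_itv.
- by rewrite leb_itv/= lte_fin r0 -EFinB subr0 lte_fin.
- exact: beta_weight_integrable.
- move=> s; rewrite /= in_itv/= => /andP[s0 sr].
  by rewrite mulr_gt0// powR_gt0// subr_gt0.
Qed.

(** The primitive [s^(b + 1) (rho - s)^(a + 1)] vanishes at both ends. *)
Lemma beta_integralS rho a b : 0 < rho -> -1 < a -> -1 < b ->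
  (a + b + 2) * beta_integral rho a (b + 1) = (b + 1) * rho * beta_integral rho a b.
Proof.
move=> r0 a1 b1; have b2 : -1 < b + 1 by lra.
have i1 := beta_weight_integrable r0 a1 b1; have i2 := beta_weight_integrable r0 a1 b2.
pose f s := (b + 1) * rho * beta_weight rho a b s - (a + b + 2) * beta_weight rho a (b + 1) s.
have i1' : leb.-integrable `]0, rho[ (EFin \o (fun s => (b + 1) * rho * beta_weight rho a b s)).
  by apply: integrableZ; first exact: measurable_itv.
have i2' : leb.-integrable `]0, rho[ (EFin \o (fun s => (a + b + 2) * beta_weight rho a (b + 1) s)).
  by apply: integrableZ; first exact: measurable_itv.
have : \int[leb]_(s in `]0, rho[) f s = 0.
  apply: (@FTC_exhausts R _ _ _ f (fun s => s `^ (b + 1) * (rho - s) `^ (a + 1)) 0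
    (exhausts_margin r0)).
  - move=> s; rewrite /= in_itv/= => /andP[s0 sr].
    have h1 : is_derive s 1 (@powR R ^~ (b + 1)) ((b + 1) * s `^ (b + 1 - 1)).
      exact: is_derive1_powR.
    have h2 := @is_derive_powR_subl (a + 1) rho s sr.
    have h3 := is_deriveM h1 h2.
    apply: (@is_derive_eq _ _ _ _ _ _ _ _ h3).
    rewrite /GRing.scale/= !addrK /f /beta_weight.
    have -> : s `^ (b + 1) = s * s `^ b.
      exact: powRS.
    have -> : (rho - s) `^ (a + 1) = (rho - s) * (rho - s) `^ a.
      by rewrite powRS// subr_gt0.
    by ring.
  - move=> s; rewrite /= in_itv/= => /andP[s0 sr].
    by apply: cvgB; apply: cvgMl_tmp; exact: beta_weight_continuous.
  - by have := @integrableB _ (measurableTypeR R) R leb _ (measurable_itv _) _ _ i1' i2'; apply: eq_integrable.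
  have e1 : (margin rho n) `^ (b + 1) @[n --> \oo] --> 0.
    apply: cvg_powR0; [lra|by move=> n; exact: margin_gt0|exact: cvg_margin].
  have e2 : (margin rho n) `^ (a + 1) @[n --> \oo] --> 0.
    apply: cvg_powR0; [lra|by move=> n; exact: margin_gt0|exact: cvg_margin].
  have e3 c : (rho - margin rho n) `^ c @[n --> \oo] --> rho `^ c.
    have h := @powR_subl_continuous c rho 0 r0; rewrite subr0 in h.
    exact: (cvg_comp _ _ (@cvg_margin rho) h).
  under eq_fun do rewrite subKr.
  have h1 : (rho - margin rho n) `^ (b + 1) * (margin rho n) `^ (a + 1) @[n --> \oo] -->
      rho `^ (b + 1) * 0 by apply: cvgM.
  have h2 : (margin rho n) `^ (b + 1) * (rho - margin rho n) `^ (a + 1) @[n --> \oo] -->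
      0 * rho `^ (a + 1) by apply: cvgM.
  rewrite mulr0 in h1; rewrite mul0r in h2.
  by rewrite -(subrr (0 : R)); exact: (cvgB h1 h2).
have mI : measurable (`]0, rho[ : set (measurableTypeR R)) by exact: measurable_itv.
rewrite (RintegralB mI i1' i2') (RintegralZl _ mI i1) (RintegralZl _ mI i2) => /eqP.
by rewrite subr_eq0 => /eqP ->.
Qed.

(** The substitution [t = 1 - s / rho] on the exhausting segments; it also
    exchanges the two exponents. *)
Lemma beta_integral_Beta rho a b : 0 < rho -> -1 < a -> -1 < b ->
  beta_integral rho a b = rho `^ (a + b + 1) * Beta (a + 1) (b + 1).
Proof.
move=> r0 a1 b1; pose F s := 1 - s / rho.
have i1 := beta_weight_integrable r0 a1 b1.
have i2 := beta_weight_integrable (@ltr01 R) b1 a1.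
have F' : derive1 F = cst (- rho^-1).
  apply/funext => s; rewrite derive1E.
  have h1 := is_deriveB (is_derive_cst (1 : R) s 1) (is_deriveZ rho^-1 (is_derive_id s 1)).
  have -> : F = cst 1 - rho^-1 \*: id by apply/funext => t; rewrite /F mulrC.
  by rewrite (@derive_val _ _ _ _ _ _ _ h1) sub0r /GRing.scale/= mulr1.
have E n : (\int[leb]_(t in `[margin 1 n, (1 - margin 1 n)%R]) (beta_weight 1 b a t)%:E =
    (rho `^ (a + b + 1))^-1%:E *
    \int[leb]_(s in `[margin rho n, (rho - margin rho n)%R]) (beta_weight rho a b s)%:E)%E.
  have e1 : margin 1 n = F (rho - margin rho n).
    by rewrite /F /margin; field; rewrite !gt_eqF// -natr1; lra.
  have e2 : 1 - margin 1 n = F (margin rho n).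
    by rewrite /F /margin; field; rewrite !gt_eqF// -natr1; lra.
  have eo := margin_gt0 n r0; have le2 := margin_le n r0.
  have cF s : F @ s --> F s.
    apply: cvgB; first exact: cvg_cst.
    by apply: cvgMr_tmp; exact: cvg_id.
  rewrite e2 e1 (@integration_by_substitution_decreasing R F (beta_weight 1 b a)).
  - rewrite -ge0_integralZl_EFin//.
    + apply: eq_integral => s; rewrite inE/= in_itv/= => /andP[h1 h2].
      rewrite F' -EFinM; congr EFin; rewrite !fctE/= opprK /F /beta_weight subKr.
      have s0 : 0 < s by apply: lt_le_trans h1.
      have sr : s < rho by apply: le_lt_trans h2 _; rewrite ltrBlDr ltrDl.
      have -> : 1 - s / rho = (rho - s) / rho by field; rewrite gt_eqF.
      rewrite !powRM ?invr_ge0 ?subr_ge0 ?ltW// powRS// powRD; last first.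
        by rewrite (@gt_eqF _ _ rho)// implybT.
      rewrite !(powRV _ r0).
      move: (s `^ b) ((rho - s) `^ a) (powR_gt0 a r0) (powR_gt0 b r0) => X Y.
      by move: (rho `^ a) (rho `^ b) => Z W Z0 W0; field; rewrite !gt_eqF.
    + by move=> s _; rewrite lee_fin beta_weight_ge0.
    + apply/measurable_EFinP; apply: (exhausts_segment_measurable (exhausts_margin r0)) => s.
      by rewrite /= in_itv/= => /andP[]; exact: beta_weight_continuous.
    + by rewrite invr_ge0 powR_ge0.
  - by move: (margin rho n) eo le2 => e; lra.
  - by move=> x y _ _ xy; rewrite ltrD2l ltrN2 ltr_pM2r ?invr_gt0.
  - by move=> s _; rewrite F'; exact: cvg_cst.
  - by rewrite F'; exact: is_cvg_cst.
  - by rewrite F'; exact: is_cvg_cst.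
  - split.
    + move=> s _; rewrite /F; apply: derivableB; first exact: derivable_cst.
      by apply: derivableM; [exact: derivable_id|exact: derivable_cst].
    + by apply: cvg_at_right_filter; exact: cF.
    + by apply: cvg_at_left_filter; exact: cF.
  - rewrite -e1 -e2; apply/subspace_continuousP => x; rewrite /= in_itv/= => /andP[h1 h2].
    apply: cvg_within_filter; apply: beta_weight_continuous.
      by apply: lt_le_trans h1; exact: margin_gt0.
    by apply: le_lt_trans h2 _; rewrite ltrBlDr ltrDl margin_gt0.
have c1 := cvg_integral_exhausts (exhausts_margin (@ltr01 R)) i2.
have c2 := cvg_integral_exhausts (exhausts_margin r0) i1.
have kf : ((rho `^ (a + b + 1))^-1%:E \is a fin_num)%E by [].
have c3 := cvgeZl kf c2; rewrite (funext E) in c1.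
have e0 : (\int[leb]_(t in `]0%R, 1%R[) (beta_weight 1 b a t)%:E =
    (rho `^ (a + b + 1))^-1%:E * \int[leb]_(s in `]0%R, rho[) (beta_weight rho a b s)%:E)%E.
  exact: (cvg_unique (@ereal_hausdorff R) c1 c3).
have f1 := integrable_fin_num (measurable_itv _ : measurable (`]0, rho[ : set (measurableTypeR R))) i1.
have {}e0 := congr1 (@fine R) e0.
rewrite (fineM kf f1) in e0.
rewrite /beta_integral /Beta !addrK.
have -> : \int[lebesgue_measure]_(t in `]0, 1[) (t `^ a * (1 - t) `^ b) =
    (rho `^ (a + b + 1))^-1 * \int[leb]_(s in `]0, rho[) beta_weight rho a b s.
  exact: e0.
by rewrite mulVKf// gt_eqF// powR_gt0.
Qed.

Let exhausts_pos : exhausts (fun n => n.+2%:R^-1 : R) (fun n => n.+1%:R) `]0, +oo[.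
Proof.
have i0 n : 0 < n.+2%:R^-1 :> R by rewrite invr_gt0.
have iS n : n.+3%:R^-1 <= n.+2%:R^-1 :> R by rewrite lef_pV2 ?posrE// ler_nat.
apply: exhausts_intro => //.
- move=> n; apply: (@le_trans _ _ 1); last by rewrite ler1n.
  by rewrite invf_le1// ler1n.
- by move=> n; rewrite ler_nat.
- by move=> n x h1 h2; rewrite /= in_itv/= andbT (lt_le_trans _ h1).
- move=> x; rewrite /= in_itv/= andbT => x0.
  have h := cvg_margin 1; have k1 : \forall n \near \oo, margin 1 n < x by apply: (cvgr_lt _ h).
  near=> n; split.
    by have : margin 1 n < x by [near: n]; rewrite /margin mul1r => /ltW.
  near: n; have [N _ NP] := nbhs_infty_gtr x; exists N => // n /= Nn.
  by apply: ltW; apply: (lt_trans (NP N (leqnn N))); rewrite ltr_nat ltnS.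
Unshelve. all: by end_near. Qed.

Definition gamma_weight x t := t `^ (x - 1) * expR (- t).

Let gamma_weight_continuous x t : 0 < t ->
  gamma_weight x s @[s --> t] --> gamma_weight x t.
Proof.
move=> t0; apply: cvgM; first exact: powR_continuous_gt0.
have c : - s @[s --> t] --> - t by apply: cvgN; exact: cvg_id.
exact: (cvg_comp _ _ c (@continuous_expR R (- t))).
Qed.

(** From the tangent of the logarithm at [y], [ln x <= x / y - 1 + ln y], for
    [x = 1 + t]. *)
Let powR_le_expR y t : 0 < y -> 0 <= t ->
  (1 + t) `^ y <= expR (1 - y + y * ln y) * expR t.
Proof.
move=> y0 t0; have t1 : 0 < 1 + t by lra.
rewrite /powR gt_eqF// -expRD ler_expR.
have h : ln ((1 + t) / y) <= (1 + t) / y - 1.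
  have {1}-> : (1 + t) / y = 1 + ((1 + t) / y - 1) by ring.
  apply: le_ln1Dx.
  by have := divr_gt0 t1 y0; lra.
move: h; rewrite ln_div ?posrE// => h.
have {}h := ler_wpM2l (ltW y0) h.
have e : y * ((1 + t) / y - 1) = 1 + t - y by field; rewrite gt_eqF.
by rewrite e mulrBr in h; lra.
Qed.

(** The function [t^x (1 + t)^(- x)] increases from 0 to 1, so that its
    derivative is an integrable majorant, up to a constant factor. *)
Lemma gamma_weight_integrable x : 0 < x ->
  leb.-integrable `]0, +oo[ (EFin \o gamma_weight x).
Proof.
move=> x0; pose g t := x * t `^ (x - 1) * (1 + t) `^ (- (x + 1)).
have h1t t b : 0 < t -> is_derive t 1 (fun t => (1 + t) `^ b) (b * (1 + t) `^ (b - 1)).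
  move=> t0; rewrite -[X in is_derive _ _ _ X]mulr1.
  have d1 : is_derive t 1 (fun s : R => 1 + s) 1.
    have h := is_deriveD (is_derive_cst (1 : R) t 1) (is_derive_id t 1).
    by apply: (@is_derive_eq _ _ _ _ _ _ _ _ h); rewrite add0r.
  have d2 : is_derive (1 + t) 1 (@powR R ^~ b) (b * (1 + t) `^ (b - 1)).
    by apply: is_derive1_powR; lra.
  exact: (@is_derive1_comp R (@powR R ^~ b) (fun s : R => 1 + s)).
have c1t t b : 0 < t -> (1 + s) `^ b @[s --> t] --> (1 + t) `^ b.
  move=> t0; have c : 1 + s @[s --> t] --> 1 + t.
    by apply: cvgD; [exact: cvg_cst|exact: cvg_id].
  have p : 0 < 1 + t by lra.
  exact: (cvg_comp _ _ c (powR_continuous_gt0 (b := b) p)).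
have g0 t : 0 <= g t by rewrite !mulr_ge0 ?powR_ge0// ltW.
have cg t : `]0, +oo[%classic t -> g s @[s --> t] --> g t.
  rewrite /= in_itv/= andbT => t0; apply: cvgM; last exact: c1t.
  by apply: cvgMl_tmp; exact: powR_continuous_gt0.
have ig : leb.-integrable `]0, +oo[ (EFin \o g).
  apply/integrableP; split.
    by apply/measurable_EFinP; exact: (exhausts_measurable_fun exhausts_pos).
  under eq_integral do rewrite /= ger0_norm//.
  suff -> : (\int[leb]_(t in `]0%R, +oo[) (g t)%:E = 1%:E)%E by rewrite ltry.
  pose u (n : nat) := n.+2%:R^-1 / (1 + n.+2%:R^-1) : R.
  apply: (@ge0_FTC_exhausts R _ _ _ g (fun t => t `^ x * (1 + t) `^ (- x)) 1%:E exhausts_pos).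
  - move=> t; rewrite /= in_itv/= andbT => t0.
    have d1 : is_derive t 1 (@powR R ^~ x) (x * t `^ (x - 1)) by exact: is_derive1_powR.
    have d := is_deriveM d1 (h1t t (- x) t0).
    apply: (@is_derive_eq _ _ _ _ _ _ _ _ d).
    rewrite /GRing.scale/= /g -[- x](subrK 1) -[x in t `^ x](subrK 1).
    rewrite [t `^ (x - 1 + 1)]powRS// [(1 + t) `^ (- x - 1 + 1)]powRS; last lra.
    by rewrite addrK opprD; ring.
  - exact: cg.
  - by [].
  apply: cvg_EFin; first exact: nearW.
  have e1 : (margin 1 n.+1) `^ x @[n --> \oo] --> 0.
    apply: cvg_powR0 => //; first by move=> n; exact: margin_gt0.
    have h := cvg_margin 1; rewrite -(cvg_shiftS (margin 1)) in h; exact: h.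
  have e2 : (1 - margin 1 n) `^ x @[n --> \oo] --> 1 `^ x.
    have h := @powR_subl_continuous x 1 0 ltr01; rewrite subr0 in h.
    exact: (cvg_comp _ _ (@cvg_margin 1) h).
  have E n : fine (n.+1%:R `^ x * (1 + n.+1%:R) `^ (- x) -
      n.+2%:R^-1 `^ x * (1 + n.+2%:R^-1) `^ (- x))%:E = (1 - margin 1 n) `^ x - (margin 1 n.+1) `^ x.
    rewrite /= !powRN -!powRV// -?powRM// ?invr_ge0//.
    congr (_ `^ _ - _ `^ _); rewrite /margin mul1r.
      have -> : 1 + n.+1%:R = n.+2%:R :> R by rewrite nat1r.
      have -> : n.+1%:R = n.+2%:R - 1 :> R by rewrite -[n.+2%:R]natr1 addrK.
      by rewrite mulrBl divff// mul1r.
    have -> : n.+3%:R = n.+2%:R + 1 :> R by rewrite natr1.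
    have p2 : 0 < n.+2%:R :> R by [].
    by move: (n.+2%:R : R) p2 => t t0; field; rewrite !gt_eqF//; lra.
  rewrite (_ : fine \o _ = (fun n => (1 - margin 1 n) `^ x - (margin 1 n.+1) `^ x)); last first.
    by apply/funext => n; exact: E.
  rewrite powR1 in e2; rewrite -[X in _ --> X](subr0 (1 : R)).
  exact: (cvgB e2 e1).
pose C := expR (1 - (x + 1) + (x + 1) * ln (x + 1)) / x.
have iC : leb.-integrable `]0, +oo[ (EFin \o (fun s => C * g s)).
  by apply: integrableZ; first exact: measurable_itv.
apply: le_integrable iC => //.
  apply/measurable_EFinP; apply: (exhausts_measurable_fun exhausts_pos) => t.
  by rewrite /= in_itv/= andbT; exact: gamma_weight_continuous.
move=> t; rewrite /= in_itv/= andbT => t0; rewrite lee_fin.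
rewrite ger0_norm ?mulr_ge0 ?powR_ge0 ?expR_ge0// ger0_norm; last first.
  by rewrite mulr_ge0// divr_ge0 ?expR_ge0// ltW.
have -> : C * g t = t `^ (x - 1) *
    (expR (1 - (x + 1) + (x + 1) * ln (x + 1)) * (1 + t) `^ (- (x + 1))).
  by rewrite /C /g; field; rewrite gt_eqF.
rewrite ler_wpM2l ?powR_ge0// expRN powRN.
rewrite ler_pdivlMr ?powR_gt0//; last lra.
rewrite ler_pdivrMl ?expR_gt0// mulrC.
by apply: powR_le_expR; lra.
Qed.

Lemma Gamma_gt0 x : 0 < x -> 0 < Gamma x.
Proof.
move=> x0; apply: Rintegral_gt0.
- exact: measurable_itv.
- by rewrite leb_itv/= ltry/= addye.
- exact: gamma_weight_integrable.
- by move=> t; rewrite /= in_itv/= andbT => t0; rewrite mulr_gt0 ?expR_gt0 ?powR_gt0.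
Qed.

(** The primitive [t^x exp(- t)] vanishes at 0 and at infinity. *)
Lemma GammaS x : 0 < x -> Gamma (x + 1) = x * Gamma x.
Proof.
move=> x0; have x1 : 0 < x + 1 by lra.
have i1 := gamma_weight_integrable x0; have i2 := gamma_weight_integrable x1.
have mI : measurable (`]0, +oo[ : set (measurableTypeR R)) by exact: measurable_itv.
have i1' := integrableZ x mI i1.
pose f t := x * gamma_weight x t - gamma_weight (x + 1) t.
have : \int[leb]_(t in `]0, +oo[) f t = 0.
  apply: (@FTC_exhausts R _ _ _ f (fun t => t `^ x * expR (- t)) 0 exhausts_pos).
  - move=> t; rewrite /= in_itv/= andbT => t0.
    have d1 : is_derive t 1 (@powR R ^~ x) (x * t `^ (x - 1)) by exact: is_derive1_powR.
    have d2 : is_derive t 1 (fun t : R => expR (- t)) (- expR (- t)).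
      have d3 := is_deriveN (is_derive_id t (1 : R)).
      have d := @is_derive1_comp R expR (-%R) t _ _ (is_derive_expR (- t)) d3.
      by apply: (@is_derive_eq _ _ _ _ _ _ _ _ d); rewrite mulrN1.
    have d := is_deriveM d1 d2.
    apply: (@is_derive_eq _ _ _ _ _ _ _ _ d).
    by rewrite /GRing.scale/= /f /gamma_weight addrK; ring.
  - move=> t; rewrite /= in_itv/= andbT => t0; apply: cvgB.
      by apply: cvgMl_tmp; exact: gamma_weight_continuous.
    exact: gamma_weight_continuous.
  - by have := @integrableB _ (measurableTypeR R) R leb _ mI _ _ i1' i2; apply: eq_integrable.
  have e1 : n.+2%:R^-1 `^ x * expR (- n.+2%:R^-1) @[n --> \oo] --> (0 : R).
    have h : (margin 1 n) `^ x @[n --> \oo] --> 0.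
      apply: cvg_powR0; [by []|by move=> n; exact: margin_gt0|exact: cvg_margin].
    apply: (@squeeze_cvgr _ _ _ _ (fun=> 0) (fun n => (margin 1 n) `^ x)).
    + apply: nearW => n; rewrite /margin mul1r mulr_ge0 ?powR_ge0 ?expR_ge0//=.
      rewrite ler_piMr ?powR_ge0// -expR0 ler_expR oppr_le0 invr_ge0//.
    + exact: cvg_cst.
    + exact: h.
  have e2 : n.+1%:R `^ x * expR (- n.+1%:R) @[n --> \oo] --> (0 : R).
    pose C := expR (1 - (x + 1) + (x + 1) * ln (x + 1)).
    have h : C * margin 1 n @[n --> \oo] --> 0.
      by rewrite -(mulr0 C); apply: cvgMl_tmp; exact: cvg_margin.
    apply: (@squeeze_cvgr _ _ _ _ (fun=> 0) (fun n => C * margin 1 n)).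
    + apply: nearW => n; rewrite mulr_ge0 ?powR_ge0 ?expR_ge0//=.
      have t0 : (0 : R) <= n.+1%:R by [].
      have t1 : 0 < 1 + n.+1%:R :> R by rewrite ltr_pwDl.
      have k := powR_le_expR x1 t0; rewrite powRS// in k.
      have k2 : n.+1%:R `^ x <= (1 + n.+1%:R) `^ x :> R.
        by apply: ge0_ler_powR; rewrite ?nnegrE ?(ltW x0) ?(ltW t1)// lerDr.
      have -> : margin 1 n = (1 + n.+1%:R)^-1 by rewrite /margin mul1r nat1r.
      rewrite expRN ler_pdivrMr ?expR_gt0//.
      move: (n.+1%:R : R) t0 t1 k k2 => t t0 t1 k k2.
      rewrite mulrAC ler_pdivlMr// mulrC; apply: le_trans k.
      by rewrite ler_pM2l.
    + exact: cvg_cst.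
    + exact: h.
  by rewrite -(subrr (0 : R)); exact: (cvgB e2 e1).
rewrite (RintegralB mI i1' i2) (RintegralZl _ mI i1) => /eqP.
by rewrite subr_eq0 => /eqP ->.
Qed.

End EulerIntegrals.

(** * Measurability on annuli *)
Section PlaneMeasurability.
Context {R : realType}.
Implicit Types (D : set (measurableTypeR R)) (z : CC R) (a b : int -> CC R).

Let plane := (measurableTypeR R * measurableTypeR R)%type.
Let leb2 : {measure set plane -> \bar R} :=
  (@lebesgue_measure R \x @lebesgue_measure R)%E.

(** A set of values of [|z|^2] rather than of [|z|], since the area is
    proportional to the length in this variable. *)
Definition annulus D : set plane := @qsq R @^-1` D.

Lemma measurable_annulus D : measurable D -> measurable (annulus D).
Proof. by move=> mD; rewrite -[annulus D]setTI; exact: measurable_qsq. Qed.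

Lemma qsqE (u : plane) : qsq u = modulus (of_plane u) ^+ 2.
Proof. by rewrite modulus_sqr. Qed.

Lemma annulus_pdisc r D (u : plane) : 0 < r -> D `<=` `]0, r ^+ 2[ -> annulus D u ->
  pdisc r (of_plane u).
Proof.
move=> r0 Dr Du; have := Dr _ Du; rewrite /= in_itv/= qsqE => /andP[h1 h2].
apply/pdiscP; split.
  by rewrite -modulus_eq0; apply: contraTneq h1 => ->; rewrite expr0n/= ltxx.
by move: h2; rewrite ltr_pXn2r ?nnegrE ?modulus_ge0 ?(ltW r0).
Qed.

Lemma Cmeasurable_of_plane (A : set plane) : Cmeasurable A (of_plane : plane -> CC R).
Proof.
split; first exact: (measurable_funS measurableT (@subsetT _ _) measurable_fst).
exact: (measurable_funS measurableT (@subsetT _ _) measurable_snd).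
Qed.

Lemma Cmeasurable_exprz d (T : measurableType d) (A : set T) (F : T -> CC R) (n : int) :
  measurable A -> Cmeasurable A F -> Cmeasurable A (fun x => F x ^ n).
Proof.
move=> mA mF; case: n => n; first exact: CmeasurableX.
by apply: CmeasurableV => //; exact: CmeasurableX.
Qed.

Lemma Cmeasurable_laurent_partial_sum d (T : measurableType d) (A : set T)
    (F : T -> CC R) a N : measurable A -> Cmeasurable A F ->
  Cmeasurable A (fun x => series (laurent_term a (F x)) N).
Proof.
move=> mA mF; elim: N => [|N ih].
  apply: (@eq_Cmeasurable _ _ _ _ (fun=> 0)); last exact: Cmeasurable_cst.
  by move=> x _; rewrite /series/= big_geq.
apply: (@eq_Cmeasurable _ _ _ _ (fun x => series (laurent_term a (F x)) N +
   laurent_term a (F x) N)); first by move=> x _; rewrite seriesSr.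
apply: CmeasurableD => //; apply: CmeasurableD;
  by apply: CmeasurableM; [exact: Cmeasurable_cst|exact: Cmeasurable_exprz].
Qed.

Lemma Cmeasurable_laurent_sum r a D : 0 < r -> growth r a -> measurable D ->
  D `<=` `]0, r ^+ 2[ ->
  Cmeasurable (annulus D) (fun u => laurent_sum a (of_plane u)).
Proof.
move=> r0 ga mD Dr; have mA := measurable_annulus mD.
apply: (@Cmeasurable_cvg _ _ _ _ (fun N u => series (laurent_term a (of_plane u)) N)) => //.
  by move=> N; apply: Cmeasurable_laurent_partial_sum => //; exact: Cmeasurable_of_plane.
move=> u Du; have /pdiscP[z0 zr] := annulus_pdisc r0 Dr Du.
by have [_ _] := growth_cvg ga z0 zr.
Qed.

Lemma of_plane_rotation (c s : R) (u : plane) :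
  of_plane (rotation c s u) = Complex c s * of_plane u.
Proof. by apply: complex_ext; rewrite ?ReM ?ImM/=; ring. Qed.

Lemma qsq_rotation (c s : R) (u : plane) : c ^+ 2 + s ^+ 2 = 1 ->
  qsq (rotation c s u) = qsq u.
Proof.
move=> cs; rewrite !qsqE of_plane_rotation modulusM exprMn.
by rewrite (modulus_sqr (Complex c s))/= cs mul1r.
Qed.

Lemma Cintegral_rotation (c s : R) D (F : plane -> CC R) :
  c ^+ 2 + s ^+ 2 = 1 -> s != 0 -> measurable D -> Cmeasurable (annulus D) F ->
  Cintegral leb2 (annulus D) (fun u => F (rotation c s u)) = Cintegral leb2 (annulus D) F.
Proof.
move=> cs s0 mD [m1 m2]; have mA := measurable_annulus mD.
have key (f : plane -> R) : measurable_fun (annulus D) f ->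
    \int[leb2]_(u in annulus D) f (rotation c s u) = \int[leb2]_(u in annulus D) f u.
  move=> mf; rewrite Rintegral_mkcond [RHS]Rintegral_mkcond.
  have mg : measurable_fun setT (EFin \o (f \_ (annulus D))).
    by apply/measurable_EFinP; apply/(measurable_restrictT _ mA).
  have h := integral_rotation cs s0 mg.
  rewrite /Rintegral -h; congr fine; apply: eq_integral => u _ /=; congr EFin.
  rewrite !patchE; have -> : (rotation c s u \in annulus D) = (u \in annulus D).
    by apply/idP/idP; rewrite !inE /annulus/= qsq_rotation.
  by [].
by congr Complex; [exact: (key _ m1)|exact: (key _ m2)].
Qed.

End PlaneMeasurability.

(** * Laurent series against a radial weight *)
Section RadialWeight.
Context {R : realType}.
Implicit Types (D : set (measurableTypeR R)) (z : CC R) (a b : int -> CC R).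

Let leb : {measure set (measurableTypeR R) -> \bar R} := @lebesgue_measure R.
Let plane := (measurableTypeR R * measurableTypeR R)%type.
Let leb2 : {measure set plane -> \bar R} :=
  (@lebesgue_measure R \x @lebesgue_measure R)%E.

Context (r : R) (om : R -> R) (r_gt0 : 0 < r).
Context (om_gt0 : forall s, 0 < s -> s < r ^+ 2 -> 0 < om s).
Context (om_int : leb.-integrable `]0, r ^+ 2[ (EFin \o om)).

Let I : set (measurableTypeR R) := `]0, r ^+ 2[.

Definition wint D (F : CC R -> CC R) : CC R :=
  Cintegral leb2 (annulus D) (fun u => F (of_plane u) * rtoc (om (qsq u))).

Definition wintegrable D (F : CC R -> CC R) :=
  Cintegrable leb2 (annulus D) (fun u => F (of_plane u) * rtoc (om (qsq u))).

Definition moment D (n : int) : R := pi * \int[leb]_(s in D) (s ^ n * om s).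

Let sub_pos D : D `<=` I -> D `<=` [set` `]0%R, +oo[].
Proof. by move=> DI s /DI; rewrite /= !in_itv/= andbT => /andP[]. Qed.

Let om_ge0 D s : D `<=` I -> D s -> 0 <= om s.
Proof. move=> DI Ds; have := DI _ Ds; rewrite /I /= in_itv/= => /andP[h1 h2].
exact/ltW/om_gt0. Qed.

Let measurable_om D : D `<=` I -> measurable_fun D om.
Proof.
move=> DI; apply: (measurable_funS _ DI); first exact: measurable_itv.
by apply/measurable_EFinP; exact: measurable_int om_int.
Qed.

Let measurable_qsq_comp D (f : R -> R) : measurable D -> measurable_fun D f ->
  measurable_fun (annulus D) (fun u => f (qsq u)).
Proof.
move=> mD mf; apply: (measurable_comp mD _ mf).
  by move=> _ [u Du <-].
exact: (measurable_funS measurableT (@subsetT _ _) (@measurable_qsq R)).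
Qed.

Lemma Cmeasurable_weight D : measurable D -> D `<=` I ->
  Cmeasurable (annulus D) (fun u => rtoc (om (qsq u))).
Proof.
by move=> mD DI; apply: Cmeasurable_rtoc; apply: measurable_qsq_comp => //; exact: measurable_om.
Qed.

Lemma integrable_radial D (f : R -> R) : measurable D -> D `<=` I ->
  leb.-integrable D (EFin \o f) -> 
  leb2.-integrable (annulus D) (EFin \o (fun u => f (qsq u))).
Proof.
move=> mD DI fi; have mf : measurable_fun D f by apply/measurable_EFinP; exact: measurable_int fi.
apply/integrableP; split; first by apply/measurable_EFinP; exact: measurable_qsq_comp.
have := @ge0_integral_radial R D (fun s => `|(f s)%:E|%E) mD (sub_pos DI) _ _.
rewrite -/leb2 => -> //; last by apply/measurable_EFinP; exact: measurableT_comp.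
by rewrite lte_mul_pinfty ?lee_fin ?pi_ge0//; have /integrableP[] := fi.
Qed.

Lemma Rintegral_radial D (f : R -> R) : measurable D -> D `<=` I ->
  measurable_fun D f -> (forall s, D s -> 0 <= f s) ->
  \int[leb2]_(u in annulus D) f (qsq u) = pi * \int[leb]_(s in D) f s.
Proof.
move=> mD DI mf f0; rewrite /Rintegral.
have := @ge0_integral_radial R D (EFin \o f) mD (sub_pos DI) _ _.
rewrite -/leb2 => ->; [|exact/measurable_EFinP|by move=> s Ds; rewrite lee_fin f0].
have h0 : (0 <= \int[leb]_(x in D) (EFin \o f) x)%E.
  by apply: integral_ge0 => s Ds; rewrite lee_fin f0.
case: (\int[leb]_(x in D) (EFin \o f) x)%E h0 => [x||]//= _.
by rewrite mulry gtr0_sg ?pi_gt0// mul1e mulr0.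
Qed.

Lemma wintegrable_bounded D (F : CC R -> CC R) (M : R) : measurable D -> D `<=` I ->
  Cmeasurable (annulus D) (fun u => F (of_plane u)) ->
  (forall z, D (modulus z ^+ 2) -> modulus (F z) <= M) -> wintegrable D F.
Proof.
move=> mD DI mF FM; have mA := measurable_annulus mD.
apply: (@le_Cintegrable _ _ _ _ _ _ (fun u => M * om (qsq u))) => //.
- by apply: CmeasurableM => //; exact: Cmeasurable_weight.
- apply: (@integrable_radial D (fun s => M * om s)) => //.
  have omD : leb.-integrable D (EFin \o om).
    by apply: (integrableS _ mD DI om_int); exact: measurable_itv.
  by have := @integrableZl _ (measurableTypeR R) R leb D mD M _ omD; apply: eq_integrable.
move=> u Du; rewrite modulusM modulus_rtoc ger0_norm ?(om_ge0 DI)//.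
by rewrite ler_wpM2r ?(om_ge0 DI)//; apply: FM; rewrite -qsqE.
Qed.

Lemma bounded_exprz (x y : R) (n : int) : 0 < x ->
  exists M : R, forall t, x <= t -> t <= y -> t ^ n <= M.
Proof.
move=> x0; case: n => k; first by exists (y ^ k%:Z) => t xt ty; apply: exprz_Posz_le => //; lra.
by exists (x ^ Negz k) => t xt ty; exact: exprz_Negz_le.
Qed.

Let modulus_itv x y z : 0 < x -> `[x, y]%classic (modulus z ^+ 2) ->
  Num.sqrt x <= modulus z /\ modulus z <= Num.sqrt y.
Proof.
move=> x0; rewrite /= in_itv/= => /andP[h1 h2].
by rewrite -(ger0_norm (modulus_ge0 z)) -sqrtr_sqr !ler_sqrt// ltW// (lt_le_trans x0)// (le_trans h1).
Qed.

Let segment_sub x y : 0 < x -> y < r ^+ 2 -> `[x, y]%classic `<=` I.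
Proof.
move=> x0 yr s; rewrite /I /= !in_itv/= => /andP[h1 h2].
by rewrite (lt_le_trans x0 h1) (le_lt_trans h2 yr).
Qed.

Lemma wintegrable_exprz_conj x y (l n : int) : 0 < x -> y < r ^+ 2 ->
  wintegrable `[x, y] (fun z => z ^ l * conj (z ^ n)).
Proof.
move=> x0 yr; have sx : 0 < Num.sqrt x by rewrite sqrtr_gt0.
have [M1 h1] := bounded_exprz (Num.sqrt y) l sx.
have [M2 h2] := bounded_exprz (Num.sqrt y) n sx.
have mI : measurable (`[x, y]%classic : set (measurableTypeR R)) by exact: measurable_itv.
have mA := measurable_annulus mI.
apply: (wintegrable_bounded (M := M1 * M2) mI (segment_sub x0 yr)).
  apply: CmeasurableM; last apply: Cmeasurable_conj;
  by apply: Cmeasurable_exprz => //; exact: Cmeasurable_of_plane.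
move=> z /(modulus_itv x0) [k1 k2]; rewrite modulusM modulus_conj !modulusXz.
by apply: ler_pM; rewrite ?exprz_ge0 ?modulus_ge0 ?h1 ?h2.
Qed.

Let conj_exprz (z : CC R) (n : int) : modulus z = 1 -> conj (z ^ n) = z ^ (- n).
Proof.
move=> m1; have z0 : z != 0 by rewrite -modulus_eq0 m1 oner_eq0.
have zn : z ^ n != 0 by rewrite expfz_neq0.
apply: (mulfI zn); rewrite mul_conj modulusXz m1 exp1rz expr1n rmorph1.
by rewrite -expfzDr// subrr expr0z.
Qed.

Let cisX (t : R) (k : nat) : cis t ^+ k = cis (t *+ k).
Proof.
elim: k => [|k ih]; first by rewrite expr0 mulr0n /cis cos0 sin0.
by rewrite exprS ih mulrS cisD.
Qed.

(** The angle [pi / (2 |d|)], whose [|d|]-th multiple is a right angle. *)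
Let exists_rotation (d : int) : d != 0 -> exists t : R, sin t != 0 /\ cis t ^ d != 1.
Proof.
move=> d0; pose k := absz d; have k0 : (0 < k)%N by rewrite absz_gt0.
have kR : 0 < k%:R :> R by rewrite ltr0n.
have p0 : 0 < pi :> R by exact: pi_gt0.
exists (pi / 2 / k%:R); split.
  rewrite gt_eqF//; apply: sin_gt0_pi; apply/andP; split; first by rewrite !divr_gt0.
  rewrite ltr_pdivrMr//; apply: (@lt_le_trans _ _ pi); first lra.
  by rewrite ler_peMr ?pi_ge0// ler1n.
have e : cis (pi / 2 / k%:R) ^+ k != 1 :> CC R.
  have -> : cis (pi / 2 / k%:R) ^+ k = cis (pi / 2) :> CC R.
    by rewrite cisX -[_ *+ k]mulr_natr divfK ?gt_eqF.
  apply/eqP => /(congr1 (@complex.Re R)) /=.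
  by rewrite cos_pihalf => /eqP; rewrite eq_sym oner_eq0.
move: e; rewrite /k; case: (d) => j //=.
by rewrite NegzE -exprnN invr_eq1.
Qed.

(** Invariance under a rotation by an angle [t] multiplies the integral by
    [e^{i (l - n) t}], which forces it to vanish. *)
Lemma wint_orthogonal D (l n : int) : measurable D -> D `<=` I -> l != n ->
  wintegrable D (fun z => z ^ l * conj (z ^ n)) ->
  wint D (fun z => z ^ l * conj (z ^ n)) = 0.
Proof.
move=> mD DI ln iF; have mA := measurable_annulus mD.
have [t [st ct]] : exists t : R, sin t != 0 /\ cis t ^ (l - n) != 1.
  by apply: exists_rotation; rewrite subr_eq0.
have := Cintegral_rotation (cos2Dsin2 t) st mD (Cintegrable_measurable iF).
have z1 : cis t != 0 by rewrite -modulus_eq0 modulus_cis oner_eq0.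
rewrite (@eq_Cintegral _ _ _ _ _ _ (fun u : plane => cis t ^ (l - n) *
   (of_plane u ^ l * conj (of_plane u ^ n) * rtoc (om (qsq u))))); last first.
  move=> u _; rewrite of_plane_rotation qsq_rotation ?cos2Dsin2// -/(cis t).
  have cc := conj_exprz n (modulus_cis t).
  move: (cis t) z1 cc (of_plane u) (rtoc _) => zeta z1 cc z om'.
  rewrite (expfzMl zeta z l) (expfzMl zeta z n) rmorphM/= cc expfzDr//.
  by move: (zeta ^ l) (zeta ^ (- n)) (z ^ l) (conj (z ^ n)) => p q s t'; clear; ring.
rewrite CintegralZ// -/(wint D _); set X := wint D _ => h.
have /eqP : (cis t ^ (l - n) - 1) * X = 0 by rewrite mulrBl mul1r h subrr.
by rewrite mulf_eq0 subr_eq0 (negbTE ct)/= => /eqP.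
Qed.

Lemma measurable_exprz_weight D (n : int) : measurable D -> D `<=` I ->
  measurable_fun D (fun s => s ^ n * om s).
Proof.
move=> mD DI; apply: measurable_funM; last exact: measurable_om.
apply: (@eq_measurable_fun _ _ _ _ _ (fun s => s `^ n%:~R)); last first.
  by apply: (measurable_funS measurableT (@subsetT _ _)); exact: measurable_powR.
move=> s; rewrite inE => Ds; rewrite powR_intmul//.
by have := DI _ Ds; rewrite /I /= in_itv/= => /andP[/ltW].
Qed.

Lemma wint_diagonal D (n : int) : measurable D -> D `<=` I ->
  wint D (fun z => z ^ n * conj (z ^ n)) = rtoc (moment D n).
Proof.
move=> mD DI; rewrite /wint /moment.
have mf := measurable_exprz_weight n mD DI.
rewrite -Rintegral_radial//; last first.
  move=> s Ds; rewrite mulr_ge0 ?(om_ge0 DI)// exprz_ge0//.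
  by have := DI _ Ds; rewrite /I /= in_itv/= => /andP[/ltW].
rewrite (@eq_Cintegral _ _ _ _ _ _ (fun u => rtoc (qsq u ^ n * om (qsq u)))).
  apply: complex_ext => //=; rewrite /Rintegral; under eq_integral do rewrite /=.
  by rewrite integral0.
move=> u _; rewrite mul_conj rmorphM/= modulusXz qsqE.
set M := modulus _; have -> : (M ^+ 2) ^ n = M ^ n * M ^ n by rewrite expr2 expfzMl.
by rewrite !rmorphM.
Qed.

(** On a closed annulus the partial sums are uniformly bounded, so that the
    integral is computed term by term; orthogonality leaves a single degree. *)
Lemma wint_laurent_sum b (n : int) x y : growth r b -> 0 < x -> x <= y -> y < r ^+ 2 ->
  wintegrable `[x, y] (fun z => laurent_sum b z * conj (z ^ n)) /\
  wint `[x, y] (fun z => laurent_sum b z * conj (z ^ n)) = b n * rtoc (moment `[x, y] n).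
Proof.
move=> gb x0 xy yr; have mI : measurable (`[x, y]%classic : set (measurableTypeR R)) by exact: measurable_itv.
have mA := measurable_annulus mI; have sI := segment_sub x0 yr.
have sx : 0 < Num.sqrt x by rewrite sqrtr_gt0.
have syr : Num.sqrt y < r by rewrite -(ger0_norm (ltW r_gt0)) -sqrtr_sqr ltr_sqrt// exprn_gt0.
have [C [q [C0 q0 q1 Cq]]] : exists C q : R, [/\ 0 <= C, 0 <= q, q < 1 &
    forall k x', Num.sqrt x <= x' -> x' <= Num.sqrt y ->
      modulus (b k%:Z) * x' ^ k%:Z <= C * q ^+ k /\
      modulus (b (Negz k)) * x' ^ Negz k <= C * q ^+ k].
  by apply: growth_bound gb sx _ syr; rewrite ler_wsqrtr.
have [M hM] := bounded_exprz (Num.sqrt y) n sx.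
pose E l := wint `[x, y] (fun z => z ^ l * conj (z ^ n)).
have EE l : E l = if l == n then rtoc (moment `[x, y] n) else 0.
  case: eqVneq => [->|ln]; first exact: wint_diagonal.
  by apply: wint_orthogonal => //; exact: wintegrable_exprz_conj.
(* The index of the term of the grouped series that contains the degree n. *)
pose j := if n is Negz k then k else absz n.
pose W (u : plane) := conj (of_plane u ^ n) * rtoc (om (qsq u)).
pose F_ N u := series (laurent_term b (of_plane u)) N * W u.
have [iF cvF] : Cintegrable leb2 (annulus `[x, y]) (fun u => laurent_sum b (of_plane u) * W u) /\
   Cintegral leb2 (annulus `[x, y]) (F_ N) @[N --> \oo] -->
   Cintegral leb2 (annulus `[x, y]) (fun u => laurent_sum b (of_plane u) * W u).
  apply: (@cvg_Cintegral _ _ _ _ _ _ _ (fun u => (C * 2 / (1 - q) * M) * om (qsq u))) => //.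
  - move=> N; apply: CmeasurableM; first apply: Cmeasurable_laurent_partial_sum => //.
      exact: Cmeasurable_of_plane.
    apply: CmeasurableM; last exact: Cmeasurable_weight.
    by apply: Cmeasurable_conj; apply: Cmeasurable_exprz => //; exact: Cmeasurable_of_plane.
  - have omD : leb.-integrable `[x, y] (EFin \o om).
      by apply: (integrableS _ mI sI om_int); exact: measurable_itv.
    apply: (@integrable_radial _ (fun s => (C * 2 / (1 - q) * M) * om s)) => //.
    by have := @integrableZl _ (measurableTypeR R) R leb _ mI (C * 2 / (1 - q) * M) _ omD; apply: eq_integrable.
  - move=> N u Du; have zI : `[x, y]%classic (modulus (of_plane u) ^+ 2) by rewrite -qsqE.
    have [k1 k2] := modulus_itv x0 zI.
    rewrite /F_ /W !modulusM modulus_rtoc ger0_norm; last exact: om_ge0 sI Du.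
    rewrite mulrA ler_wpM2r//; first exact: om_ge0 sI Du.
    rewrite modulus_conj modulusXz ler_pM ?modulus_ge0 ?exprz_ge0 ?modulus_ge0 ?hM//.
    rewrite /series/= (le_trans (le_modulus_sum _ _ _))// big_mkord.
    apply: (@le_trans _ _ (\sum_(i < N) (C * 2) * q ^+ i)).
      apply: ler_sum => i _; rewrite (le_trans (le_modulusD _ _))// !modulusM !modulusXz.
      have [a1 a2] := Cq i _ k1 k2; rewrite mulrAC mulr_natr mulr2n.
      by rewrite lerD.
    rewrite -mulr_sumr ler_wpM2l ?mulr_ge0//; exact: geometric_sum_le.
  - move=> u Du; apply: cvgMr_tmp; have /pdiscP[z0 zr] := annulus_pdisc r_gt0 sI Du.
    by have [_ _] := growth_cvg gb z0 zr.
have FE N : Cintegral leb2 (annulus `[x, y]) (F_ N) =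
    \sum_(k < N) (b k%:Z * E k%:Z + b (Negz k) * E (Negz k)).
  pose T k (u : plane) :=
    b k%:Z * (of_plane u ^ k%:Z * conj (of_plane u ^ n) * rtoc (om (qsq u))) +
    b (Negz k) * (of_plane u ^ Negz k * conj (of_plane u ^ n) * rtoc (om (qsq u))).
  have iE l : wintegrable `[x, y] (fun z => z ^ l * conj (z ^ n)).
    exact: wintegrable_exprz_conj.
  have iT k : Cintegrable leb2 (annulus `[x, y]) (T k).
    by apply: CintegrableD => //; apply: CintegrableZ => //; exact: iE.
  have [_ sT] := Cintegral_sum (index_enum 'I_N) mA (fun k : 'I_N => iT k).
  rewrite (@eq_Cintegral _ _ _ _ _ _ (fun u => \sum_(k < N) T k u)); last first.
    move=> u _; rewrite /F_ /series/= big_mkord mulr_suml; apply: eq_bigr => k _.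
    by rewrite /laurent_term /T /W; ring.
  rewrite sT; apply: eq_bigr => k _.
  rewrite CintegralD//; [|exact: (CintegrableZ _ mA (iE _))|exact: (CintegrableZ _ mA (iE _))].
  by congr (_ + _); exact: (CintegralZ _ mA (iE _)).
have lim2 : Cintegral leb2 (annulus `[x, y]) (F_ N) @[N --> \oo] --> b n * rtoc (moment `[x, y] n).
  apply: cvg_near_cst; exists j.+1 => // N /= jN; rewrite FE.
  rewrite (bigD1 (Ordinal jN))//= big1 ?addr0.
    rewrite !EE /j; case: (n) => k /=; rewrite eqxx.
      by rewrite mulr0 addr0.
    by rewrite mulr0 add0r.
  move=> k kj; rewrite !EE.
  have [h1 h2] : k%:Z != n /\ Negz k != n.
    split; apply: contra kj => /eqP kn; apply/eqP/val_inj => /=; rewrite /j -kn//.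
  by rewrite (negbTE h1) (negbTE h2) !mulr0 addr0.
split; first by apply: eq_Cintegrable iF => // u _; rewrite /W mulrA.
transitivity (Cintegral leb2 (annulus `[x, y]) (fun u => laurent_sum b (of_plane u) * W u)).
  by apply: eq_Cintegral => u _; rewrite /W mulrA.
exact: (cvg_unique (@norm_hausdorff _ (CC R)) cvF lim2).
Qed.

End RadialWeight.

(** * Square integrable Laurent series *)
Section SquareIntegrable.
Context {R : realType}.
Implicit Types (D : set (measurableTypeR R)) (z : CC R) (a b : int -> CC R).

Let leb : {measure set (measurableTypeR R) -> \bar R} := @lebesgue_measure R.
Let plane := (measurableTypeR R * measurableTypeR R)%type.
Let leb2 : {measure set plane -> \bar R} :=
  (@lebesgue_measure R \x @lebesgue_measure R)%E.

Context (r : R) (om : R -> R) (r_gt0 : 0 < r).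
Context (om_gt0 : forall s, 0 < s -> s < r ^+ 2 -> 0 < om s).
Context (om_int : leb.-integrable `]0, r ^+ 2[ (EFin \o om)).

Let I : set (measurableTypeR R) := `]0, r ^+ 2[.
Let mI : measurable I. Proof. exact: measurable_itv. Qed.
Let mAI : measurable (annulus I). Proof. exact: measurable_annulus. Qed.
Let II : I `<=` I. Proof. by []. Qed.
Let rr_gt0 : 0 < r ^+ 2. Proof. by rewrite exprn_gt0. Qed.

Let segment_sub x y : 0 < x -> y < r ^+ 2 -> `[x, y]%classic `<=` I.
Proof.
move=> x0 yr s; rewrite /I /= !in_itv/= => /andP[h1 h2].
by rewrite (lt_le_trans x0 h1) (le_lt_trans h2 yr).
Qed.

Let om_ge0 s : I s -> 0 <= om s.
Proof. by rewrite /I /= in_itv/= => /andP[h1 h2]; exact/ltW/om_gt0. Qed.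

Let exprz_ge0_I s (n : int) : I s -> 0 <= s ^ n.
Proof. by rewrite /I /= in_itv/= => /andP[h1 h2]; rewrite exprz_ge0// ltW. Qed.

Let u_ := margin (r ^+ 2).
Let v_ n := r ^+ 2 - margin (r ^+ 2) n.
Let ex : exhausts u_ v_ I. Proof. exact: exhausts_margin. Qed.

Let u_gt0 n : 0 < u_ n. Proof. exact: margin_gt0. Qed.
Let v_lt n : v_ n < r ^+ 2. Proof. by rewrite ltrBlDr ltrDl margin_gt0. Qed.
Let uv_ n : u_ n <= v_ n. Proof. by have [] := ex. Qed.
Let uv_sub n : [set` `[u_ n, v_ n]] `<=` I.
Proof. exact: segment_sub. Qed.

Lemma moment_integrable_segment x y (n : int) : 0 < x -> y < r ^+ 2 ->
  leb.-integrable `[x, y] (EFin \o (fun s => s ^ n * om s)).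
Proof.
move=> x0 yr; have sI := segment_sub x0 yr; have [M hM] := bounded_exprz y n x0.
have mxy : measurable (`[x, y]%classic : set (measurableTypeR R)) by exact: measurable_itv.
have omD : leb.-integrable `[x, y] (EFin \o om) by apply: (integrableS mI mxy sI om_int).
have iM : leb.-integrable `[x, y] (EFin \o (fun s => M * om s)).
  by have := @integrableZl _ (measurableTypeR R) R leb _ mxy M _ omD; apply: eq_integrable.
apply: (le_integrable mxy _ _ iM); first by apply/measurable_EFinP; exact: measurable_exprz_weight om_int _ _ _ _.
move=> s sxy; have sI' := sI _ sxy; rewrite lee_fin ger0_norm; last first.
  by rewrite mulr_ge0 ?om_ge0 ?exprz_ge0_I.
apply: le_trans (ler_norm _); rewrite ler_wpM2r ?om_ge0//.
by move: sxy; rewrite /= in_itv/= => /andP[]; exact: hM.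
Qed.

Lemma moment_gt0 x y (n : int) : 0 < x -> x < y -> y < r ^+ 2 ->
  0 < moment om `[x, y] n.
Proof.
move=> x0 xy yr; rewrite mulr_gt0 ?pi_gt0//; apply: Rintegral_gt0.
- exact: measurable_itv.
- rewrite /= lebesgue_measure_itv/= lte_fin xy -EFinB lte_fin; lra.
- exact: moment_integrable_segment.
- move=> s sxy; have := segment_sub x0 yr sxy; rewrite /I /= in_itv/= => /andP[h1 h2].
  by rewrite mulr_gt0 ?om_gt0 ?exprz_gt0.
Qed.

(** The coefficients are recovered by integration against monomials. *)
Lemma laurent_sum_inj a b : growth r a -> growth r b ->
  (forall z, pdisc r z -> laurent_sum a z = laurent_sum b z) -> forall n, a n = b n.
Proof.
move=> ga gb ab n.
have [x [y [x0 xy yr]]] : exists x y, [/\ 0 < x, x < y & y < r ^+ 2].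
  by exists (r ^+ 2 / 3), (r ^+ 2 / 2); move: (r ^+ 2) rr_gt0 => t t0; split; lra.
have m0 := moment_gt0 n x0 xy yr.
have [_ ha] := wint_laurent_sum r_gt0 om_gt0 om_int n ga x0 (ltW xy) yr.
have [_ hb] := wint_laurent_sum r_gt0 om_gt0 om_int n gb x0 (ltW xy) yr.
have m1 : rtoc (moment om `[x, y] n) != 0 by rewrite rtoc_eq0 gt_eqF.
apply: (mulIf m1); rewrite -ha -hb; apply: eq_Cintegral => u Du.
by rewrite ab//; apply: annulus_pdisc (segment_sub x0 yr) Du.
Qed.

Definition wsqint (F : CC R -> CC R) :=
  leb2.-integrable (annulus I) (EFin \o (fun u => modulus (F (of_plane u)) ^+ 2 * om (qsq u))).

(** Integrate [|g|^2 >= 2 Re(g conj(h)) - |h|^2] for the Laurent sum [g] and its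
    monomial [h = b n * z^n]; the integral of the right-hand side is the energy
    of [h]. *)
Lemma moment_energy_le b (n : int) x y : growth r b -> wsqint (laurent_sum b) ->
  0 < x -> x <= y -> y < r ^+ 2 ->
  modulus (b n) ^+ 2 * moment om `[x, y] n <=
  \int[leb2]_(u in annulus I) (modulus (laurent_sum b (of_plane u)) ^+ 2 * om (qsq u)).
Proof.
move=> gb sb x0 xy yr; have sI := segment_sub x0 yr.
have mS : measurable (`[x, y]%classic : set (measurableTypeR R)) by exact: measurable_itv.
have mA := measurable_annulus mS; have [i1 w1] := wint_laurent_sum r_gt0 om_gt0 om_int n gb x0 xy yr.
have i2 := wintegrable_exprz_conj om_gt0 om_int n n x0 yr.
have w2 := wint_diagonal om_gt0 om_int n mS sI.
have AA : annulus `[x, y] `<=` annulus I by move=> u; exact: sI.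
have sb' : leb2.-integrable (annulus `[x, y])
    (EFin \o (fun u => modulus (laurent_sum b (of_plane u)) ^+ 2 * om (qsq u))).
  exact: integrableS sb.
have g0 u : annulus I u -> 0 <= modulus (laurent_sum b (of_plane u)) ^+ 2 * om (qsq u).
  by move=> Iu; rewrite mulr_ge0 ?om_ge0// sqr_ge0.
apply: (@le_trans _ _ (\int[leb2]_(u in annulus `[x, y])
   (modulus (laurent_sum b (of_plane u)) ^+ 2 * om (qsq u)))); last first.
  rewrite /Rintegral fine_le ?integrable_fin_num//.
  apply: ge0_subset_integral => //; first exact: measurable_int sb.
pose c1 : CC R := rtoc 2 * conj (b n); pose c2 : CC R := rtoc (modulus (b n) ^+ 2).
have iF := CintegrableB mA (CintegrableZ c1 mA i1) (CintegrableZ c2 mA i2).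
have : Cintegral leb2 (annulus `[x, y]) (fun u =>
    c1 * (laurent_sum b (of_plane u) * conj (of_plane u ^ n) * rtoc (om (qsq u))) -
    c2 * (of_plane u ^ n * conj (of_plane u ^ n) * rtoc (om (qsq u)))) =
    rtoc (modulus (b n) ^+ 2 * moment om `[x, y] n).
  have e0 := CintegralB mA (CintegrableZ c1 mA i1) (CintegrableZ c2 mA i2).
  rewrite /wint in w1 w2; rewrite e0 (CintegralZ _ mA i1) (CintegralZ _ mA i2) w1 w2.
  rewrite mulrA /c1 -(mulrA (rtoc 2)) [conj _ * _]mulrC mul_conj -/c2.
  have r2 : rtoc 2 = 2 :> CC R by rewrite rmorph_nat.
  by rewrite [RHS]rmorphM/= -/c2 r2; ring.
move=> /(congr1 (@complex.Re R)); rewrite [RHS]/= => <-; rewrite [leLHS]/=.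
apply: le_Rintegral => //; first by case: iF.
move=> u Au; have o0 := om_ge0 (sI _ Au).
move: (laurent_sum b _) (of_plane u ^ n) => g zn.
have -> : c1 * (g * conj zn * rtoc (om (qsq u))) - c2 * (zn * conj zn * rtoc (om (qsq u))) =
    (rtoc 2 * (g * conj (b n * zn)) - b n * zn * conj (b n * zn)) * rtoc (om (qsq u)).
  by rewrite /c1 /c2 -mul_conj rmorphM/=; ring.
move: (b n * zn) => h; rewrite mulrC rtocM_Re mulrC ler_wpM2r//.
rewrite mul_conj ReD ReN rtocM_Re/= ReM !modulus_sqr.
case: g h => g1 g2 [h1 h2] /=.
have := sqr_ge0 (g1 - h1); have := sqr_ge0 (g2 - h2).
by nra.
Qed.

(** A bound on [|b n|^2] times moments that are unbounded. *)
Lemma coef_eq0 b (n : int) : growth r b -> wsqint (laurent_sum b) ->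
  (\int[leb]_(s in I) (s ^ n * om s)%:E = +oo)%E -> b n = 0.
Proof.
move=> gb sb In; apply/eqP/negPn/negP => bn0.
have m0 : 0 < modulus (b n) ^+ 2 by rewrite exprn_gt0// modulus_gt0.
set M := \int[leb2]_(u in annulus I) (modulus (laurent_sum b (of_plane u)) ^+ 2 * om (qsq u)).
have cv : (\int[leb]_(s in `[u_ k, v_ k]) (s ^ n * om s)%:E @[k --> \oo] --> +oo)%E.
  rewrite -In; apply: (ge0_cvg_integral_exhausts ex).
    by apply/measurable_EFinP; exact: measurable_exprz_weight om_int _ _ _ _.
  by move=> s Is; rewrite lee_fin mulr_ge0 ?om_ge0 ?exprz_ge0_I.
have bd k : (\int[leb]_(s in `[u_ k, v_ k]) (s ^ n * om s)%:E <= (M / modulus (b n) ^+ 2 / pi)%:E)%E.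
  have ik := moment_integrable_segment n (u_gt0 k) (v_lt k).
  have mk : measurable (`[u_ k, v_ k]%classic : set (measurableTypeR R)) by exact: measurable_itv.
  rewrite -(fineK (integrable_fin_num mk ik)) lee_fin ler_pdivlMr ?pi_gt0//.
  rewrite ler_pdivlMr// mulrC [X in _ * X]mulrC.
  exact: (moment_energy_le n gb sb (u_gt0 k) (uv_ k) (v_lt k)).
suff : (+oo <= (M / modulus (b n) ^+ 2 / pi)%:E)%E by rewrite leye_eq.
rewrite -(cvg_lim (@ereal_hausdorff R) cv); apply: lime_le.
  exact: cvgP cv.
exact: nearW.
Qed.

Lemma Cintegral_exhaust (F : plane -> CC R) : Cintegrable leb2 (annulus I) F ->
  Cintegral leb2 (annulus `[u_ n, v_ n]) F @[n --> \oo] --> Cintegral leb2 (annulus I) F.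
Proof.
move=> iF; pose A n := annulus `[u_ n, v_ n].
have mA n : measurable (A n) by apply: measurable_annulus; exact: measurable_itv.
have AI n : annulus I `&` A n = A n.
  by apply: setIidr => u; exact: uv_sub.
pose F_ n u : CC R := Complex (((@complex.Re R \o F) \_ (A n)) u) (((@complex.Im R \o F) \_ (A n)) u).
have -> : (fun n => Cintegral leb2 (annulus `[u_ n, v_ n]) F) =
    (fun n => Cintegral leb2 (annulus I) (F_ n)).
  apply/funext => n; rewrite /Cintegral -/(A n) -(AI n).
  by congr Complex; rewrite Rintegral_mkcondr.
have [m1 m2] := Cintegrable_measurable iF.
have FE n u : F_ n u = if u \in A n then F u else 0.
  rewrite /F_ /patch; case: ifPn => _ //=; first by case: (F u).
have im := Cintegrable_modulus mAI iF.
apply: (proj2 (cvg_Cintegral mAI _ im _ _)).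
- move=> n; split; apply/(measurable_restrict _ (mA n) mAI).
    by rewrite AI; apply: (measurable_funS mAI _ m1) => u; exact: uv_sub.
  by rewrite AI; apply: (measurable_funS mAI _ m2) => u; exact: uv_sub.
- by move=> n u _; rewrite FE; case: ifP => // _; rewrite modulus0 modulus_ge0.
move=> u Iu; have [_ _ _ IE] := ex.
have : I (qsq u) by [].
rewrite IE => -[N _ uN]; apply: cvg_near_cst; exists N => // n /= Nn; rewrite FE.
rewrite ifT//; rewrite inE /A /annulus/=.
have nd (k : nat) : [set` `[u_ k, v_ k]] `<=` [set` `[u_ k.+1, v_ k.+1]].
  by have [h1 _ h2 _] := ex; apply: subset_itv; rewrite bnd_simp.
move: uN; elim: n Nn => [|n ih]; first by rewrite leqn0 => /eqP ->.
rewrite leq_eqVlt => /predU1P[<-//|Nn] uN; apply: nd; exact: ih.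
Qed.

Let moment_finite (n : int) := leb.-integrable I (EFin \o (fun s => s ^ n * om s)).

Lemma wsqint_exprz (n : int) : moment_finite n -> wsqint (fun z => z ^ n).
Proof.
move=> gn; have := @integrable_radial R r I (fun s => s ^ n * om s) mI II gn.
apply: eq_integrable => // u _ /=; congr EFin.
by rewrite modulusXz qsqE expr2 expr2 expfzMl.
Qed.

(** From [|F G| <= |F|^2 + |G|^2]. *)
Lemma wsqint_wintegrable (F G : CC R -> CC R) :
  Cmeasurable (annulus I) (fun u => F (of_plane u)) ->
  Cmeasurable (annulus I) (fun u => G (of_plane u)) ->
  wsqint F -> wsqint G -> wintegrable om I (fun z => F z * conj (G z)).
Proof.
move=> mF mG sF sG.
have sFG := @integrableD _ _ _ leb2 _ mAI _ _ sF sG.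
rewrite /wintegrable; apply: (@le_Cintegrable _ _ _ leb2 _ _ (fun u => modulus (F (of_plane u)) ^+ 2 * om (qsq u) +
  modulus (G (of_plane u)) ^+ 2 * om (qsq u))) => //.
- apply: CmeasurableM; last exact: Cmeasurable_weight om_int _ _ _.
  by apply: CmeasurableM => //; exact: Cmeasurable_conj.
- move=> u Iu; have o0 := om_ge0 Iu.
  rewrite !modulusM modulus_conj modulus_rtoc ger0_norm// -mulrDl ler_wpM2r//.
  by move: (modulus (F _)) (modulus (G _)) => x y; nra.
Qed.

Lemma Cmeasurable_laurent_I b : growth r b ->
  Cmeasurable (annulus I) (fun u => laurent_sum b (of_plane u)).
Proof. by move=> gb; exact: (Cmeasurable_laurent_sum r_gt0 gb mI II). Qed.

Lemma wint_laurent_exprz b (n : int) : growth r b -> wsqint (laurent_sum b) -> moment_finite n ->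
  wintegrable om I (fun z => laurent_sum b z * conj (z ^ n)) /\
  wint om I (fun z => laurent_sum b z * conj (z ^ n)) = b n * rtoc (moment om I n).
Proof.
move=> gb sb gn; have iF : wintegrable om I (fun z => laurent_sum b z * conj (z ^ n)).
  apply: wsqint_wintegrable => //; first exact: Cmeasurable_laurent_I.
    by apply: Cmeasurable_exprz => //; exact: Cmeasurable_of_plane.
  exact: wsqint_exprz.
split => //; have c1 := Cintegral_exhaust iF.
have E k : Cintegral leb2 (annulus `[u_ k, v_ k])
   (fun u => laurent_sum b (of_plane u) * conj (of_plane u ^ n) * rtoc (om (qsq u))) =
   b n * rtoc (moment om `[u_ k, v_ k] n).
  by have [_] := wint_laurent_sum r_gt0 om_gt0 om_int n gb (u_gt0 k) (uv_ k) (v_lt k).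
rewrite (funext E) in c1.
have c2 : b n * rtoc (moment om `[u_ k, v_ k] n) @[k --> \oo] --> b n * rtoc (moment om I n).
  apply: cvgMl_tmp; apply: cvg_rtoc; apply: cvgMl_tmp.
  have c := cvg_integral_exhausts ex gn.
  rewrite -(fineK (integrable_fin_num mI gn)) in c; exact: (fine_cvg c).
exact: (cvg_unique (@norm_hausdorff _ (CC R)) c1 c2).
Qed.

Lemma moment_finite_ge (p : nat) (n : int) : moment_finite (- p%:Z) -> - p%:Z <= n -> moment_finite n.
Proof.
move=> gp pn; have [k nk] : exists k : nat, n = k%:Z - p%:Z.
  by exists (absz (n + p%:Z)); lia.
have mn : measurable_fun I (fun s => s ^ n * om s) by exact: (measurable_exprz_weight om_int n mI II).
have ic : leb.-integrable I (EFin \o (fun s => (r ^+ 2) ^+ k * (s ^ (- p%:Z) * om s))).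
  by have := @integrableZl _ (measurableTypeR R) R leb _ mI ((r ^+ 2) ^+ k) _ gp; apply: eq_integrable.
apply: (le_integrable mI _ _ ic); first exact/measurable_EFinP.
move=> s Is; have o0 := om_ge0 Is; have e0 j := exprz_ge0_I j Is.
rewrite lee_fin !ger0_norm ?mulr_ge0 ?exprn_ge0 ?(ltW r_gt0)//.
move: (Is); rewrite /I /= in_itv/= => /andP[s0 sr].
rewrite mulrA ler_wpM2r// nk expfzDr ?gt_eqF// ler_wpM2r//.
by apply: lerXn2r; rewrite ?nnegrE ?(ltW rr_gt0) ?(ltW s0) ?(ltW sr).
Qed.

Lemma wsqint_bounded (F : CC R -> CC R) (p : nat) (C : R) : moment_finite (- p%:Z) ->
  Cmeasurable (annulus I) (fun u => F (of_plane u)) ->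
  (forall z, pdisc r z -> modulus (F z) <= C * modulus z ^ (- p%:Z)) -> wsqint F.
Proof.
move=> gp mF FC.
have ic : leb.-integrable I (EFin \o (fun s => C ^+ 2 * (s ^ (- p%:Z) * om s))).
  by have := @integrableZl _ (measurableTypeR R) R leb _ mI (C ^+ 2) _ gp; apply: eq_integrable.
apply: (le_integrable mAI _ _ (integrable_radial mI II ic)).
  apply/measurable_EFinP; apply: measurable_funM.
    by apply: measurable_funX; exact: measurable_modulus.
  by have [] := Cmeasurable_weight om_int mI II.
move=> u Iu; have o0 := om_ge0 Iu; have e0 := exprz_ge0_I (- p%:Z) Iu.
rewrite lee_fin !ger0_norm ?(mulr_ge0 (sqr_ge0 _) (mulr_ge0 e0 o0))//; last first.
  by rewrite (mulr_ge0 (sqr_ge0 _) o0).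
rewrite mulrA ler_wpM2r// qsqE expr2 expfzMl -exprMn_comm -?expr2; last exact: mulrC.
have zr := annulus_pdisc r_gt0 II Iu; have h := FC _ zr.
apply: lerXn2r => //; rewrite nnegrE ?modulus_ge0//.
exact: le_trans (modulus_ge0 _) h.
Qed.

Lemma wsqint_laurent_sum kappa (p : nat) (C : R) : growth r kappa -> moment_finite (- p%:Z) ->
  (forall N z, pdisc r z -> modulus (series (laurent_term kappa z) N) <= C * modulus z ^ (- p%:Z)) ->
  wsqint (laurent_sum kappa).
Proof.
move=> gk gp kC; have mk := Cmeasurable_laurent_I gk.
apply: (wsqint_bounded gp mk (C := C)) => z zr; have /pdiscP[z0 z1] := zr.
have [_ _ cv] := growth_cvg gk z0 z1.
by apply: (modulus_lim_le cv) => N; exact: kC.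
Qed.

(** The partial sums of the series of [kappa] are dominated by [|z|^(- p)]
    times a constant; as both [|z|^(- p)] and [laurent_sum b] are square
    integrable, dominated convergence applies. *)
Lemma wint_pairing b kappa (p : nat) (C : R) :
  growth r b -> wsqint (laurent_sum b) -> growth r kappa -> moment_finite (- p%:Z) ->
  (forall k : nat, (p <= k)%N -> kappa (Negz k) = 0) ->
  (forall N z, pdisc r z -> modulus (series (laurent_term kappa z) N) <= C * modulus z ^ (- p%:Z)) ->
  series (fun k : nat =>
    b k%:Z * conj (kappa k%:Z) * rtoc (moment om I k%:Z) +
    b (Negz k) * conj (kappa (Negz k)) * rtoc (moment om I (Negz k))) @ \oo -->
  wint om I (fun z => laurent_sum b z * conj (laurent_sum kappa z)).
Proof.
move=> gb sb gk gp k0 kC.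
have mk := Cmeasurable_laurent_I gk; have mb := Cmeasurable_laurent_I gb.
pose T (n : int) (u : plane) := conj (kappa n) *
  (laurent_sum b (of_plane u) * conj (of_plane u ^ n) * rtoc (om (qsq u))).
have TP n : Cintegrable leb2 (annulus I) (T n) /\
    Cintegral leb2 (annulus I) (T n) = b n * conj (kappa n) * rtoc (moment om I n).
  have [kn|kn] := eqVneq (kappa n) 0.
    have T0 u : annulus I u -> 0 = T n u by rewrite /T kn rmorph0 mul0r.
    split; first exact: eq_Cintegrable mAI T0 (Cintegrable0 _ mAI).
    by rewrite -(eq_Cintegral _ T0) Cintegral0 kn rmorph0 mulr0 mul0r.
  have gn : moment_finite n.
    apply: (moment_finite_ge gp); case: n kn => j; first by lia.
    move=> kj; have : (j < p)%N by rewrite ltnNge; apply: contra kj => /k0 ->.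
    by lia.
  have [i1 i2] := wint_laurent_exprz gb sb gn.
  split; first exact: CintegrableZ.
  rewrite (CintegralZ _ mAI i1); rewrite /wint in i2; rewrite i2; ring.
pose F_ N u := laurent_sum b (of_plane u) * conj (series (laurent_term kappa (of_plane u)) N) *
  rtoc (om (qsq u)).
have FE N : Cintegral leb2 (annulus I) (F_ N) = series (fun k : nat =>
    b k%:Z * conj (kappa k%:Z) * rtoc (moment om I k%:Z) +
    b (Negz k) * conj (kappa (Negz k)) * rtoc (moment om I (Negz k))) N.
  have iT (k : nat) : Cintegrable leb2 (annulus I) (fun u => T k%:Z u + T (Negz k) u).
    by apply: CintegrableD => //; [exact: (TP k%:Z).1|exact: (TP (Negz k)).1].
  have [_ sT] := Cintegral_sum (index_enum 'I_N) mAI (fun k : 'I_N => iT k).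
  rewrite (@eq_Cintegral _ _ _ _ _ _ (fun u => \sum_(k < N) (T k%:Z u + T (Negz k) u))); last first.
    move=> u _; rewrite /F_ /series/= big_mkord rmorph_sum/= mulr_sumr mulr_suml.
    apply: eq_bigr => k _; rewrite /laurent_term /T rmorphD !rmorphM/=; ring.
  rewrite sT /series/= big_mkord; apply: eq_bigr => k _.
  by rewrite (CintegralD mAI (TP k%:Z).1 (TP (Negz k)).1) (TP k%:Z).2 (TP (Negz k)).2.
rewrite -(funext FE).
have [ip _] := wint_laurent_exprz gb sb gp.
have ig := @integrableZl _ _ R leb2 _ mAI C _ (Cintegrable_modulus mAI ip).
pose g u := C * modulus (laurent_sum b (of_plane u) * conj (of_plane u ^ (- p%:Z)) *
  rtoc (om (qsq u))).
pose F u := laurent_sum b (of_plane u) * conj (laurent_sum kappa (of_plane u)) *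
  rtoc (om (qsq u)).
suff [] : Cintegrable leb2 (annulus I) F /\
   Cintegral leb2 (annulus I) (F_ N) @[N --> \oo] --> Cintegral leb2 (annulus I) F by [].
apply: (@cvg_Cintegral _ _ _ leb2 _ F_ F g mAI).
- move=> N; apply: CmeasurableM; last exact: (Cmeasurable_weight om_int mI II).
  apply: CmeasurableM => //; apply: Cmeasurable_conj; apply: Cmeasurable_laurent_partial_sum => //.
  exact: Cmeasurable_of_plane.
- by apply: eq_integrable ig.
- move=> N u Iu; have zr := annulus_pdisc r_gt0 II Iu; have h := kC N _ zr.
  rewrite /F_ /g !modulusM !modulus_conj modulusXz.
  rewrite [leRHS]mulrA ler_wpM2r ?modulus_ge0// mulrCA ler_wpM2l ?modulus_ge0//.
- move=> u Iu; apply: cvgMr_tmp; apply: cvgMl_tmp; apply: cvgC_conj.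
  have /pdiscP[z0 z1] := annulus_pdisc r_gt0 II Iu.
  by have [_ _] := growth_cvg gk z0 z1.
Qed.

End SquareIntegrable.

(** * The weighted Bergman space *)
Section BergmanMeasure.
Context {R : realType}.
Implicit Types (z : CC R) (b kappa : int -> CC R) (f g : CC R -> CC R).

Let leb : {measure set (measurableTypeR R) -> \bar R} := @lebesgue_measure R.
Let plane := (measurableTypeR R * measurableTypeR R)%type.
Let leb2 : {measure set plane -> \bar R} :=
  (@lebesgue_measure R \x @lebesgue_measure R)%E.

Context (r alpha beta0 beta : R) (p : nat) (r_gt0 : 0 < r) (alpha_gtN1 : - 1 < alpha)
  (beta0_gtN1 : - 1 < beta0) (beta0_le0 : beta0 <= 0) (beta_def : beta = beta0 + p%:R).

Let rho := r ^+ 2.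
Let rho_gt0 : 0 < rho. Proof. by rewrite exprn_gt0. Qed.
Let beta_gtN1 : - 1 < beta.
Proof.
have b0 := beta0_gtN1; have p0 : 0 <= p%:R :> R by [].
by rewrite beta_def; lra.
Qed.

Let beta_addz_gtN1 (n : int) : - p%:Z <= n -> -1 < beta + n%:~R.
Proof.
move=> pn; have b0 := beta0_gtN1.
have : (- p%:Z)%:~R <= n%:~R :> R by rewrite ler_int.
by rewrite rmorphN/= beta_def -[p%:~R]/(p%:R : R); lra.
Qed.

Let B := beta_integral rho alpha beta.
Let B_gt0 : 0 < B. Proof. by apply: beta_integral_gt0; [exact: rho_gt0|exact: alpha_gtN1|exact: beta_gtN1]. Qed.

(** The density of the measure as a function of [|z|^2]. *)
Definition radial_density (s : R) : R := beta_weight rho alpha beta s / B / pi.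

Let om := radial_density.
Let I : set (measurableTypeR R) := `]0, rho[.

Lemma mu_densityE z : mu_density r alpha beta z = om (modulus z ^+ 2).
Proof.
rewrite /mu_density /om /radial_density /B (beta_integral_Beta rho_gt0 alpha_gtN1 beta_gtN1) /beta_weight.
have e (x y : R) : 0 <= x -> x `^ (2 * y) = (x ^+ 2) `^ y.
  by move=> x0; rewrite powRrM -(powR_mulrn 2).
by rewrite !e ?modulus_ge0 ?(ltW r_gt0).
Qed.

Lemma radial_density_gt0 s : 0 < s -> s < rho -> 0 < om s.
Proof.
by move=> s0 sr; rewrite !divr_gt0 ?pi_gt0 ?B_gt0// /beta_weight mulr_gt0// powR_gt0// subr_gt0.
Qed.

Let exprz_density (n : int) s : I s ->
  s ^ n * om s = (B * pi)^-1 * beta_weight rho alpha (beta + n%:~R) s.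
Proof.
rewrite /I /= in_itv/= => /andP[s0 sr].
rewrite /om /radial_density /beta_weight powRD; last by rewrite (@gt_eqF _ _ s)// implybT.
rewrite powR_intmul ?(ltW s0)//.
by rewrite invfM; ring.
Qed.

(** Here and in the next lemma the threshold is [- p] because
    [beta - p = beta0] is greater than -1 while [beta0 - 1] is not. *)
Lemma exprz_density_integrable (n : int) : - p%:Z <= n ->
  leb.-integrable I (EFin \o (fun s => s ^ n * om s)).
Proof.
move=> pn; have bn := beta_addz_gtN1 pn.
have mI : measurable I by exact: measurable_itv.
have := @integrableZl _ (measurableTypeR R) R leb _ mI (B * pi)^-1 _
  (beta_weight_integrable rho_gt0 alpha_gtN1 bn).
by apply: eq_integrable => // s; rewrite inE => Is /=; rewrite exprz_density.
Qed.

Lemma exprz_density_divergent (n : int) : n < - p%:Z ->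
  (\int[leb]_(s in I) (s ^ n * om s)%:E = +oo)%E.
Proof.
move=> np; have bn : beta + n%:~R <= -1.
  have b0 := beta0_le0; have : (n + 1)%:~R <= (- p%:Z)%:~R :> R by rewrite ler_int; lia.
  by rewrite rmorphD rmorphN/= beta_def -[p%:~R]/(p%:R : R); lra.
have BP : 0 < (B * pi)^-1 by rewrite invr_gt0 mulr_gt0// pi_gt0.
transitivity ((B * pi)^-1%:E * \int[leb]_(s in I) (beta_weight rho alpha (beta + n%:~R) s)%:E)%E.
  rewrite -ge0_integralZl_EFin//; last exact: ltW.
  - by apply: eq_integral => s; rewrite inE => Is; rewrite exprz_density.
  - exact: measurable_itv.
  - by move=> s _; rewrite lee_fin beta_weight_ge0.
  - by apply/measurable_EFinP; exact: measurable_beta_weight.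
by rewrite beta_weight_divergent// gt0_muley// lte_fin.
Qed.

Lemma radial_density_integrable : leb.-integrable I (EFin \o om).
Proof.
have p0 : - p%:Z <= 0 by lia.
have := exprz_density_integrable p0; apply: eq_integrable => //; first exact: measurable_itv.
by move=> s _ /=; rewrite expr0z mul1r.
Qed.

Definition monomial_norm (n : int) : R := moment om I n.

Lemma monomial_normE (n : int) : - p%:Z <= n ->
  monomial_norm n = beta_integral rho alpha (beta + n%:~R) / B.
Proof.
move=> pn; rewrite /monomial_norm /moment.
have bn := beta_addz_gtN1 pn.
have mI : measurable I by exact: measurable_itv.
have -> : \int[leb]_(s in I) (s ^ n * om s) =
    \int[leb]_(s in I) ((B * pi)^-1 * beta_weight rho alpha (beta + n%:~R) s).
  by apply: eq_Rintegral => s; rewrite inE => Is; rewrite exprz_density.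
rewrite (RintegralZl _ mI (beta_weight_integrable rho_gt0 alpha_gtN1 bn)).
rewrite -/(beta_integral _ _ _); move: (pi_gt0 R) B_gt0; move: (pi : R) B => P B' P0 B0; field.
by rewrite !gt_eqF.
Qed.

Lemma monomial_norm_gt0 (n : int) : - p%:Z <= n -> 0 < monomial_norm n.
Proof.
move=> pn; rewrite monomial_normE// divr_gt0//.
by apply: beta_integral_gt0; [exact: rho_gt0|exact: alpha_gtN1|exact: beta_addz_gtN1].
Qed.

Lemma monomial_norm0 : monomial_norm 0 = 1.
Proof. by rewrite monomial_normE ?addr0 ?divff ?gt_eqF//; lia. Qed.

(** The integration by parts of [beta_integralS], in degree [n]. *)
Lemma monomial_normS (n : int) : - p%:Z <= n ->
  (alpha + beta + n%:~R + 2) * monomial_norm (n + 1) =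
  (beta + n%:~R + 1) * rho * monomial_norm n.
Proof.
move=> pn; have pn1 : - p%:Z <= n + 1 by lia.
have bn := beta_addz_gtN1 pn.
have h := beta_integralS rho_gt0 alpha_gtN1 bn.
rewrite (monomial_normE pn) (monomial_normE pn1).
have -> : beta + (n + 1)%:~R = beta + n%:~R + 1 by rewrite rmorphD addrA.
have -> : alpha + beta + n%:~R + 2 = alpha + (beta + n%:~R) + 2 by rewrite !addrA.
move: h; move: (beta_integral _ _ (_ + 1)) => X; move: (beta_integral _ _ _) => Y h.
by rewrite mulrA h -mulrA.
Qed.

Lemma pochhammerS (a : R) n : pochhammer a n.+1 = pochhammer a n * (a + n%:R).
Proof. by rewrite /pochhammer big_ord_recr. Qed.

Lemma pochhammer_gt0 (a : R) n : 0 < a -> 0 < pochhammer a n.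
Proof. by move=> a0; apply: prodr_gt0 => i _; rewrite ltr_wpDr. Qed.

Lemma monomial_norm_nat (n : nat) :
  monomial_norm n%:Z = rho ^+ n * pochhammer (beta + 1) n / pochhammer (alpha + beta + 2) n.
Proof.
elim: n => [|n ih]; first by rewrite monomial_norm0 /pochhammer !big_ord0 expr0 !mul1r invr1.
have pn : - p%:Z <= n%:Z by clear; lia.
have h := monomial_normS pn; rewrite ih -[n%:~R]/(n%:R) in h.
have al := alpha_gtN1; have be := beta_gtN1; have n0 : 0 <= n%:R :> R by [].
have q0 : 0 < pochhammer (alpha + beta + 2) n by apply: pochhammer_gt0; lra.
have a0 : 0 < alpha + beta + 2 + n%:R by lra.
have -> : n.+1%:Z = n%:Z + 1 by rewrite -addn1 PoszD.
have {}h : (alpha + beta + 2 + n%:R) * monomial_norm (n%:Z + 1) =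
  (beta + 1 + n%:R) * rho * (rho ^+ n * pochhammer (beta + 1) n / pochhammer (alpha + beta + 2) n).
  by rewrite -[beta + 1 + _]addrAC -h; congr (_ * _); ring.
rewrite !pochhammerS exprS; apply: (mulfI (lt0r_neq0 a0)); rewrite h; field.
by rewrite !gt_eqF.
Qed.

Lemma monomial_norm_neg (j : nat) : (j <= p)%N ->
  monomial_norm (- j%:Z) = rho ^- j * (Gamma (alpha + beta + 2) / Gamma (beta + 1)) *
    (Gamma (beta + 1 - j%:R) / Gamma (alpha + beta + 2 - j%:R)).
Proof.
have al := alpha_gtN1; have be := beta_gtN1; have be0 := beta0_gtN1.
elim: j => [|j ih] jp.
  rewrite oppr0 monomial_norm0 !subr0 expr0 invr1 mul1r.
  have g1 : 0 < Gamma (beta + 1) by apply: Gamma_gt0; lra.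
  have g2 : 0 < Gamma (alpha + beta + 2) by apply: Gamma_gt0; lra.
  move: g1 g2; move: (Gamma (beta + 1)) (Gamma (alpha + beta + 2)) => G1 G2 g1 g2; field.
  by rewrite !gt_eqF.
have jp' : j%:R + 1 <= p%:R :> R by rewrite natr1 ler_nat.
have b1 : 0 < beta - j%:R by clear ih; rewrite beta_def; lra.
have a1 : 0 < alpha + beta + 1 - j%:R by clear ih; rewrite beta_def; lra.
have h := @monomial_normS (- j.+1%:Z).
have e : - j.+1%:Z + 1 = - j%:Z by clear; lia.
rewrite e ih ?(ltnW jp)// in h.
have g1 : Gamma (beta + 1 - j%:R) = (beta - j%:R) * Gamma (beta - j%:R).
  by rewrite -(GammaS b1) addrAC.
have g2 : Gamma (alpha + beta + 2 - j%:R) =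
    (alpha + beta + 1 - j%:R) * Gamma (alpha + beta + 1 - j%:R).
  have <- : alpha + beta + 1 - j%:R + 1 = alpha + beta + 2 - j%:R by ring.
  exact: GammaS a1.
have -> : beta + 1 - j.+1%:R = beta - j%:R by rewrite -natr1; ring.
have -> : alpha + beta + 2 - j.+1%:R = alpha + beta + 1 - j%:R by rewrite -natr1; ring.
have p1 := Gamma_gt0 b1; have p2 := Gamma_gt0 a1.
have p3 : 0 < Gamma (beta + 1) by apply: Gamma_gt0; rewrite -ltrBlDr sub0r.
have pj : - p%:Z <= - j.+1%:Z by rewrite lerN2 lez_nat.
have {}h := h pj.
have e1 : (- j.+1%:Z)%:~R = - j%:R - 1 :> R by rewrite rmorphN/= -[j.+1%:~R]/(j.+1%:R : R) -natr1 opprD.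
rewrite e1 g1 g2 in h.
have b2 : (beta - j%:R) * rho != 0 by rewrite mulf_neq0 ?gt_eqF.
apply: (mulfI b2).
have -> : (beta - j%:R) * rho * monomial_norm (- j.+1%:Z) =
   (beta + (- j%:R - 1) + 1) * rho * monomial_norm (- j.+1%:Z) by ring.
rewrite -h exprS; move: p1 p2 p3 rho_gt0.
move: (Gamma (beta - _)) (Gamma (alpha + beta + 1 - _)) (Gamma (beta + 1)) rho => G1 G2 G3 ro h1 h2 h3 h4.
have -> : alpha + beta + (- j%:R - 1) + 2 = alpha + beta + 1 - j%:R by ring.
have := exprn_gt0 j h4; move: (ro ^+ j) (Gamma (alpha + beta + 2)) b1 a1 => w G4.
move: (beta - j%:R) (alpha + beta + 1 - j%:R) => x y x0 y0 w0; field.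
by rewrite !gt_eqF.
Qed.

Let mI : measurable I. Proof. exact: measurable_itv. Qed.
Let mAI : measurable (annulus I). Proof. exact: measurable_annulus. Qed.
Let disc_plane : set plane := of_plane @^-1` disc r.

(** The origin is the disc of radius 0, so the area formula shows that it is a
    null set. *)
Let origin_le0 : [set ((0, 0) : plane)] = [set u | qsq u <= 0].
Proof.
apply/seteqP; split => [u ->|[x y]]; rewrite /= /qsq/= ?expr0n ?addr0//.
move=> h; have x0 := sqr_ge0 x; have y0 := sqr_ge0 y.
have : x ^+ 2 == 0 by rewrite eq_le x0 andbT; lra.
have : y ^+ 2 == 0 by rewrite eq_le y0 andbT; lra.
by rewrite !sqrf_eq0 => /eqP -> /eqP ->.
Qed.

Let leb2_origin : leb2 [set ((0, 0) : plane)] = 0%E.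
Proof. by rewrite origin_le0 (area_disc (lexx 0)) mulr0. Qed.

Let disc_planeD : disc_plane `\` [set ((0, 0) : plane)] = annulus I.
Proof.
rewrite origin_le0; apply/seteqP; split => u.
  rewrite /disc_plane /annulus /I /disc/= in_itv/= qsqE => -[h1 /negP]; rewrite -ltNge => -> /=.
  by rewrite /rho ltr_pXn2r ?nnegrE ?modulus_ge0 ?(ltW r_gt0).
rewrite /disc_plane /annulus /I /disc/= in_itv/= qsqE => /andP[h1 h2]; split.
  by move: h2; rewrite /rho ltr_pXn2r ?nnegrE ?modulus_ge0 ?(ltW r_gt0).
by apply/negP; rewrite -ltNge.
Qed.

Let morigin : measurable [set ((0, 0) : plane)].
Proof.
rewrite origin_le0 (_ : [set u | _] = annulus [set` `]-oo, 0]]).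
  by apply: measurable_annulus; exact: measurable_itv.
by apply/seteqP; split => u; rewrite /annulus /= in_itv.
Qed.

Let disc_planeU : disc_plane = annulus I `|` [set ((0, 0) : plane)].
Proof.
rewrite -disc_planeD setUC setDUK// => u ->; rewrite /disc_plane /disc/=.
by rewrite (_ : of_plane _ = 0)// modulus0.
Qed.

Let mdisc : measurable disc_plane.
Proof. by rewrite disc_planeU; exact: (measurableU _ _ mAI morigin). Qed.

Let integral_disc (f : plane -> \bar R) : measurable_fun (annulus I) f ->
  (\int[leb2]_(u in disc_plane) f u = \int[leb2]_(u in annulus I) f u)%E.
Proof.
move=> mf; have mf' : measurable_fun disc_plane f.
  rewrite disc_planeU; apply/(measurable_funU _ mAI morigin); split => //.
  exact: measurable_fun_set1.
rewrite integralE [RHS]integralE; congr (_ - _)%E.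
  rewrite (@ge0_negligible_integral _ _ _ leb2 disc_plane _ _ morigin mdisc) ?disc_planeD//.
  exact: measurable_funepos.
rewrite (@ge0_negligible_integral _ _ _ leb2 disc_plane _ _ morigin mdisc) ?disc_planeD//.
exact: measurable_funeneg.
Qed.

Let density_of_plane (u : plane) : mu_density r alpha beta (of_plane u) = om (qsq u).
Proof. by rewrite mu_densityE qsqE. Qed.

Let mW : measurable_fun (annulus I) (fun u => om (qsq u)).
Proof. by have [] := Cmeasurable_weight radial_density_integrable mI (@subset_refl _ I). Qed.

Lemma mu_cintegralE (F : CC R -> CC R) : Cmeasurable (annulus I) (fun u => F (of_plane u)) ->
  mu_cintegral r alpha beta F = wint om I F.
Proof.
move=> [m1 m2].
have E (h : plane -> R) : measurable_fun (annulus I) h ->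
    \int[leb2]_(u in disc_plane) (h u * mu_density r alpha beta (of_plane u)) =
    \int[leb2]_(u in annulus I) (h u * om (qsq u)).
  move=> mh; rewrite /Rintegral; congr fine.
  under eq_integral do rewrite density_of_plane.
  by apply: integral_disc; apply/measurable_EFinP; exact: measurable_funM.
rewrite /mu_cintegral /mu_integral; apply: complex_ext => /=.
  rewrite [LHS](E _ m1); apply: eq_Rintegral => u _.
  by rewrite mulrC -rtocM_Re mulrC.
rewrite [LHS](E _ m2); apply: eq_Rintegral => u _.
by rewrite mulrC -rtocM_Im mulrC.
Qed.

Lemma mu_square_integrableE (F : CC R -> CC R) :
  Cmeasurable (annulus I) (fun u => F (of_plane u)) ->
  mu_square_integrable r alpha beta F <-> wsqint r om F.
Proof.
move=> mF; have mh : measurable_fun (annulus I)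
    (fun u : plane => modulus (F (of_plane u)) ^+ 2 * om (qsq u)).
  by apply: measurable_funM => //; apply: measurable_funX; exact: measurable_modulus.
have E : (\int[leb2]_(u in disc_plane)
    (modulus (F (of_plane u)) ^+ 2 * mu_density r alpha beta (of_plane u))%:E =
    \int[leb2]_(u in annulus I) `|(modulus (F (of_plane u)) ^+ 2 * om (qsq u))%:E|)%E.
  transitivity (\int[leb2]_(u in disc_plane) (modulus (F (of_plane u)) ^+ 2 * om (qsq u))%:E)%E.
    by apply: eq_integral => u _; rewrite density_of_plane.
  rewrite integral_disc; last exact/measurable_EFinP.
  apply: eq_integral => u; rewrite inE => Iu; congr EFin; rewrite ger0_norm//.
  rewrite mulr_ge0 ?sqr_ge0//; move: Iu; rewrite /annulus /I /= in_itv/= => /andP[h1 h2].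
  exact: ltW (radial_density_gt0 h1 h2).
rewrite /mu_square_integrable -/leb2 -/disc_plane [X in (X < _)%E]E.
split; first by move=> h; apply/integrableP; split => //; exact/measurable_EFinP.
by move=> /integrableP[].
Qed.

Let Cmeasurable_eq_laurent_sum f b : growth r b ->
  (forall z, pdisc r z -> f z = laurent_sum b z) ->
  Cmeasurable (annulus I) (fun u => f (of_plane u)).
Proof.
move=> gb fb; have := Cmeasurable_laurent_sum r_gt0 gb mI (@subset_refl _ I).
apply: eq_Cmeasurable => u Iu; rewrite fb//; exact: annulus_pdisc r_gt0 (@subset_refl _ I) Iu.
Qed.

Lemma square_integrable_laurent_sum f b : growth r b ->
  (forall z, pdisc r z -> f z = laurent_sum b z) ->
  mu_square_integrable r alpha beta f <-> wsqint r om (laurent_sum b).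
Proof.
move=> gb fb; have mf := Cmeasurable_eq_laurent_sum gb fb.
apply: (iff_trans (mu_square_integrableE mf)).
by split; apply: eq_integrable => // u; rewrite inE => Iu /=;
   rewrite fb//; exact: annulus_pdisc r_gt0 (@subset_refl _ I) Iu.
Qed.

(** Square integrability at the origin kills the monomials that are not square
    integrable there. *)
Lemma bergman_coef_eq0 f b : growth r b ->
  (forall z, pdisc r z -> f z = laurent_sum b z) -> mu_square_integrable r alpha beta f ->
  forall k : nat, (p <= k)%N -> b (Negz k) = 0.
Proof.
move=> gb fb /(square_integrable_laurent_sum gb fb) sb k pk.
apply: (coef_eq0 r_gt0 radial_density_gt0 radial_density_integrable gb sb).
by apply: exprz_density_divergent; lia.
Qed.

Lemma dominated_square_integrable g kappa (C : R) : growth r kappa ->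
  (forall z, pdisc r z -> g z = laurent_sum kappa z) ->
  (forall N z, pdisc r z -> modulus (series (laurent_term kappa z) N) <= C * modulus z ^ (- p%:Z)) ->
  mu_square_integrable r alpha beta g.
Proof.
move=> gk gkappa kC; apply/(square_integrable_laurent_sum gk gkappa).
have gp := @exprz_density_integrable (- p%:Z) (lexx _).
exact: (wsqint_laurent_sum r_gt0 radial_density_gt0 radial_density_integrable gk gp kC).
Qed.

Lemma bergman_ip_series f g b kappa (C : R) : growth r b -> growth r kappa ->
  (forall z, pdisc r z -> f z = laurent_sum b z) ->
  (forall z, pdisc r z -> g z = laurent_sum kappa z) ->
  mu_square_integrable r alpha beta f ->
  (forall k : nat, (p <= k)%N -> kappa (Negz k) = 0) ->
  (forall N z, pdisc r z -> modulus (series (laurent_term kappa z) N) <= C * modulus z ^ (- p%:Z)) ->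
  series (fun k : nat =>
    b k%:Z * conj (kappa k%:Z) * rtoc (monomial_norm k%:Z) +
    b (Negz k) * conj (kappa (Negz k)) * rtoc (monomial_norm (Negz k))) @ \oo -->
  bergman_ip r alpha beta f g.
Proof.
move=> gb gk fb gkappa /(square_integrable_laurent_sum gb fb) sb k0 kC.
have gp := @exprz_density_integrable (- p%:Z) (lexx _).
have h2 := wint_pairing r_gt0 radial_density_gt0 radial_density_integrable gb sb gk gp k0 kC.
have -> : bergman_ip r alpha beta f g =
    wint om I (fun z => laurent_sum b z * conj (laurent_sum kappa z)); last exact: h2.
rewrite /bergman_ip mu_cintegralE; last first.
  apply: CmeasurableM; first exact: Cmeasurable_eq_laurent_sum gb fb.
  by apply: Cmeasurable_conj; exact: Cmeasurable_eq_laurent_sum gk gkappa.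
apply: eq_Cintegral => u Iu.
by have zr := annulus_pdisc r_gt0 (@subset_refl _ I) Iu; rewrite fb// gkappa.
Qed.

End BergmanMeasure.

(** * Laurent coefficients of holomorphic functions *)
Section LaurentCoefficients.
Context {R : realType}.
Implicit Types (r s t : R) (z : CC R) (a b kappa : int -> CC R) (f : CC R -> CC R) (m p : nat).

Lemma laurent_expansion_laurent_sum r a f : laurent_expansion r f a ->
  forall z, pdisc r z -> f z = laurent_sum a z.
Proof.
move=> fa z zr; have ga := laurent_expansion_growth fa.
have /pdiscP[z0 z1] := zr; have [s [t [cs ct ->]]] := fa z zr.
rewrite (laurent_sum_split ga z0 z1).
by rewrite (cvg_lim (@norm_hausdorff _ (CC R)) cs) (cvg_lim (@norm_hausdorff _ (CC R)) ct).
Qed.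

Lemma laurent_coefP r f : 0 < r -> holomorphic_on (pdisc r) f ->
  growth r (laurent_coef r f) /\
  forall z, pdisc r z -> f z = laurent_sum (laurent_coef r f) z.
Proof.
move=> r0 hf; have [ga fa] := laurent_sum_integral r0 hf.
have ex : laurent_expansion r f (laurent_coef r f).
  by apply: xgetPex; exists (laurent_integral r f); exact: laurent_expansion_sum ga fa.
by split; [exact: laurent_expansion_growth ex|exact: laurent_expansion_laurent_sum ex].
Qed.

Lemma growth_le r a b : growth r a -> (forall n, modulus (b n) <= modulus (a n)) -> growth r b.
Proof.
move=> ga ba x x0 xr; have [C aC] := ga x x0 xr; exists C => n.
by apply: le_trans (aC n); rewrite ler_wpM2r// exprz_ge0// ltW.
Qed.

Lemma laurent_sumB r a b z : growth r a -> growth r b -> growth r (fun n => a n - b n) ->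
  z != 0 -> modulus z < r ->
  laurent_sum (fun n => a n - b n) z = laurent_sum a z - laurent_sum b z.
Proof.
move=> ga gb gab z0 zr; have [_ _ ca] := growth_cvg ga z0 zr.
have [_ _ cb] := growth_cvg gb z0 zr; have [_ _ cab] := growth_cvg gab z0 zr.
have E : series (laurent_term (fun n => a n - b n) z) =
    (fun N => series (laurent_term a z) N - series (laurent_term b z) N).
  apply/funext => N; rewrite /series/= -sumrB; apply: eq_bigr => k _.
  by rewrite /laurent_term; ring.
rewrite E in cab; exact: (cvg_unique (@norm_hausdorff _ (CC R)) cab (cvgB ca cb)).
Qed.

Definition low_part m a (n : int) : CC R :=
  if n is Posz k then (if (k < m)%N then a n else 0) else 0.

Definition high_part m a (n : int) : CC R := a n - low_part m a n.

Lemma growth_low_part r m a : growth r a -> growth r (low_part m a).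
Proof.
move=> ga; apply: (growth_le ga) => -[k|k] /=; last by rewrite modulus0 modulus_ge0.
by case: ifP => // _; rewrite modulus0 modulus_ge0.
Qed.

Lemma growth_high_part r m a : growth r a -> growth r (high_part m a).
Proof.
move=> ga; apply: (growth_le ga) => -[k|k]; rewrite /high_part /=; last by rewrite subr0.
by case: ifP => _; rewrite ?subr0 ?subrr ?modulus0 ?modulus_ge0.
Qed.

Lemma laurent_sum_low_part m a z :
  laurent_sum (low_part m a) z = \sum_(n < m) a n%:Z * z ^+ n.
Proof.
apply: (cvg_lim (@norm_hausdorff _ (CC R))); apply: cvg_near_cst.
exists m => // N /= mN; rewrite /series/= big_mkord.
rewrite (eq_bigr (fun n : 'I_N => if (n < m)%N then a n%:Z * z ^+ n else 0)); last first.
  move=> n _; rewrite /laurent_term /= mul0r addr0.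
  by case: ifP => // _; rewrite mul0r.
rewrite -big_mkcond/= (big_ord_widen _ (fun n => a n%:Z * z ^+ n) mN).
by [].
Qed.

(** The coefficient of the [m]-th derivative of [z^n], that is
    [n (n - 1) ... (n - m + 1)]. *)
Definition falling m (n : int) : R := \prod_(i < m) (n - i%:Z)%:~R.

Lemma iter_laurent_deriv m a (n : int) :
  iter m laurent_deriv a n = rtoc (falling m (n + m%:Z)) * a (n + m%:Z).
Proof.
elim: m n => [|m ih] n; first by rewrite /falling big_ord0 rmorph1 mul1r addr0.
rewrite iterS /laurent_deriv ih /falling big_ord_recr/= rmorphM/= rmorph_int.
have -> : n + 1 + m%:Z = n + m.+1%:Z by rewrite -addn1 PoszD; ring.
have -> : n + m.+1%:Z - m%:Z = n + 1 by rewrite -addn1 PoszD; ring.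
by ring.
Qed.

(** The degrees killed by the [m]-th derivative are those of the Taylor part. *)
Lemma falling_eq0 m (n : int) : (falling m n == 0) = (0 <= n < m%:Z).
Proof.
apply/idP/idP => [|/andP[n0 nm]].
  move=> /prodf_eq0 [i _]; rewrite intr_eq0 subr_eq0 => /eqP ->.
  by rewrite lez_nat ltz_nat ltn_ord.
case: n n0 nm => // n _; rewrite ltz_nat => nm; apply/prodf_eq0.
by exists (Ordinal nm) => //=; rewrite subrr.
Qed.

Lemma falling_nat m j : falling m (j + m)%:Z * j`!%:R = (j + m)`!%:R.
Proof.
elim: m => [|m ih]; first by rewrite /falling big_ord0 mul1r addn0.
rewrite addnS factS natrM -ih /falling big_ord_recl/= subr0 [RHS]mulrA; congr (_ * _ * _).
apply: eq_bigr => i _; rewrite /bump/=; congr (_%:~R); lia.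
Qed.

(** The square removes the sign [(- 1)^m]. *)
Lemma falling_neg m k : falling m (Negz k) ^+ 2 * k`!%:R ^+ 2 = (m + k)`!%:R ^+ 2.
Proof.
elim: m => [|m ih]; first by rewrite /falling big_ord0 expr1n mul1r.
rewrite addSn factS natrM [RHS]exprMn -ih /falling big_ord_recr/= [in LHS]exprMn.
have -> : (Negz k - m%:Z)%:~R ^+ 2 = (m + k).+1%:R ^+ 2 :> R.
  by rewrite -sqrrN -rmorphN; congr (_ ^+ 2); rewrite -[RHS]/((m + k).+1%:Z%:~R); congr (_%:~R); lia.
by ring.
Qed.

Lemma falling_nat_ge1 m j : 1 <= falling m (j + m)%:Z.
Proof.
have j0 : 0 < j`!%:R :> R by rewrite ltr0n fact_gt0.
rewrite -(ler_pM2r j0) mul1r falling_nat ler_nat.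
elim: m => [|m ih]; first by rewrite addn0.
by rewrite addnS factS (leq_trans ih)// leq_pmull.
Qed.

Lemma growth_bounded r a p (C : R) : 0 < r ->
  (forall k : nat, modulus (a k%:Z) * r ^+ k <= C) ->
  (forall k : nat, (p <= k)%N -> a (Negz k) = 0) -> growth r a.
Proof.
move=> r0 aC a0 x x0 xr.
pose S := \sum_(k < p) modulus (a (Negz k)) * x ^ Negz k.
have S0 : 0 <= S.
  by apply: sumr_ge0 => k _; rewrite mulr_ge0 ?modulus_ge0// exprz_ge0// ltW.
have C0 : 0 <= C by apply: le_trans (aC 0%N); rewrite mulr_ge0 ?modulus_ge0.
exists (C + S) => -[k|k].
  apply: (@le_trans _ _ C); last by rewrite lerDl.
  apply: le_trans (aC k); rewrite ler_wpM2l ?modulus_ge0//.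
  by apply: lerXn2r; rewrite ?nnegrE ltW.
have [pk|kp] := leqP p k; first by rewrite a0// modulus0 mul0r addr_ge0.
apply: (@le_trans _ _ S); last by rewrite lerDr.
rewrite /S (bigD1 (Ordinal kp))//= lerDl; apply: sumr_ge0 => i _.
by rewrite mulr_ge0 ?modulus_ge0// exprz_ge0// ltW.
Qed.

(** After multiplication by [|z|^p] no negative degree is left, and the terms are
    bounded by their values on the boundary circle. *)
Lemma laurent_partial_sum_le r kappa p (C q : R) : 0 < r -> 0 <= q -> q < 1 ->
  (forall k : nat, modulus (kappa k%:Z) * r ^+ k <= C * q ^+ k) ->
  (forall k : nat, (p <= k)%N -> kappa (Negz k) = 0) ->
  exists M : R, forall N z, pdisc r z ->
    modulus (series (laurent_term kappa z) N) <= M * modulus z ^ (- p%:Z).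
Proof.
move=> r0 q0 q1 kC k0; have C0 : 0 <= C.
  by have := kC 0%N; rewrite !expr0 !mulr1; apply: le_trans; exact: modulus_ge0.
pose S := \sum_(k < p) modulus (kappa (Negz k)) * r ^+ (p - k.+1).
exists (C / (1 - q) * r ^+ p + S) => N z /pdiscP[z0 zr].
have m0 : 0 < modulus z by rewrite modulus_gt0.
rewrite -invr_expz ler_pdivlMr ?exprn_gt0// -exprnP.
have t1 : \sum_(k < N) modulus (kappa k%:Z) * modulus z ^+ k <= C / (1 - q).
  apply: (@le_trans _ _ (\sum_(k < N) C * q ^+ k)).
    apply: ler_sum => k _; apply: le_trans (kC k).
    rewrite ler_wpM2l ?modulus_ge0//.
    by apply: lerXn2r; rewrite ?nnegrE ltW.
  by rewrite -mulr_sumr ler_wpM2l//; exact: geometric_sum_le.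
pose T (k : nat) := modulus (kappa (Negz k)) * r ^+ (p - k.+1).
have T0 k : 0 <= T k by rewrite mulr_ge0 ?modulus_ge0 ?exprn_ge0 ?(ltW r0).
have t2 : \sum_(k < N) modulus (kappa (Negz k)) * modulus z ^ Negz k * modulus z ^+ p <= S.
  apply: (@le_trans _ _ (\sum_(0 <= k < N) T k)).
    rewrite big_mkord; apply: ler_sum => k _.
    have [pk|kp] := leqP p k; first by rewrite k0// modulus0 !mul0r.
    rewrite -mulrA /T ler_wpM2l ?modulus_ge0// exprnP -expfzDr ?gt_eqF//.
    have -> : Negz k + p%:Z = (p - k.+1)%N%:Z by clear -kp; lia.
    by apply: lerXn2r; rewrite ?nnegrE ltW.
  apply: (@le_trans _ _ (\sum_(0 <= k < p + N) T k)).
    rewrite [leRHS](big_cat_nat (n := N))//= ?leq_addl// lerDl.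
    by apply: sumr_ge0.
  rewrite (big_cat_nat (n := p))//= ?leq_addr// [X in _ + X]big_nat_cond [X in _ + X]big1.
    by rewrite addr0 big_mkord.
  by move=> k /andP[/andP[pk _] _]; rewrite /T k0// modulus0 mul0r.
apply: (@le_trans _ _ ((\sum_(k < N) modulus (kappa k%:Z) * modulus z ^+ k) * modulus z ^+ p +
   \sum_(k < N) modulus (kappa (Negz k)) * modulus z ^ Negz k * modulus z ^+ p)).
  rewrite -mulr_suml -mulrDl ler_wpM2r ?exprn_ge0 ?modulus_ge0//.
  rewrite /series/= big_mkord (le_trans (le_modulus_sum _ _ _))// -big_split/=.
  apply: ler_sum => k _; rewrite (le_trans (le_modulusD _ _))//.
  by rewrite !modulusM !modulusXz.
apply: lerD t2; apply: ler_pM => //.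
- by apply: sumr_ge0 => k _; rewrite mulr_ge0 ?modulus_ge0// exprn_ge0 ?modulus_ge0.
- by rewrite exprn_ge0 ?modulus_ge0.
- by apply: lerXn2r; rewrite ?nnegrE ltW.
Qed.

(** From the index [N] on, [u k / q^k] does not increase. *)
Lemma geometric_of_ratio (u : nat -> R) (q : R) (N : nat) : 0 < q -> (forall k, 0 <= u k) ->
  (forall k, (N <= k)%N -> u k.+1 <= q * u k) -> exists C : R, forall k, u k <= C * q ^+ k.
Proof.
move=> q0 u0 uS; pose C := \sum_(i < N.+1) u i / q ^+ i.
have C0 k : (k <= N)%N -> u k <= C * q ^+ k.
  move=> kN; rewrite -ler_pdivrMr ?exprn_gt0// /C (bigD1 (Ordinal (kN : k < N.+1)%N))//=.
  by rewrite lerDl; apply: sumr_ge0 => i _; rewrite divr_ge0// exprn_ge0// ltW.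
exists C; elim=> [|k ih]; first exact: C0.
have [kN|Nk] := ltnP k N; first exact: C0.
by rewrite (le_trans (uS k Nk))// exprS mulrCA ler_pM2l.
Qed.

(** The conjugates of the Laurent coefficients of the kernel at [w] are the
    numbers [w^n] divided by the squared norms of the monomials [z^n]: the norm
    is that of [z^n] itself in degrees 0 to [m - 1], and that of the [m]-th
    derivative in the other degrees. *)
Definition kernel_coef m p (c : int -> R) (w : CC R) (n : int) : CC R :=
  if 0 <= n < m%:Z then conj (w ^ n) / rtoc (c n)
  else if - p%:Z <= n - m%:Z then
    conj (w ^ n) / rtoc (falling m n ^+ 2 * c (n - m%:Z))
  else 0.

End LaurentCoefficients.

(** * The reproducing property *)
Section ReproducingKernel.
Context {R : realType}.
Implicit Types (z w : CC R) (a b kappa : int -> CC R) (f K : CC R -> CC R).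
Context (r alpha beta0 beta : R) (m p : nat) (r_gt0 : 0 < r) (alpha_gtN1 : - 1 < alpha)
  (beta0_gtN1 : - 1 < beta0) (beta0_le0 : beta0 <= 0) (beta_def : beta = beta0 + p%:R).

Let c := monomial_norm r alpha beta.

Let c_gt0 (n : int) : - p%:Z <= n -> 0 < c n.
Proof. exact: (monomial_norm_gt0 r_gt0 alpha_gtN1 beta0_gtN1 beta_def). Qed.

Let negp_le (n : nat) : - p%:Z <= n%:Z.
Proof. by rewrite (@le_trans _ _ 0) ?oppr_le0. Qed.

Let c_gt0_nat (n : nat) : 0 < c n%:Z.
Proof. exact/c_gt0/negp_le. Qed.

(** The squared norms of consecutive monomials have a ratio tending to [r^2], so
    the terms decay with any ratio larger than [|w| / r]. *)
Let w_bound w : pdisc r w -> exists C q : R, [/\ 0 <= C, 0 <= q, q < 1 &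
  forall k : nat, modulus w ^+ k * r ^+ k / c k%:Z <= C * q ^+ k].
Proof.
move=> /pdiscP[w0 wr]; have r0 := r_gt0; have al := alpha_gtN1.
have be : -1 < beta.
  have h := beta0_gtN1; have p0 : 0 <= p%:R :> R by [].
  by rewrite beta_def; lra.
pose t := modulus w / r; have t0 : 0 < t by rewrite divr_gt0// modulus_gt0.
have t1 : t < 1 by rewrite ltr_pdivrMr// mul1r.
pose q := (1 + t) / 2; have q0 : 0 < q by rewrite /q; lra.
have q1 : q < 1 by rewrite /q; lra.
have qt : 0 < q - t by rewrite /q; lra.
have [N _ NP] := nbhs_infty_gtr ((t * (alpha + beta + 2) - q * (beta + 1)) / (q - t)).
have u0 k : 0 <= modulus w ^+ k * r ^+ k / c k%:Z.
  apply: divr_ge0; last exact/ltW/c_gt0_nat.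
  by apply: mulr_ge0; apply: exprn_ge0; [exact: modulus_ge0|exact: ltW].
have uS k : (N <= k)%N -> modulus w ^+ k.+1 * r ^+ k.+1 / c k.+1%:Z <=
    q * (modulus w ^+ k * r ^+ k / c k%:Z).
  move=> Nk; have := NP k Nk; rewrite /= ltr_pdivrMr// => h.
  have pk := negp_le k.
  have := monomial_normS r_gt0 alpha_gtN1 beta0_gtN1 beta0_le0 beta_def pk.
  rewrite -/c -[k%:Z + 1]/((k + 1)%N%:Z) addn1 -[k%:~R]/(k%:R : R).
  have ck := c_gt0_nat k; have ck1 := c_gt0_nat k.+1.
  have k0 : 0 <= k%:R :> R by [].
  move: (c k%:Z) (c k.+1%:Z) ck ck1 => x y x0 y0 e.
  have a0 : 0 < alpha + beta + k%:R + 2 by lra.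
  have b0 : 0 < beta + k%:R + 1 by lra.
  have ey : y = (beta + k%:R + 1) * r ^+ 2 * x / (alpha + beta + k%:R + 2).
    by apply: (mulfI (lt0r_neq0 a0)); rewrite e; field; rewrite gt_eqF.
  rewrite ey (exprS (modulus w) k) (exprS r k).
  have -> : modulus w = t * r by rewrite /t divfK// gt_eqF.
  have wk : 0 <= (t * r) ^+ k * r ^+ k / x.
    have tr0 : 0 <= t * r by rewrite mulr_ge0// ltW.
    by rewrite divr_ge0 ?(ltW x0)// mulr_ge0// exprn_ge0// ltW.
  have -> : t * r * (t * r) ^+ k * (r * r ^+ k) /
      ((beta + k%:R + 1) * r ^+ 2 * x / (alpha + beta + k%:R + 2)) =
      (t * (alpha + beta + k%:R + 2) / (beta + k%:R + 1)) * ((t * r) ^+ k * r ^+ k / x).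
    move: ((t * r) ^+ k) (r ^+ k) => A B; field.
    by rewrite !gt_eqF.
  by rewrite ler_wpM2r// ler_pdivrMr//; lra.
have [C hC] := @geometric_of_ratio R (fun k => modulus w ^+ k * r ^+ k / c k%:Z) q N q0 u0 uS.
exists C, q; split => //; last exact: ltW.
by have := le_trans (u0 0%N) (hC 0%N); rewrite expr0 mulr1.
Qed.

Let kc := kernel_coef m p c.

Let kc_neg w k : (p <= k)%N -> kc w (Negz k) = 0.
Proof.
move=> pk; rewrite /kc /kernel_coef (_ : (0 <= Negz k < m%:Z) = false)//.
by rewrite ifF//; apply/negP; lia.
Qed.

Let kc_high w (j : nat) : kc w (j + m)%N%:Z =
  conj (w ^+ (j + m)) / rtoc (falling m (j + m)%N%:Z ^+ 2 * c j%:Z).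
Proof.
rewrite /kc /kernel_coef ifF; last by apply/negP; lia.
have e : (j + m)%N%:Z - m%:Z = j%:Z by lia.
by rewrite e ifT//; lia.
Qed.

Let kc_low w (j : nat) : (j < m)%N -> kc w j%:Z = conj (w ^+ j) / rtoc (c j%:Z).
Proof. by move=> jm; rewrite /kc /kernel_coef ifT//; apply/andP; split; lia. Qed.

Let conj_div z (x : R) : conj (z / rtoc x) = conj z / rtoc x.
Proof.
have -> : (rtoc x)^-1 = rtoc x^-1 by rewrite fmorphV.
by rewrite rmorphM; congr (_ * _); exact: conj_rtoc.
Qed.

Let modulus_rtocV (x : R) : 0 < x -> modulus (rtoc x)^-1 = x^-1.
Proof. by move=> x0; rewrite modulusV modulus_rtoc gtr0_norm. Qed.

Lemma growth_kernel_coef w : pdisc r w -> growth r (kernel_coef m p c w).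
Proof.
rewrite -/(kc w) => wr; have [C [q [C0 q0 q1 hC]]] := w_bound wr.
have hC1 k : modulus w ^+ k * r ^+ k / c k%:Z <= C.
  by apply: le_trans (hC k) _; rewrite ler_piMr// exprn_ile1// ltW.
pose D := modulus w ^+ m * r ^+ m.
have D0 : 0 <= D by rewrite mulr_ge0 ?exprn_ge0 ?modulus_ge0 ?(ltW r_gt0).
apply: (@growth_bounded _ _ _ p (C + D * C) r_gt0) => [k|k]; last exact: kc_neg.
have [km|mk] := ltnP k m.
  rewrite kc_low// modulusM modulus_conj modulusX modulus_rtocV ?c_gt0_nat//.
  by rewrite mulrAC (le_trans (hC1 k))// lerDl mulr_ge0.
rewrite -(subnK mk) kc_high; move: (k - m)%N => j.
have f1 := falling_nat_ge1 (R := R) m j; have f2 : 1 <= falling m (j + m)%N%:Z ^+ 2 :> R.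
  by rewrite exprn_ege1.
have cj := c_gt0_nat j.
rewrite modulusM modulus_conj modulusX modulus_rtocV; last by rewrite mulr_gt0// (lt_le_trans ltr01).
apply: (@le_trans _ _ (D * C)); last by rewrite lerDr.
apply: (@le_trans _ _ (D * (modulus w ^+ j * r ^+ j / c j%:Z))); last by rewrite ler_wpM2l.
have -> : D * (modulus w ^+ j * r ^+ j / c j%:Z) =
    modulus w ^+ (j + m) * r ^+ (j + m) * (c j%:Z)^-1 by rewrite /D !exprD; ring.
rewrite mulrAC ler_wpM2l ?mulr_ge0 ?exprn_ge0 ?modulus_ge0 ?(ltW r_gt0)//.
have f3 := lt_le_trans ltr01 f2.
by rewrite lef_pV2 ?posrE ?(mulr_gt0 f3 cj)// ler_peMl// ltW.
Qed.

Let kd w := iter m laurent_deriv (kc w).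

Let kdE w (n : int) : - p%:Z <= n -> falling m (n + m%:Z) != 0 :> R ->
  kd w n = conj (w ^ (n + m%:Z)) / rtoc (falling m (n + m%:Z) * c n).
Proof.
move=> pn f0; rewrite /kd iter_laurent_deriv /kc /kernel_coef.
rewrite -(falling_eq0 (R := R)) (negbTE f0) addrK pn; move: (c n) (c_gt0 pn) => cn cn0; rewrite !rmorphM/=.
have g0 : rtoc (falling m (n + m%:Z)) != 0 :> CC R by rewrite rtoc_eq0.
have h0 : rtoc cn != 0 by rewrite rtoc_eq0 gt_eqF.
by field; rewrite g0 h0.
Qed.

Let kd_eq0 w (n : int) : n < - p%:Z -> kd w n = 0.
Proof.
move=> np; rewrite /kd iter_laurent_deriv /kc /kernel_coef.
have [f0|f0] := eqVneq (falling m (n + m%:Z) : R) 0; first by rewrite f0 rmorph0 mul0r.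
by rewrite -(falling_eq0 (R := R)) (negbTE f0) addrK leNgt np mulr0.
Qed.

(** The domination that allows pairing with the [m]-th derivative of the
    kernel. *)
Let kd_bound w : pdisc r w -> exists M : R, forall N z, pdisc r z ->
  modulus (series (laurent_term (kd w) z) N) <= M * modulus z ^ (- p%:Z).
Proof.
move=> wr; have [C [q [C0 q0 q1 hC]]] := w_bound wr.
apply: (@laurent_partial_sum_le _ _ _ _ (modulus w ^+ m * C) q r_gt0 q0 q1) => k; last first.
  by move=> pk; apply: kd_eq0; lia.
have f1 := falling_nat_ge1 (R := R) m k.
have f0 : 0 < falling m (k + m)%N%:Z :> R by apply: lt_le_trans f1.
have ck := c_gt0_nat k.
rewrite kdE; [|exact: negp_le|by rewrite gt_eqF].
rewrite modulusM modulus_conj modulusXz modulus_rtocV ?(mulr_gt0 f0 ck)//.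
rewrite -mulrA; apply: (@le_trans _ _ (modulus w ^+ m * (modulus w ^+ k * r ^+ k / c k%:Z))).
  rewrite -[modulus w ^ _]/(modulus w ^+ (k + m)) exprD.
  have -> : modulus w ^+ m * (modulus w ^+ k * r ^+ k / c k%:Z) =
      modulus w ^+ k * modulus w ^+ m * ((c k%:Z)^-1 * r ^+ k) by ring.
  rewrite ler_wpM2l ?mulr_ge0 ?exprn_ge0 ?modulus_ge0// ler_wpM2r ?exprn_ge0 ?(ltW r_gt0)//.
  by rewrite lef_pV2 ?posrE ?(mulr_gt0 f0 ck)// ler_peMl// ltW.
by rewrite -[leRHS]mulrA ler_wpM2l ?exprn_ge0 ?modulus_ge0.
Qed.

(** A polynomial of degree less than [m] is trivially a geometric series of
    ratio [1 / 2], up to the constant. *)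
Let finite_bound a : exists M : R, forall N z, pdisc r z ->
  modulus (series (laurent_term (low_part m a) z) N) <= M * modulus z ^ (- p%:Z).
Proof.
have h2 : 0 < 2^-1 :> R by rewrite invr_gt0.
pose C := \sum_(k < m) modulus (a k%:Z) * r ^+ k * 2 ^+ k.
have C0 : 0 <= C.
  by apply: sumr_ge0 => k _; rewrite !mulr_ge0 ?modulus_ge0 ?exprn_ge0 ?(ltW r_gt0).
apply: (@laurent_partial_sum_le _ _ _ _ C 2^-1 r_gt0 (ltW h2)).
- by rewrite invf_lt1// ltr1n.
- move=> k /=; case: ifP => [km|_]; last first.
    by rewrite modulus0 mul0r mulr_ge0// exprn_ge0// ltW.
  rewrite exprVn ler_pdivlMr ?exprn_gt0// /C (bigD1 (Ordinal km))//= lerDl.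
  by apply: sumr_ge0 => i _; rewrite !mulr_ge0 ?modulus_ge0 ?exprn_ge0 ?(ltW r_gt0).
- by [].
Qed.

Let low_neg a k : (p <= k)%N -> low_part m a (Negz k) = 0.
Proof. by []. Qed.

Let mu_sq_low a f : growth r a ->
  (forall z, pdisc r z -> f z = laurent_sum (low_part m a) z) ->
  mu_square_integrable r alpha beta f.
Proof.
move=> ga fa; have [M hM] := finite_bound a.
exact: (dominated_square_integrable r_gt0 alpha_gtN1 beta0_gtN1 beta0_le0 beta_def
  (growth_low_part m ga) fa hM).
Qed.

Let iter_high a : iter m laurent_deriv (high_part m a) = iter m laurent_deriv a.
Proof.
apply/funext => n; rewrite !iter_laurent_deriv /high_part.
have [f0|] := eqVneq (falling m (n + m%:Z) : R) 0; first by rewrite f0 !rmorph0 !mul0r.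
rewrite falling_eq0; case: (n + m%:Z) => k //=; last by rewrite subr0.
by rewrite ltz_nat => /negbTE ->; rewrite subr0.
Qed.

Let taylor_laurent f : holomorphic_on (pdisc r) f ->
  forall z, taylor_part r m f z = laurent_sum (low_part m (laurent_coef r f)) z.
Proof. by move=> hf z; rewrite laurent_sum_low_part. Qed.

Let remainder_laurent f : holomorphic_on (pdisc r) f ->
  forall z, pdisc r z ->
    remainder_part r m f z = laurent_sum (high_part m (laurent_coef r f)) z.
Proof.
move=> hf z zr; have [ga fa] := laurent_coefP r_gt0 hf; have /pdiscP[z0 z1] := zr.
rewrite /remainder_part fa// taylor_laurent//.
rewrite -(laurent_sumB ga (growth_low_part m ga) _ z0 z1)//.
exact: (growth_high_part m ga).
Qed.

Let derive_laurent f : holomorphic_on (pdisc r) f ->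
  forall z, pdisc r z ->
    derive1n m f z = laurent_sum (iter m laurent_deriv (laurent_coef r f)) z.
Proof.
move=> hf; have [ga fa] := laurent_coefP r_gt0 hf.
exact: derive1n_laurent_sum ga fa.
Qed.

Let derive_remainder_laurent f : holomorphic_on (pdisc r) f ->
  forall z, pdisc r z ->
    derive1n m (remainder_part r m f) z =
    laurent_sum (iter m laurent_deriv (laurent_coef r f)) z.
Proof.
move=> hf; have [ga fa] := laurent_coefP r_gt0 hf; rewrite -iter_high.
exact: derive1n_laurent_sum (growth_high_part m ga) (remainder_laurent hf).
Qed.

Lemma kernel_in_bergman_dirichlet w K : pdisc r w ->
  (forall z, pdisc r z -> K z = laurent_sum (kernel_coef m p c w) z) ->
  bergman_dirichlet r m alpha beta K.
Proof.
move=> wr Kk; have gk := growth_kernel_coef wr.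
have hK : holomorphic_on (pdisc r) K by exact: holomorphic_laurent_sum gk Kk.
have dK := derive1n_laurent_sum m gk Kk; have gd := growth_iter_deriv m gk.
split; first exact: hK.
split; first exact: holomorphic_laurent_sum gd dK.
have [M hM] := kd_bound wr.
exact: (dominated_square_integrable r_gt0 alpha_gtN1 beta0_gtN1 beta0_le0 beta_def gd dK hM).
Qed.

Let laurent_coef_unique a f : growth r a -> (forall z, pdisc r z -> f z = laurent_sum a z) ->
  laurent_coef r f = a.
Proof.
move=> ga fa; have hf := holomorphic_laurent_sum ga fa.
have [gc fc] := laurent_coefP r_gt0 hf; apply/funext => n.
have gp := radial_density_gt0 r_gt0 alpha_gtN1 beta0_gtN1 beta_def.
have gi := radial_density_integrable r_gt0 alpha_gtN1 beta0_gtN1 beta0_le0 beta_def.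
apply: (laurent_sum_inj r_gt0 gp gi gc ga _ n).
by move=> z zr; rewrite -fc// fa.
Qed.

Let taylor_ip w K f : pdisc r w -> holomorphic_on (pdisc r) f ->
  (forall z, pdisc r z -> K z = laurent_sum (kernel_coef m p c w) z) ->
  bergman_ip r alpha beta (taylor_part r m f) (taylor_part r m K) =
  \sum_(n < m) laurent_coef r f n%:Z * w ^+ n.
Proof.
move=> wr hf Kk; have gk := growth_kernel_coef wr.
have hK : holomorphic_on (pdisc r) K by exact: holomorphic_laurent_sum gk Kk.
have ck := laurent_coef_unique gk Kk; have [ga fa] := laurent_coefP r_gt0 hf.
have tf z (_ : pdisc r z) := taylor_laurent hf z.
have tK z (_ : pdisc r z) := taylor_laurent hK z.
have [M hM] := finite_bound (laurent_coef r K).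
have gK : growth r (laurent_coef r K) by rewrite ck.
have h := bergman_ip_series r_gt0 alpha_gtN1 beta0_gtN1 beta0_le0 beta_def
  (growth_low_part m ga) (growth_low_part m gK) tf tK (mu_sq_low ga tf)
  (@low_neg (laurent_coef r K)) hM.
apply: (cvg_unique (@norm_hausdorff _ (CC R)) h); apply: cvg_near_cst.
exists m => // N /= mN; rewrite /series/= big_mkord.
rewrite (eq_bigr (fun n : 'I_N => if (n < m)%N then laurent_coef r f n%:Z * w ^+ n else 0)).
  by rewrite -big_mkcond/= (big_ord_widen _ (fun n => laurent_coef r f n%:Z * w ^+ n) mN).
move=> n _; rewrite !mul0r addr0; case: ifP => nm; last by rewrite !mul0r.
rewrite ck -/(kc w n%:Z) kc_low// conj_div conjK -/c.
by rewrite mulrA divfK// rtoc_eq0 gt_eqF.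
Qed.

(** The kernel coefficients are chosen so that the factors [falling m] and the
    squared norm cancel. Where the kernel has no such coefficient, the right-hand
    side vanishes as well: either the degree belongs to the Taylor part, or a
    nonzero coefficient would make the derivative of [f] fail to be square
    integrable. *)
Let coef_pairing w f (n : int) : w != 0 -> bergman_dirichlet r m alpha beta f ->
  iter m laurent_deriv (laurent_coef r f) n * conj (kd w n) * rtoc (c n) =
  high_part m (laurent_coef r f) (n + m%:Z) * w ^ (n + m%:Z).
Proof.
move=> w0 [hf [hd sf]]; have [ga fa] := laurent_coefP r_gt0 hf.
set a := laurent_coef r f in ga fa *.
have b0 : n < - p%:Z -> iter m laurent_deriv a n = 0.
  move=> np; have dl := derive_laurent hf.
  have h := bergman_coef_eq0 r_gt0 alpha_gtN1 beta0_gtN1 beta0_le0 beta_def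
    (growth_iter_deriv m ga) dl sf.
  by case: n np => k; [lia|move=> kp; apply: h; lia].
rewrite -iter_high iter_laurent_deriv in b0 *.
have [f0|f0] := eqVneq (falling m (n + m%:Z) : R) 0.
  have -> : high_part m a (n + m%:Z) = 0.
    move/eqP: f0; rewrite falling_eq0 /high_part; case: (n + m%:Z) => k //=.
    by rewrite ltz_nat => ->; rewrite subrr.
  by rewrite mulr0 !mul0r.
have [np|pn] := ltP n (- p%:Z).
  have /eqP := b0 np; rewrite mulf_eq0 rtoc_eq0 (negbTE f0)/= => /eqP ->.
  by rewrite mulr0 !mul0r.
rewrite kdE// conj_div conjK.
have c1 : rtoc (falling m (n + m%:Z)) != 0 :> CC R by rewrite rtoc_eq0.
move: (c n) (c_gt0 pn) => cn cn0.
have c2 : rtoc cn != 0 by rewrite rtoc_eq0 gt_eqF.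
by rewrite rmorphM/=; field; rewrite c1 c2.
Qed.

(** The pairing of the derivatives sums the expansion of [f] at [w] without its
    Taylor part. *)
Let derivative_ip w K f : pdisc r w -> bergman_dirichlet r m alpha beta f ->
  (forall z, pdisc r z -> K z = laurent_sum (kernel_coef m p c w) z) ->
  f w = (\sum_(n < m) laurent_coef r f n%:Z * w ^+ n) +
   bergman_ip r alpha beta (derive1n m (remainder_part r m f))
     (derive1n m (remainder_part r m K)).
Proof.
move=> wr Hf Kk; have gk := growth_kernel_coef wr; have /pdiscP[w0 w1] := wr.
have hK : holomorphic_on (pdisc r) K by exact: holomorphic_laurent_sum gk Kk.
have ck := laurent_coef_unique gk Kk; have [hf [_ sf]] := Hf.
have [ga fa] := laurent_coefP r_gt0 hf.
have df := derive_remainder_laurent hf; have dK := derive_remainder_laurent hK.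
have [M hM] := kd_bound wr; rewrite ck in dK.
have sr : mu_square_integrable r alpha beta (derive1n m (remainder_part r m f)).
  apply/(square_integrable_laurent_sum r_gt0 alpha_gtN1 beta0_gtN1 beta0_le0 beta_def
    (growth_iter_deriv m ga) df).
  exact/(square_integrable_laurent_sum r_gt0 alpha_gtN1 beta0_gtN1 beta0_le0 beta_def
    (growth_iter_deriv m ga) (derive_laurent hf)).
have k0 k : (p <= k)%N -> kd w (Negz k) = 0 by move=> pk; apply: kd_eq0; lia.
have h := bergman_ip_series r_gt0 alpha_gtN1 beta0_gtN1 beta0_le0 beta_def
  (growth_iter_deriv m ga) (growth_iter_deriv m gk) df dK sr k0 hM.
set a := laurent_coef r f in ga fa df sr h *.
have E N : series (fun k : nat =>
     iter m laurent_deriv a k%:Z * conj (iter m laurent_deriv (kc w) k%:Z) *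
       rtoc (monomial_norm r alpha beta k%:Z) +
     iter m laurent_deriv a (Negz k) * conj (iter m laurent_deriv (kc w) (Negz k)) *
       rtoc (monomial_norm r alpha beta (Negz k))) N =
   \sum_(k < N) (high_part m a (k%:Z + m%:Z) * w ^ (k%:Z + m%:Z) +
     high_part m a (Negz k + m%:Z) * w ^ (Negz k + m%:Z)).
  rewrite /series/= big_mkord; apply: eq_bigr => k _.
  by rewrite -/c -/(kd w) !coef_pairing.
rewrite (funext E) in h.
pose S1 := series (fun k : nat => a k%:Z * w ^ k%:Z).
pose S2 := series (fun k : nat => a (Negz k) * w ^ Negz k).
have [c1 c2 _] := growth_cvg ga w0 w1.
have hN (k : nat) : high_part m a (k%:Z + m%:Z) = a (k + m)%N%:Z.
  by rewrite -PoszD /high_part /= ifF ?subr0// ltnNge leq_addl.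
(* The grouped series shifts all degrees by m: with M' + m groups it covers the
   degrees up to M' + 2 m - 1 and down to - M'. *)
have E2 M' : \sum_(n < m) a n%:Z * w ^+ n +
   \sum_(k < M' + m) (high_part m a (k%:Z + m%:Z) * w ^ (k%:Z + m%:Z) +
     high_part m a (Negz k + m%:Z) * w ^ (Negz k + m%:Z)) = S1 (M' + m + m)%N + S2 M'.
  elim: M' => [|j ih].
    have -> : S2 0%N = 0 by rewrite /S2 /series/= big_geq.
    rewrite addr0 add0n /S1 /series/= big_mkord big_split_ord/=; congr (_ + _).
    apply: eq_bigr => k _; rewrite hN -PoszD addnC.
    have -> : high_part m a (Negz k + m%:Z) = 0; last by rewrite mul0r addr0.
    have -> : Negz k + m%:Z = (m - k.+1)%N%:Z by have := ltn_ord k; lia.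
    by rewrite /high_part /= ifT ?subrr//; have := ltn_ord k; lia.
  rewrite addSn big_ord_recr/= addrA ih /S1 /S2 addSn !seriesSr hN.
  have -> : Negz (j + m) + m%:Z = Negz j by lia.
  by rewrite /high_part /= subr0 -PoszD; ring.
have cT : S1 (M' + m + m)%N + S2 M' @[M' --> \oo] --> f w.
  have fw : f w = limn S1 + limn S2 by rewrite (fa w wr) (laurent_sum_split ga w0 w1).
  rewrite fw; apply: cvgD.
    have -> : (fun M' => S1 (M' + m + m)%N) = (fun M' => S1 (M' + (m + m))%N).
      by apply/funext => M'; rewrite addnA.
    by rewrite (cvg_shiftn (m + m) S1); exact: c1.
  exact: c2.
have cS : S1 (M' + m + m)%N + S2 M' @[M' --> \oo] -->
   \sum_(n < m) a n%:Z * w ^+ n + bergman_ip r alpha beta (derive1n m (remainder_part r m f))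
     (derive1n m (remainder_part r m K)).
  rewrite -(funext E2); apply: cvgD; first exact: cvg_cst.
  have := h; rewrite -(cvg_shiftn m); exact: id.
exact: (cvg_unique (@norm_hausdorff _ (CC R)) cT cS).
Qed.

Lemma bergman_dirichlet_reproducing w K f : pdisc r w -> bergman_dirichlet r m alpha beta f ->
  (forall z, pdisc r z -> K z = laurent_sum (kernel_coef m p c w) z) ->
  f w = bergman_dirichlet_ip r m alpha beta f K.
Proof.
move=> wr Hf Kk; rewrite (derivative_ip wr Hf Kk) /bergman_dirichlet_ip.
by rewrite (taylor_ip wr (proj1 Hf) Kk).
Qed.

End ReproducingKernel.

(** * The closed form of the kernel *)
Section KernelProfile.
Context {R : realType}.
Implicit Types (z w xi : CC R).
Context (r alpha beta0 beta : R) (m p : nat) (r_gt0 : 0 < r) (alpha_gtN1 : - 1 < alpha)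
  (beta0_gtN1 : - 1 < beta0) (beta0_le0 : beta0 <= 0) (beta_def : beta = beta0 + p%:R).

Let c := monomial_norm r alpha beta.
Let kc := kernel_coef m p c.
Let A := alpha + beta + 2.
Let B := beta + 1.

Let B_gt0 : 0 < B.
Proof.
have h := beta0_gtN1; have p0 : 0 <= p%:R :> R by [].
by rewrite /B beta_def; lra.
Qed.

Let A_gt0 : 0 < A.
Proof. by have h := B_gt0; have h' := alpha_gtN1; rewrite /A; move: h; rewrite /B; lra. Qed.

Let c_nat (n : nat) : c n%:Z = r ^+ 2 ^+ n * pochhammer B n / pochhammer A n.
Proof. exact: (monomial_norm_nat r_gt0 alpha_gtN1 beta0_gtN1 beta0_le0 beta_def). Qed.

Let pochhammer1 n : pochhammer 1 n = n`!%:R :> R.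
Proof.
elim: n => [|n ih]; first by rewrite /pochhammer big_ord0.
by rewrite pochhammerS ih factS natrM -nat1r mulrC.
Qed.

Let pochhammer_fact k n : pochhammer (k%:R + 1) n * k`!%:R = (n + k)`!%:R :> R.
Proof.
elim: n => [|n ih]; first by rewrite /pochhammer big_ord0 mul1r.
rewrite pochhammerS mulrAC ih addSn factS natrM [RHS]mulrC; congr (_ * _).
by rewrite -natr1 natrD; ring.
Qed.

Let fact_gt0R n : 0 < n`!%:R :> R.
Proof. by rewrite ltr0n fact_gt0. Qed.

Let conj_exprz w (n : nat) z : conj (w ^+ n) * z ^+ n = (z * conj w) ^+ n.
Proof. by rewrite rmorphXn exprMn mulrC. Qed.

Let div_rtocX xi (x : R) n : (xi / rtoc x) ^+ n = xi ^+ n * rtoc (x ^+ n)^-1.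
Proof. by rewrite expr_div_n -rmorphXn -fmorphV. Qed.

Let low_term w z (n : nat) : (n < m)%N -> kc w n%:Z * z ^+ n =
  rtoc (pochhammer A n / pochhammer B n) * (z * conj w / rtoc (r ^+ 2)) ^+ n.
Proof.
move=> nm; rewrite /kc /kernel_coef ifT; last by apply/andP; split; [|rewrite ltz_nat].
rewrite -[w ^ n%:Z]/(w ^+ n) mulrAC conj_exprz c_nat div_rtocX -fmorphV.
rewrite mulrCA -rmorphM; congr (_ * rtoc _).
have b := pochhammer_gt0 n B_gt0; have a := pochhammer_gt0 n A_gt0.
have := exprn_gt0 n (exprn_gt0 2 r_gt0).
move: (r ^+ 2 ^+ n) (pochhammer A n) (pochhammer B n) a b => x y t y0 t0 x0.
by field; rewrite !gt_eqF.
Qed.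

Let hyper_term xi (j : nat) : CC R :=
  rtoc ((\prod_(c <- [:: 1; 1; 1; A]) pochhammer c j) /
        (\prod_(c <- [:: m%:R + 1; m%:R + 1; B]) pochhammer c j))
  * ((xi / rtoc (r ^+ 2)) ^+ j / j`!%:R).

(** In degree [j + m] the factorials of [falling] are [(j + m)! / j!], that is
    [m! (m + 1)_j / (1)_j]; this is where the parameters 1, 1 and [m + 1],
    [m + 1] come from, while the third parameter 1 cancels the factorial in the
    definition of the hypergeometric series. *)
Let high_term w z (j : nat) : kc w (j + m)%N%:Z * z ^+ (j + m) =
  (z * conj w) ^+ m / (m`!%:R ^+ 2) * hyper_term (z * conj w) j.
Proof.
rewrite /kc /kernel_coef ifF; last by apply/negP; rewrite ltz_nat; lia.
rewrite PoszD addrK ifT; last by rewrite (@le_trans _ _ 0) ?oppr_le0.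
rewrite -PoszD -[w ^ (j + m)%N%:Z]/(w ^+ (j + m)) mulrAC conj_exprz c_nat.
rewrite /hyper_term !big_cons !big_nil !mulr1 !pochhammer1.
move: (z * conj w) => xi.
have e n : n`!%:R = rtoc n`!%:R :> CC R by rewrite rmorph_nat.
rewrite !e div_rtocX -rmorphXn -!fmorphV exprD.
pose X := (falling m (j + m)%N ^+ 2 * (r ^+ 2 ^+ j * pochhammer B j / pochhammer A j))^-1.
pose Y := (m`!%:R ^+ 2)^-1 * (j`!%:R * (j`!%:R * (j`!%:R * pochhammer A j)) /
  (pochhammer (m%:R + 1) j * (pochhammer (m%:R + 1) j * pochhammer B j)) *
  ((r ^+ 2 ^+ j)^-1 * (j`!%:R)^-1)).
have XY : X = Y.
  rewrite /X /Y; have f1 := falling_nat m j; have f2 := pochhammer_fact m j.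
  have f0 : 0 < falling m (j + m)%N%:Z :> R.
    by apply: lt_le_trans (falling_nat_ge1 m j); exact: ltr01.
  have P0 : 0 < pochhammer (m%:R + 1) j :> R by apply: pochhammer_gt0; rewrite ltr_wpDl.
  have fe : falling m (j + m)%N%:Z = pochhammer (m%:R + 1) j * m`!%:R / j`!%:R :> R.
    by apply: (canRL (mulfK _)); rewrite ?f1 ?f2// gt_eqF.
  have b := pochhammer_gt0 j B_gt0; have a := pochhammer_gt0 j A_gt0.
  rewrite fe; have := exprn_gt0 j (exprn_gt0 2 r_gt0).
  move: (fact_gt0R m) (fact_gt0R j) a b P0.
  move: (r ^+ 2 ^+ j) (pochhammer A j) (pochhammer B j) (m`!%:R : R) (j`!%:R : R)
    (pochhammer (m%:R + 1) j) => x1 x2 x3 x4 x5 x6 h4 h5 h2 h3 h6 h1.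
  by field; rewrite !gt_eqF.
rewrite -/X XY /Y !rmorphM/=; ring.
Qed.

(** Dropping the first [m] terms and the factor in front turns the convergence
    of the expansion into that of the hypergeometric series. *)
Let kernel_low_and_hypergeometric w z : z != 0 -> w != 0 ->
  cvgn (series (fun k : nat => kc w k%:Z * z ^ k%:Z)) ->
  limn (series (fun k : nat => kc w k%:Z * z ^ k%:Z)) =
  \sum_(n < m) rtoc (pochhammer A n / pochhammer B n) * (z * conj w / rtoc (r ^+ 2)) ^+ n +
  (z * conj w) ^+ m / (m`!%:R ^+ 2) *
    hypergeometric [:: 1; 1; 1; A] [:: m%:R + 1; m%:R + 1; B] (z * conj w / rtoc (r ^+ 2)).
Proof.
move=> z0 w0 cv; set S := series _ in cv *; set xi := z * conj w.
pose c0 : CC R := xi ^+ m / (m`!%:R ^+ 2).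
have xi0 : xi != 0 by rewrite mulf_neq0// -modulus_eq0 modulus_conj modulus_eq0.
have c00 : c0 != 0.
  by rewrite mulf_neq0 ?expf_neq0// invr_neq0// expf_neq0// pnatr_eq0 -lt0n fact_gt0.
set L := \sum_(n < m) _.
have SE N : S (N + m)%N = L + c0 * series (hyper_term xi) N.
  elim: N => [|N ih].
    rewrite add0n /S /series/= big_mkord [X in _ * X]big_geq// mulr0 addr0.
    by apply: eq_bigr => n _; rewrite low_term.
  rewrite addSn /S !seriesSr -/S ih mulrDr addrA; congr (_ + _).
  by rewrite -high_term.
have cS : S (N + m)%N @[N --> \oo] --> limn S by rewrite (cvg_shiftn m S); exact: cv.
rewrite (funext SE) in cS.
have cH : series (hyper_term xi) @ \oo --> c0^-1 * (limn S - L).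
  have -> : series (hyper_term xi) = (fun N => c0^-1 * ((L + c0 * series (hyper_term xi) N) - L)).
    by apply/funext => N; rewrite addrAC subrr add0r mulKf.
  by apply: cvgMl_tmp; apply: cvgB; [exact: cS|exact: cvg_cst].
have -> : hypergeometric [:: 1; 1; 1; A] [:: m%:R + 1; m%:R + 1; B] (xi / rtoc (r ^+ 2)) =
    c0^-1 * (limn S - L).
  exact: (cvg_lim (@norm_hausdorff _ (CC R)) cH).
by rewrite mulVKf// addrC subrK.
Qed.

(** In degree [- (k + 1)] the [m]-th derivative has degree [- (m + k + 1)], and
    its squared norm is a quotient of Gamma values. *)
Let principal_term w z k : z != 0 -> w != 0 -> (k < p - m)%N ->
  kc w (Negz k) * z ^ Negz k = rtoc (r ^+ (2 * m)) *
   (rtoc (Gamma (alpha + beta + 1 - m%:R - k%:R) / Gamma (beta - m%:R - k%:R)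
          * (Gamma (beta + 1) / Gamma (alpha + beta + 2))
          * (k`!%:R / (m + k)`!%:R) ^+ 2)
    * (rtoc (r ^+ 2) / (z * conj w)) ^+ k.+1).
Proof.
move=> z0 w0 kp; rewrite /kc /kernel_coef (_ : (0 <= Negz k < m%:Z) = false)//.
rewrite ifT; last by lia.
have -> : Negz k - m%:Z = - (m + k).+1%:Z by lia.
have jp : ((m + k).+1 <= p)%N by lia.
have cE : c (- (m + k).+1%:Z) = (r ^+ 2) ^- (m + k).+1 * (Gamma (alpha + beta + 2) / Gamma (beta + 1)) *
    (Gamma (beta + 1 - (m + k).+1%:R) / Gamma (alpha + beta + 2 - (m + k).+1%:R)).
  exact: (monomial_norm_neg r_gt0 alpha_gtN1 beta0_gtN1 beta0_le0 beta_def jp).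
have e1 : beta + 1 - (m + k).+1%:R = beta - m%:R - k%:R by rewrite -[(m + k).+1%:R]natr1 natrD; ring.
have e2 : alpha + beta + 2 - (m + k).+1%:R = alpha + beta + 1 - m%:R - k%:R.
  by rewrite -[(m + k).+1%:R]natr1 natrD; ring.
rewrite e1 e2 in cE; rewrite cE.
have jR : (m + k).+1%:R <= p%:R :> R by rewrite ler_nat.
have al := alpha_gtN1; have be := beta0_gtN1.
have g1 : 0 < Gamma (beta - m%:R - k%:R).
  by clear cE; apply: Gamma_gt0; rewrite -e1 beta_def; lra.
have g2 : 0 < Gamma (alpha + beta + 1 - m%:R - k%:R).
  by clear cE; apply: Gamma_gt0; rewrite -e2 beta_def; lra.
have g3 : 0 < Gamma (beta + 1) by exact: Gamma_gt0 B_gt0.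
have g4 : 0 < Gamma (alpha + beta + 2) by exact: Gamma_gt0 A_gt0.
move: g1 g2 g3 g4.
move: (Gamma (beta - m%:R - k%:R)) (Gamma (alpha + beta + 1 - m%:R - k%:R))
  (Gamma (beta + 1)) (Gamma (alpha + beta + 2)) => G1 G2 G3 G4 g1 g2 g3 g4.
have xi0 : z * conj w != 0 by rewrite mulf_neq0// -modulus_eq0 modulus_conj modulus_eq0.
have -> : conj (w ^ Negz k) / rtoc (falling m (Negz k) ^+ 2 *
     ((r ^+ 2) ^- (m + k).+1 * (G4 / G3) * (G1 / G2))) * z ^ Negz k =
   rtoc (falling m (Negz k) ^+ 2 * ((r ^+ 2) ^- (m + k).+1 * (G4 / G3) * (G1 / G2)))^-1 *
   (z * conj w) ^- k.+1.
  move: (_ * (_ * _ * _)) => X.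
  have -> : conj (w ^ Negz k) = conj w ^- k.+1.
    by rewrite -[w ^ Negz k]/((w ^+ k.+1)^-1) fmorphV rmorphXn.
  by rewrite -[z ^ Negz k]/((z ^+ k.+1)^-1) exprMn invfM fmorphV/=; ring.
have -> : (rtoc (r ^+ 2) / (z * conj w)) ^+ k.+1 = rtoc ((r ^+ 2) ^+ k.+1) * (z * conj w) ^- k.+1.
  by rewrite expr_div_n -rmorphXn.
move: ((z * conj w) ^- k.+1) => xi.
have fe : falling m (Negz k) ^+ 2 = (m + k)`!%:R ^+ 2 / k`!%:R ^+ 2 :> R.
  by rewrite -falling_neg mulfK// expf_neq0// gt_eqF.
have -> : (falling m (Negz k) ^+ 2 * ((r ^+ 2) ^- (m + k).+1 * (G4 / G3) * (G1 / G2)))^-1 =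
    r ^+ (2 * m) * (G2 / G1 * (G3 / G4) * (k`!%:R / (m + k)`!%:R) ^+ 2) * (r ^+ 2) ^+ k.+1.
  rewrite fe exprM -addnS exprD; have := exprn_gt0 2 r_gt0; move: (r ^+ 2) => x x0.
  have := exprn_gt0 m x0; have := exprn_gt0 k.+1 x0; move: (fact_gt0R k) (fact_gt0R (m + k)).
  move: (x ^+ m) (x ^+ k.+1) (k`!%:R : R) ((m + k)`!%:R : R) => x1 x2 x3 x4 h3 h4 h2 h1.
  by field; rewrite !gt_eqF.
move: (r ^+ (2 * m)) (G2 / G1 * _ * _) ((r ^+ 2) ^+ k.+1) => a1 a2 a3.
by rewrite !rmorphM/=; ring.
Qed.

Let kernel_principalE w z : z != 0 -> w != 0 ->
  limn (series (fun k : nat => kc w (Negz k) * z ^ Negz k)) =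
  kernel_principal r m p alpha beta (z * conj w).
Proof.
move=> z0 w0; have kn k : (p - m <= k)%N -> kc w (Negz k) = 0.
  move=> pk; rewrite /kc /kernel_coef (_ : (0 <= Negz k < m%:Z) = false)// ifF//.
  by apply/negP; lia.
have -> : kernel_principal r m p alpha beta (z * conj w) =
    \sum_(k < p - m) kc w (Negz k) * z ^ Negz k.
  rewrite /kernel_principal; case: leqP => pm.
    by rewrite (_ : (p - m)%N = 0%N) ?big_ord0//; lia.
  by rewrite mulr_sumr; apply: eq_bigr => k _; rewrite principal_term.
apply: (cvg_lim (@norm_hausdorff _ (CC R))); apply: cvg_near_cst.
exists (p - m)%N => // N /= pN; rewrite /series/= -(big_mkord xpredT (fun k => kc w (Negz k) * z ^ Negz k)).
rewrite (big_cat_nat (n := (p - m)%N))//= [X in _ + X]big_nat_cond [X in _ + X]big1 ?addr0//.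
by move=> k /andP[/andP[pk _] _]; rewrite kn// mul0r.
Qed.

Lemma kernel_profile_laurent_sum w z : growth r (kernel_coef m p c w) ->
  pdisc r w -> pdisc r z ->
  kernel_profile r m p alpha beta (z * conj w) = laurent_sum (kernel_coef m p c w) z.
Proof.
move=> gk /pdiscP[w0 w1] /pdiscP[z0 z1]; have [c1 _ _] := growth_cvg gk z0 z1.
by rewrite (laurent_sum_split gk z0 z1) (kernel_low_and_hypergeometric z0 w0 c1) kernel_principalE.
Qed.

End KernelProfile.

Theorem theorem1 (R : realType) (r : R) (m : nat) (alpha beta0 beta : R)
    (p : nat) (r_gt0 : 0 < r) (alpha_gtN1 : - 1 < alpha)
    (beta0_gtN1 : - 1 < beta0) (beta0_le0 : beta0 <= 0)
    (beta_def : beta = beta0 + p%:R) :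
  reproducing_kernel (pdisc r) (bergman_dirichlet r m alpha beta)
    (bergman_dirichlet_ip r m alpha beta)
    (fun z w => kernel_profile r m p alpha beta (z * conj w)).
Proof.
move=> w wr.
have gk := growth_kernel_coef m r_gt0 alpha_gtN1 beta0_gtN1 beta0_le0 beta_def wr.
have Kk z (zr : pdisc r z) := kernel_profile_laurent_sum
  r_gt0 alpha_gtN1 beta0_gtN1 beta0_le0 beta_def gk wr zr.
split.
  exact: (kernel_in_bergman_dirichlet r_gt0 alpha_gtN1 beta0_gtN1 beta0_le0 beta_def wr Kk).
move=> f Hf.
exact: (bergman_dirichlet_reproducing r_gt0 alpha_gtN1 beta0_gtN1 beta0_le0 beta_def wr Hf Kk).
Qed.
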